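(* Let $D$ be a convex bounded domain in $\mathbb{C}^N$ and $q\in\{0,\ldots,N-2\}$. Suppose that there are a constant $\alpha\ge 0$ and a complex affine plane $\pi_0$ of codimension $q$ intersecting $D$ such that $$\dim_H\check{S}_{\mathcal{O}_0(\overline{D}\cap\pi)}\ge\alpha$$ for every complex affine plane $\pi$ of codimension $q$ which is parallel to $\pi_0$ and lies nearby $\pi_0$ (i.e. for all sufficiently small translates of $\pi_0$). Then $$\dim_H\check{S}_{\mathcal{O}_q(\overline{D})}\ge\alpha+2q.$$ In particular (for every convex bounded domain $D$ in $\mathbb{C}^N$, $N\geq 2$), $\dim_H\check{S}_{\mathcal{O}_{N-2}(\overline{D})}\ge 2N-2$.
   Context: $\dim_H$ is the Hausdorff dimension. Shilov boundary: for a compact Hausdorff space $K$ and a set $\mathcal{B}$ of complex-valued continuous functions on $K$, a closed boundary is a closed set $S\subset K$ which, for every $f\in\mathcal{B}$, contains a point at which $|f|$ attains $\max_K|f|$; $\check{S}_{\mathcal{B}}$ is the intersection of all closed boundaries. For open $U\subset\mathbb{C}^N$, $\mathcal{O}_q(U)$ is the set of complex-valued $f\in\mathcal{C}^2(U)$ with $\overline{\partial}f\wedge(\partial\overline{\partial}f)^q=0$ ($q$-holomorphic functions). For compact $K\subset\mathbb{C}^N$, $\mathcal{O}_q(K)$ is the set of continuous functions on $K$ which extend to a function in $\mathcal{O}_q(U)$ for some open neighborhood $U$ of $K$. For a complex affine plane $\pi$ of codimension $q$, identified with $\mathbb{C}^{N-q}$, $\mathcal{O}_0(\overline{D}\cap\pi)$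 is the set of continuous functions on $\overline{D}\cap\pi$ which extend holomorphically to a neighborhood of $\overline{D}\cap\pi$ in $\pi$. *)

(* Defs.v *)
From HB Require Import structures.
From mathcomp Require Import all_boot all_order all_algebra.
From mathcomp Require Import all_classical all_reals all_analysis.
From mathcomp Require Import complex.

Set Implicit Arguments.
Unset Strict Implicit.
Unset Printing Implicit Defensive.

Import Order.TTheory GRing.Theory Num.Theory.
Import numFieldNormedType.Exports.

Local Open Scope classical_set_scope.
Local Open Scope ring_scope.
Local Open Scope complex_scope.

(* The library puts the topology of a numFieldType [K] on [K^o]; it has no
   instance for the concrete type [R[i]]. C^n is then ['rV[R[i]]_n], whose
   library norm is the [R[i]]-valued max norm. *)
HB.instance Definition _ (R : realType) := PseudoPointedMetric.copy R[i] R[i]^o.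
HB.instance Definition _ (R : realType) := NormedModule.copy R[i] R[i]^o.

Section Hausdorff_dimension.
Context {R : realType} {T : Type} (d : T -> T -> R).
Local Open Scope ereal_scope.

(* Equals -oo on the empty set. *)
Definition diameter (A : set T) : \bar R :=
  ereal_sup [set (d p.1 p.2)%:E | p in A `*` A].

(* The term diam(A)^s, with 0^0 = 1 for nonempty [A] and 0 for empty [A]. *)
Definition diam_pow (s : R) (A : set T) : \bar R :=
  if A == set0 then 0 else poweR (diameter A) s.

Definition hausdorff_premeasure (s delta : R) (E : set T) : \bar R :=
  ereal_inf [set \sum_(0 <= i <oo) diam_pow s (V i) | V in
    [set V : (set T)^nat | E `<=` \bigcup_i V i /\
                           forall i, diameter (V i) <= delta%:E]].

Definition hausdorff_measure (s : R) (E : set T) : \bar R :=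
  ereal_sup [set hausdorff_premeasure s delta E | delta in
    [set delta : R | (0 < delta)%R]].

Definition hausdorff_dim (E : set T) : \bar R :=
  ereal_inf [set s%:E | s in
    [set s : R | (0 <= s)%R /\ hausdorff_measure s E = 0]].

End Hausdorff_dimension.

Section Shilov_boundary.
Context {R : realType} {T : topologicalType}.

(* Functions on [K] are represented by total functions on [T], of which only
   the values on [K] are used. *)
Definition closed_boundary (K : set T) (B : set (T -> R[i])) (S : set T) :=
  [/\ closed S, S `<=` K &
      forall f, B f -> exists2 z, S z & forall w, K w -> `|f w| <= `|f z|].

(* The intersection is taken inside the space [K]. *)
Definition shilov_boundary (K : set T) (B : set (T -> R[i])) : set T :=
  K `&` \bigcap_(S in closed_boundary K B) S.

End Shilov_boundary.

Section Real_derivatives.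
Context {R : realType} {n : nat}.
Local Notation C := R[i].
Local Notation Cn := 'rV[C]_n.
Local Notation iC := (0 +i* 1 : C).
Implicit Types (f : Cn -> C) (z v : Cn) (U : set Cn).

Definition re_along f z v (t : R) : R := complex.Re (f (z + t%:C *: v)).
Definition im_along f z v (t : R) : R := complex.Im (f (z + t%:C *: v)).

(* Derivatives with respect to a real parameter: [t] ranges over [R]. *)
Definition rderivable f z v : Prop :=
  derivable (re_along f z v) 0 1 /\ derivable (im_along f z v) 0 1.

Definition rderive f v z : C :=
  derive1 (re_along f z v) 0 +i* derive1 (im_along f z v) 0.

(* With z_j = x_j + i y_j, the real coordinate directions of C^n. *)
Definition x_dir (j : 'I_n) : Cn := delta_mx 0 j.
Definition y_dir (j : 'I_n) : Cn := iC *: delta_mx 0 j.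

(* [contDiff k U f]: on the open set [U], the partial derivatives of [f] of
   order at most [k] in the 2n real coordinates exist and are continuous. *)
Fixpoint contDiff (k : nat) U f : Prop :=
  (forall z, U z -> {for z, continuous f}) /\
  if k is k'.+1 then
    forall j : 'I_n,
      [/\ forall z, U z -> rderivable f z (x_dir j),
          forall z, U z -> rderivable f z (y_dir j),
          contDiff k' U (rderive f (x_dir j)) &
          contDiff k' U (rderive f (y_dir j))]
  else True.

(* The Wirtinger derivatives. *)
Definition d_dz (j : 'I_n) f z : C :=
  2^-1 * (rderive f (x_dir j) z - iC * rderive f (y_dir j) z).
Definition d_dzbar (j : 'I_n) f z : C :=
  2^-1 * (rderive f (x_dir j) z + iC * rderive f (y_dir j) z).

End Real_derivatives.

Section Differential_forms.
Context {R : realType} {n : nat}.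
Local Notation C := R[i].
Local Notation Cn := 'rV[C]_n.

(* The complex exterior algebra on the 2n generators
   dz_1, ..., dz_n, dzbar_1, ..., dzbar_n, in this order: the value of a form
   at [S] is its coefficient on the exterior product, in increasing order, of
   the generators whose index lies in [S]. *)
Definition ext_form := {ffun {set 'I_(n + n)} -> C}.

Definition inversions (A B : {set 'I_(n + n)}) : nat :=
  #|[set p in finset.setX A B | (p.2 < p.1)%N]%SET|.

Definition wedge (a b : ext_form) : ext_form :=
  [ffun S : {set 'I_(n + n)} => \sum_(A : {set 'I_(n + n)} | A \subset S)
     (-1) ^+ inversions A (S :\: A) * (a A * b (S :\: A))].

Definition ext_scalar (c : C) : ext_form := [ffun S => if S == finset.set0 then c else 0].

Definition wedge_exp (a : ext_form) (q : nat) : ext_form := iter q (wedge a) (ext_scalar 1).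

Definition dz (j : 'I_n) : ext_form :=
  [ffun S => (S == [set lshift n j]%SET)%:R].
Definition dzbar (j : 'I_n) : ext_form :=
  [ffun S => (S == [set rshift n j]%SET)%:R].

Definition del (w : Cn -> ext_form) (z : Cn) : ext_form :=
  \sum_(j < n) wedge (dz j) [ffun S => d_dz j (fun y => w y S) z].
Definition delbar (w : Cn -> ext_form) (z : Cn) : ext_form :=
  \sum_(j < n) wedge (dzbar j) [ffun S => d_dzbar j (fun y => w y S) z].

End Differential_forms.
Arguments ext_form : clear implicits.

Section q_holomorphic.
Context {R : realType}.
Local Notation C := R[i].

Definition q_holomorphic {n} (q : nat) (U : set 'rV[C]_n) : set ('rV[C]_n -> C) :=
  [set f | contDiff 2 U f /\
    forall z, U z ->
      let F : 'rV[C]_n -> ext_form R n := fun y => ext_scalar (f y) in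
      wedge (delbar F z) (wedge_exp (del (delbar F) z) q) = 0].

Definition q_holomorphic_on {n} (q : nat) (K : set 'rV[C]_n) :
    set ('rV[C]_n -> C) :=
  [set f | {within K, continuous f} /\
    exists U : set 'rV[C]_n, exists g : 'rV[C]_n -> C,
      [/\ open U, K `<=` U, q_holomorphic q U g & forall z, K z -> f z = g z]].

(* For [A] of rank [m], an [m]-dimensional complex affine plane through [p],
   identified with C^m by the parametrization [plane_param A p]. *)
Definition plane_param {m n} (A : 'M[C]_(m, n)) (p : 'rV[C]_n)
  (w : 'rV[C]_m) : 'rV[C]_n := p + w *m A.

Definition affine_plane {m n} (A : 'M[C]_(m, n)) (p : 'rV[C]_n) :
  set 'rV[C]_n := range (plane_param A p).

Definition holomorphic_on_plane {m n} (A : 'M[C]_(m, n)) (p : 'rV[C]_n)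
    (K : set 'rV[C]_n) : set ('rV[C]_n -> C) :=
  [set f | {within K, continuous f} /\
    exists U : set 'rV[C]_m, exists g : 'rV[C]_m -> C,
      [/\ open U, plane_param A p @^-1` K `<=` U, q_holomorphic 0 U g &
          forall w, K (plane_param A p w) -> f (plane_param A p w) = g w]].

Definition euclidean_dist {n} (z w : 'rV[C]_n) : R :=
  Num.sqrt (\sum_(j < n) ((complex.Re (z 0 j - w 0 j)) ^+ 2 +
                          (complex.Im (z 0 j - w 0 j)) ^+ 2)).

Definition dimH {n} (E : set 'rV[C]_n) : \bar R := hausdorff_dim euclidean_dist E.

(* In [convex_set] the weight lies between 0 and 1 for the partial order of
   [R[i]], in which elements comparable to 0 are real: this is the usual
   (real) convexity. *)
Definition convex_bounded_domain {n} (D : set 'rV[C]_n) : Prop :=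
  [/\ open D, connected D, D !=set0, convex_set D & bounded_set D].

End q_holomorphic.

(* Main.v *)
(* Let X be the Shilov boundary for O_q on the closure of D. If g is holomorphic
   near a slice of codimension q, then max(0, 1 - |zeta|^2 / e)^k g, with zeta the
   q coordinates transverse to the slice, is q-holomorphic, equals g on the slice
   and concentrates on it as k grows; hence X contains the Shilov boundary of every
   slice. Cutting an H^s-null set along 2q real linear functionals leaves, for
   suitable arbitrarily small levels, an H^(s-2q)-null set, which is empty when
   s < 2q. This gives the first claim.

   For the second claim, suppose that H^s X = 0 with s < 2N - 2. Cutting along
   2N - 4 real functionals leaves a two-dimensional slice whose Shilov boundary X'
   is null in some dimension s' < 2, and two more cuts give a line {w_0 = c} that
   meets the slice of D but stays at positive distance from X'. Through every point
   of the boundary of the slice passes a complex line (a leaf) that misses its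
   interior, and on a ray of a leaf the last point of the slice lies in X'. Leaves
   through n points on {w_0 = c} and n rays in each give n^2 points of X' whose
   s'-energy is bounded uniformly in n, which contradicts covers of X' of small
   s'-dimensional size. *)
From HB Require Import structures.
Require Import Defs.
From mathcomp Require Import all_boot all_order all_algebra.
From mathcomp Require Import all_classical all_reals all_analysis.
From mathcomp Require Import complex.
From mathcomp Require Import measurable_realfun ring lra zify.
Import Order.TTheory GRing.Theory Num.Theory.
Import numFieldNormedType.Exports.
Local Open Scope classical_set_scope.
Local Open Scope ring_scope.
Local Open Scope complex_scope.

Set Implicit Arguments.
Unset Strict Implicit.
Unset Printing Implicit Defensive.

(** * Complex numbers and row vectors *)

(** The bound in the second claim comes from an energy kernel that splits into three factors. Number
    the leaves by i and the rays by j, with indices scaled to [0, 1]. The radius at which a ray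
    meets X' depends on (i, j) without any regularity, so distances have to be bounded below
    uniformly in the radii. Two such bounds exist. Points on rays of different directions are at
    least a multiple of z = |j - j'| apart, because radii stay away from 0 on X'. Two leaves, seen
    as graphs over the first coordinate, force a distance of at least a multiple of x y, where x =
    |i - i'| and y is the distance from j to the one direction, depending on (i, i'), near which the
    leaves may meet. Together they bound the squared distance below by a multiple of x y z. The
    kernel of exponent s' is thus dominated by a product of three powers of exponent -s'/2, each
    with sums linear in n because s' < 2. Finite sums and finite covers take the place of a measure
    on X', so no measurable choice of points is made. *)

Section complex_modulus.
Context {R : realType}.
Local Notation C := R[i].
Implicit Types (x y z : C).
Local Notation Re := (@complex.Re R).
Local Notation Im := (@complex.Im R).

(** Squared modulus with values in [R]: the norm of [R[i]] takes values in [R[i]], whereas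
    polynomial inequalities are to be solved in an ordered field. *)
Definition nsq z : R := Re z ^+ 2 + Im z ^+ 2.

Lemma cReD x y : Re (x + y) = Re x + Re y. Proof. by case: x; case: y. Qed.
Lemma cImD x y : Im (x + y) = Im x + Im y. Proof. by case: x; case: y. Qed.
Lemma cReN x : Re (- x) = - Re x. Proof. by case: x. Qed.
Lemma cImN x : Im (- x) = - Im x. Proof. by case: x. Qed.
Lemma cReB x y : Re (x - y) = Re x - Re y. Proof. by rewrite cReD cReN. Qed.
Lemma cImB x y : Im (x - y) = Im x - Im y. Proof. by rewrite cImD cImN. Qed.
Lemma cReM x y : Re (x * y) = Re x * Re y - Im x * Im y.
Proof. by case: x; case: y. Qed.
Lemma cImM x y : Im (x * y) = Re x * Im y + Im x * Re y.
Proof. by case: x; case: y. Qed.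
Lemma cRe_real (a : R) : Re a%:C = a. Proof. by []. Qed.
Lemma cIm_real (a : R) : Im a%:C = 0. Proof. by []. Qed.
Lemma cRe0 : Re 0 = 0. Proof. by []. Qed.
Lemma cIm0 : Im 0 = 0. Proof. by []. Qed.
Lemma cRe1 : Re 1 = 1. Proof. by []. Qed.
Lemma cIm1 : Im 1 = 0. Proof. by []. Qed.
Lemma cRe_conj x : Re (conjc x) = Re x. Proof. by case: x. Qed.
Lemma cIm_conj x : Im (conjc x) = - Im x. Proof. by case: x. Qed.

Lemma cRe_mk (a b : R) : Re (a +i* b) = a. Proof. by []. Qed.
Lemma cIm_mk (a b : R) : Im (a +i* b) = b. Proof. by []. Qed.

Definition cReImE := (cRe_mk, cIm_mk, cReD, cImD, cReN, cImN, cReM, cImM, cRe_real, cIm_real, cRe_conj, cIm_conj,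
  cRe0, cIm0, cRe1, cIm1).

Lemma complexP x y : Re x = Re y -> Im x = Im y -> x = y.
Proof. by case: x; case: y => a b c d /= -> ->. Qed.

Lemma nsqM x y : nsq (x * y) = nsq x * nsq y.
Proof. by rewrite /nsq !cReImE; ring. Qed.
Lemma nsq_ge0 x : 0 <= nsq x.
Proof. by rewrite addr_ge0 ?sqr_ge0. Qed.
Lemma nsq0 : nsq 0 = 0. Proof. by rewrite /nsq !expr0n addr0. Qed.
Lemma nsq1 : nsq 1 = 1. Proof. by rewrite /nsq /= expr0n expr1n addr0. Qed.
Lemma nsq_eq0 x : (nsq x == 0) = (x == 0).
Proof. by rewrite /nsq paddr_eq0 ?sqr_ge0// !sqrf_eq0 [RHS]eq_complex. Qed.
Lemma nsqX x k : nsq (x ^+ k) = nsq x ^+ k.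
Proof. by elim: k => [|k IH]; rewrite ?expr0 ?nsq1// !exprS nsqM IH. Qed.
Lemma nsq_real (a : R) : nsq a%:C = a ^+ 2.
Proof. by rewrite /nsq /= expr0n addr0. Qed.
Lemma nsqN x : nsq (- x) = nsq x.
Proof. by rewrite /nsq cReN cImN !sqrrN. Qed.
Lemma nsq_conj x : nsq (conjc x) = nsq x.
Proof. by rewrite /nsq cRe_conj cIm_conj sqrrN. Qed.

Lemma ler_norm_nsq x y : (`|x| <= `|y|) = (nsq x <= nsq y).
Proof. by rewrite !normc_def lecR ler_sqrt// nsq_ge0. Qed.

Lemma ltr_norm_nsq x (e : R) : 0 < e -> (`|x| < e%:C) = (nsq x < e ^+ 2).
Proof.
by move=> e0; rewrite normc_def ltcR -{1}(ger0_norm (ltW e0)) -sqrtr_sqr ltr_sqrt ?exprn_gt0.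
Qed.

Lemma cRe_sq_le x : Re x ^+ 2 <= nsq x. Proof. by rewrite lerDl sqr_ge0. Qed.
Lemma cIm_sq_le x : Im x ^+ 2 <= nsq x. Proof. by rewrite lerDr sqr_ge0. Qed.

Lemma pos_complex_real (e : C) : 0 < e -> exists2 d : R, 0 < d & e = d%:C.
Proof.
by case: e => a b; rewrite ltcE /= => /andP[/eqP -> a0]; exists a.
Qed.

Lemma sqr_ltr_norm (a e : R) : 0 < e -> a ^+ 2 < e ^+ 2 -> `|a| < e.
Proof.
move=> e0 h; rewrite ltr_norml; apply/andP; split; rewrite ltNge; apply/negP => h'; nra.
Qed.

Lemma Re_continuous : continuous Re.
Proof.
move=> z s /nbhs_ballP [e /= e0 es]; apply/nbhs_ballP; exists e%:C; rewrite /= ?ltcR//.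
move=> w; rewrite /ball /= ltr_norm_nsq// => h; apply: es; rewrite /ball /= -cReB.
apply: sqr_ltr_norm => //; exact: le_lt_trans (cRe_sq_le _) h.
Qed.

Lemma Im_continuous : continuous Im.
Proof.
move=> z s /nbhs_ballP [e /= e0 es]; apply/nbhs_ballP; exists e%:C; rewrite /= ?ltcR//.
move=> w; rewrite /ball /= ltr_norm_nsq// => h; apply: es; rewrite /ball /= -cImB.
apply: sqr_ltr_norm => //; exact: le_lt_trans (cIm_sq_le _) h.
Qed.

Lemma complex_cvg (T : Type) (F : set_system T) {FF : Filter F} (f : T -> C) (l : C) :
  Re (f x) @[x --> F] --> Re l -> Im (f x) @[x --> F] --> Im l -> f x @[x --> F] --> l.
Proof.
move=> /cvgrPdist_lt fr /cvgrPdist_lt fi.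
apply/cvgrPdist_lt => e /pos_complex_real [d d0 ->].
have d20 : 0 < d / 2 by rewrite divr_gt0.
near=> x; rewrite ltr_norm_nsq//.
have h1 : `|Re l - Re (f x)| < d / 2 by near: x; exact: fr.
have h2 : `|Im l - Im (f x)| < d / 2 by near: x; exact: fi.
rewrite /nsq cReB cImB -(real_normK (num_real (Re l - _))) -(real_normK (num_real (Im l - _))).
move: h1 h2; move: `|_| `|_| (normr_ge0 (Re l - Re (f x))) (normr_ge0 (Im l - Im (f x))).
by move=> a b a0 b0 h1 h2; nra.
Unshelve. all: end_near. Qed.

Lemma real_complex_continuous : continuous (fun a : R => a%:C).
Proof. by move=> a; apply: complex_cvg => /=; [exact: cvg_id|exact: cvg_cst]. Qed.

Lemma conjc_continuous : continuous (fun z : C => conjc z).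
Proof.
move=> z; apply: (@complex_cvg _ (nbhs z)).
rewrite cRe_conj (_ : (fun x => _) = Re); first exact: Re_continuous.
  by apply/funext => x; rewrite cRe_conj.
rewrite cIm_conj (_ : (fun x => _) = (fun x => - Im x)); first by apply: cvgN; exact: Im_continuous.
by apply/funext => x; rewrite cIm_conj.
Qed.

Lemma nsq_continuous : continuous nsq.
Proof.
have -> : nsq = (fun z => Re z * Re z + Im z * Im z) by apply/funext => z; rewrite /nsq !expr2.
move=> z; exact: (cvgD (cvgM (@Re_continuous z) (@Re_continuous z)) (cvgM (@Im_continuous z) (@Im_continuous z))).
Qed.

Lemma compact_square (M : R) : compact [set z : C | `|Re z| <= M /\ `|Im z| <= M].
Proof.
have -> : [set z : C | `|Re z| <= M /\ `|Im z| <= M] =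
   (fun p : R * R => p.1 +i* p.2) @` (`[-M, M] `*` `[-M, M]).
  apply/seteqP; split => [z [h1 h2]|_ [[a b] [/= ha hb] <-]] /=.
    by exists (Re z, Im z) => /=; [rewrite !in_itv /= -!ler_norml|case: z h1 h2].
  by rewrite !in_itv /= -!ler_norml in ha hb.
apply: continuous_compact; last by apply: compact_setX; exact: segment_compact.
apply: continuous_subspaceT => p; apply: complex_cvg => /=; [exact: cvg_fst|exact: cvg_snd].
Qed.

End complex_modulus.

Section row_vectors.
Context {R : realType} {n : nat}.
Local Notation C := R[i].
Local Notation Cn := 'rV[C]_n.
Local Notation Re := (@complex.Re R).
Local Notation Im := (@complex.Im R).

Lemma rV_cvg (T : Type) (F : set_system T) {FF : Filter F} (f : T -> Cn) (l : Cn) :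
  (forall j, f x 0 j @[x --> F] --> l 0 j) -> f x @[x --> F] --> l.
Proof.
move=> fl; apply/cvgrPdist_lt => e e0.
have h : \forall x \near F, forall j, `|l 0 j - f x 0 j| < e.
  by apply: filter_forall => j; have /cvgrPdist_lt := fl j; exact.
near=> x; have hx : forall j, `|l 0 j - f x 0 j| < e by near: x.
suff : ball l e (f x) by rewrite mx_norm_ball.
by split => // i j; rewrite ord1; exact: hx.
Unshelve. all: end_near. Qed.

Lemma coord_cvg (z : Cn) j : w 0 j @[w --> z] --> z 0 j.
Proof. exact: coord_continuous. Qed.

Lemma bounded_closure_compact (A : set Cn) : bounded_set A -> compact (closure A).
Proof.
move=> [M [Mr bA]].
have [M' hM'] : exists M' : R, forall z, A z -> forall j, `|z 0 j| <= M'%:C.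
  (* The bound [M] is a real element of [R[i]]. One unit of room serves the strict inequality in
     [bA], the other the open ball. *)
  exists (Re (M + 2)) => z Az j.
  have hM1 : (Re (M + 2))%:C = M + 2 by rewrite RRe_real // realD.
  have := bA (M + 1) _ z Az; rewrite ltrDl ltr01 => /(_ isT) /= h.
  have : ball 0 (M + 2) z.
    by rewrite mx_norm_ball /ball_ /= sub0r normrN (le_lt_trans h)// ltrD2l ltr1n.
  by move=> [_ /(_ 0 j)]; rewrite /ball /= !mxE sub0r normrN hM1 => /ltW.
pose B := [set v : Cn | forall i, [set z : C | `|Re z| <= M' /\ `|Im z| <= M'] (v 0 i)].
have cB : compact B by apply: (@rV_compact C n (fun=> [set z : C | `|Re z| <= M' /\ `|Im z| <= M'])) => i; exact: compact_square.
suff AB : A `<=` B.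
  apply: (subclosed_compact _ cB); first exact: closed_closure.
  have clB : closed B by apply: compact_closed cB; exact: norm_hausdorff.
  by rewrite [X in _ `<=` X](closure_id B).1//; exact: closureS.
move=> z Az i /=.
have := hM' z Az i; rewrite normc_def lecR => h.
split; (apply: le_trans h; rewrite -sqrtr_sqr ler_sqrt ?nsq_ge0//);
  [exact: cRe_sq_le|exact: cIm_sq_le].
Qed.

End row_vectors.

(** * Null sets for Hausdorff measures *)

Section Hausdorff.
Context {R : realType} {T : Type} (d : T -> T -> R).
Hypothesis d_ge0 : forall x y, 0 <= d x y.
Implicit Types (E V : set T) (s : R).
Local Open Scope ereal_scope.

Lemma le_diameter V x y : V x -> V y -> (d x y)%:E <= diameter d V.
Proof. by move=> Vx Vy; apply: ereal_sup_ubound; exists (x, y). Qed.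

Lemma diameter_ge0 V : V !=set0 -> 0 <= diameter d V.
Proof. by move=> [x Vx]; apply: le_trans (le_diameter Vx Vx); rewrite lee_fin. Qed.

Lemma diameter_set0 : diameter d set0 = -oo.
Proof. by rewrite /diameter setX0 image_set0 ereal_sup0. Qed.

Lemma diameter_fin V (delta : R) : V !=set0 -> diameter d V <= delta%:E ->
  exists2 r : R, (0 <= r <= delta)%R & diameter d V = r%:E.
Proof.
move=> V0 h; have h0 := diameter_ge0 V0.
have : diameter d V \is a fin_num by rewrite ge0_fin_numE// (le_lt_trans h) ?ltry.
move=> hf; exists (fine (diameter d V)); last by rewrite fineK.
by rewrite fine_ge0 //= -lee_fin fineK.
Qed.

Lemma diam_pow_ge0 s V : 0 <= diam_pow d s V.
Proof. by rewrite /diam_pow; case: ifP => // _; exact: poweR_ge0. Qed.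

Lemma diam_pow_set0 s : diam_pow d s set0 = 0.
Proof. by rewrite /diam_pow eqxx. Qed.

Lemma diam_powE s V r : V !=set0 -> diameter d V = r%:E -> diam_pow d s V = (r `^ s)%:E.
Proof. by move=> /set0P V0 h; rewrite /diam_pow (negbTE V0) h poweR_EFin. Qed.

(** A supremum of nonnegative infima vanishes iff each of them does, so null sets are handled
    through explicit covers and no value of the measure is computed. *)
Definition small_covers s E := forall delta epsilon : R, (0 < delta)%R -> (0 < epsilon)%R ->
  exists V : (set T)^nat, [/\ E `<=` \bigcup_i V i,
    forall i, diameter d (V i) <= delta%:E &
    \sum_(0 <= i <oo) diam_pow d s (V i) <= epsilon%:E].

Lemma hausdorff_null s E : hausdorff_measure d s E = 0 <-> small_covers s E.
Proof.
have pre0 delta : 0 <= hausdorff_premeasure d s delta E.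
  apply: le_ereal_inf_tmp => _ [V _ <-]; apply: nneseries_ge0 => i _ _; exact: diam_pow_ge0.
split=> [h delta e delta0 e0|h].
  have : hausdorff_premeasure d s delta E < e%:E.
    apply: le_lt_trans (_ : 0 < _); last by rewrite lte_fin.
    by rewrite -h; apply: ereal_sup_ubound; exists delta.
  by move=> /ereal_inf_lt [_ [V [EV dV] <-] /ltW le]; exists V.
apply/eqP; rewrite eq_le; apply/andP; split.
  apply: ge_ereal_sup => _ [delta /= delta0 <-].
  apply/lee_addgt0Pr => e e0; rewrite add0e.
  have [V [EV dV sV]] := h _ _ delta0 e0.
  by apply: le_trans sV; apply: ereal_inf_lbound; exists V.
by apply: le_trans (pre0 1%R) _; apply: ereal_sup_ubound; exists 1%R => /=.
Qed.

Lemma hausdorff_null_sub s E E' : E `<=` E' ->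
  hausdorff_measure d s E' = 0 -> hausdorff_measure d s E = 0.
Proof.
move=> EE' /hausdorff_null h; apply/hausdorff_null => delta e d0 e0.
by have [V [? ? ?]] := h _ _ d0 e0; exists V; split => //; exact: subset_trans EE' _.
Qed.

Lemma hausdorff_null_le s t E : (0 <= s <= t)%R ->
  hausdorff_measure d s E = 0 -> hausdorff_measure d t E = 0.
Proof.
move=> /andP[s0 st] /hausdorff_null h; apply/hausdorff_null => delta e d0 e0.
have d1 : (0 < Num.min delta 1)%R by rewrite lt_min d0 ltr01.
have [V [EV dV sV]] := h _ _ d1 e0; exists V; split => //.
  by move=> i; apply: le_trans (dV i) _; rewrite lee_fin ge_min lexx.
apply: le_trans sV; apply: lee_nneseries => [i _ _|i _]; first exact: diam_pow_ge0.
have [->|/set0P V0] := eqVneq (V i) set0; first by rewrite !diam_pow_set0.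
have [r /andP[r0 r1] hr] := diameter_fin V0 (dV i).
rewrite !(diam_powE _ V0 hr) lee_fin.
(* Here 0^0 = 1 matters: [t = 0] forces [s = 0], so the comparison survives at [r = 0]. *)
have [->|rn0] := eqVneq r 0%R.
  rewrite /powR eqxx; case: (eqVneq t 0%R) => [t0|_]; case: (eqVneq s 0%R) => [s1|sn0];
    rewrite ?ler01 ?lexx//.
  by exfalso; move/eqP: sn0; apply; lra.
by apply: ger_powR => //; rewrite lt_neqAle eq_sym rn0 r0 (le_trans r1)// ge_min lexx orbT.
Qed.

Section slicing.
Variables (f : T -> R) (L : R).
Hypothesis L_gt0 : (0 < L)%R.
Hypothesis f_lip : forall x y, (`|f x - f y| <= L * d x y)%R.
Local Notation mu := (@lebesgue_measure R).

(** With r the diameter of [V], the interval of radius [L * r] about the image of one point has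
    length 2 L r, and r^(s-1) * 2 L r = 2 L r^s. An interval is used since the image of [V] itself
    may fail to be measurable. *)
Lemma lipschitz_shadow V (delta : R) : diameter d V <= delta%:E ->
  exists J : set R, [/\ measurable J, f @` V `<=` J &
    forall s, (1 <= s)%R ->
      diam_pow d (s - 1) V * mu J <= (2 * L)%:E * diam_pow d s V].
Proof.
move=> dV; have [->|/set0P V0] := eqVneq V set0.
  exists set0; split => [//||s _]; first by rewrite image_set0.
  by rewrite !diam_pow_set0 mul0e mule0.
have [r /andP[r0 _] hr] := diameter_fin V0 dV; have [v Vv] := V0.
exists `[(f v - L * r)%R, (f v + L * r)%R]%classic; split => [//|_ [w Vw <-]|s s1].
  rewrite /= in_itv /= -ler_distl (le_trans (f_lip _ _))// ler_pM2l//.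
  by rewrite -lee_fin -hr; exact: le_diameter.
rewrite lebesgue_measure_itv /= !(diam_powE _ V0 hr) lte_fin.
(* A degenerate interval has measure 0, which makes the product vanish whatever the value of
   0^(s-1). *)
case: ifPn => [h|_]; last by rewrite mule0 -EFinM lee_fin !mulr_ge0 ?powR_ge0 ?ltW.
rewrite -EFinB -!EFinM lee_fin.
have -> : (f v + L * r - (f v - L * r) = (2 * L) * r)%R by ring.
rewrite mulrCA ler_pM2l ?mulr_gt0//.
have rn0 : (0 < r)%R by move: h; rewrite ltrD2l -subr_gt0 opprK -mulr2n pmulrn_lgt0// pmulr_rgt0.
by rewrite -{2}(powRr1 (ltW rn0)) -powRD ?(gt_eqF rn0) ?implybT// subrK.
Qed.

(* Cover E for each n with total s-size 2^-n; by Fubini the (s - 1)-sizes of the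
   covers of the slices sum to an integrable function of the level. *)
Lemma slice_null s E (a b : R) : (1 <= s)%R -> (a < b)%R ->
  hausdorff_measure d s E = 0 ->
  exists2 c, (a < c < b)%R & hausdorff_measure d (s - 1) (E `&` f @^-1` [set c]) = 0.
Proof.
move=> s1 ab /hausdorff_null hE.
pose eps (n : nat) : R := (1 / (2 ^ n.+1)%:R)%R.
have eps0 n : (0 < eps n)%R by rewrite divr_gt0// ltr0n expn_gt0.
have /choice [V hV] : forall n, exists V : (set T)^nat, [/\ E `<=` \bigcup_i V i,
    forall i, diameter d (V i) <= (eps n)%:E &
    \sum_(0 <= i <oo) diam_pow d s (V i) <= (eps n)%:E] by move=> n; exact: hE.
have /choice [J' hJ'] : forall p : nat * nat, exists J : set R, [/\ measurable J,
    f @` (V p.1 p.2) `<=` J & forall s, (1 <= s)%R ->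
      diam_pow d (s - 1) (V p.1 p.2) * mu J <= (2 * L)%:E * diam_pow d s (V p.1 p.2)].
  by move=> [n i]; have [_ h _] := hV n; exact: lipschitz_shadow (h i).
pose J n i := J' (n, i).
(* The size that the i-th set of the n-th cover contributes to the slice at level [c], nonzero only
   if [c] lies in its shadow. *)
pose w n i (c : R) : \bar R := diam_pow d (s - 1) (V n i) * (\1_(J n i) c)%:E.
have w0 n i c : 0 <= w n i c by rewrite mule_ge0 ?diam_pow_ge0// lee_fin.
have mI n i : measurable_fun [set: R] (EFin \o (\1_(J n i) : R -> R)).
  by apply/measurable_EFinP; apply: measurable_indic; have [] := hJ' (n, i).
have mw n i : measurable_fun [set: R] (w n i).
  by apply: emeasurable_funM; [exact: measurable_cst|exact: mI].
pose g n c := \sum_(0 <= i <oo) w n i c.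
have g0 n c : 0 <= g n c by apply: nneseries_ge0.
have mg n : measurable_fun [set: R] (g n).
  exact: (@ge0_emeasurable_sum _ _ _ _ (w n) xpredT).
pose G c := \sum_(0 <= n <oo) g n c.
have mG : measurable_fun [set: R] G by exact: (@ge0_emeasurable_sum _ _ _ _ g xpredT).
have intG : \int[mu]_(c in [set: R]) G c <= (2 * L)%:E.
  rewrite integral_nneseries//.
  apply: (@le_trans _ _ (\sum_(0 <= n <oo) ((2 * L)%:E * (eps n)%:E))).
    apply: lee_nneseries => [n _ _|n _]; first exact: integral_ge0.
    rewrite integral_nneseries//; last exact: mw.
    have [_ _ hn] := hV n.
    apply: (@le_trans _ _ (\sum_(0 <= i <oo) ((2 * L)%:E * diam_pow d s (V n i)))).
      apply: lee_nneseries => [i _ _|i _]; first exact: integral_ge0.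
      have -> : \int[mu]_(x in [set: R]) w n i x =
          diam_pow d (s - 1) (V n i) * \int[mu]_(x in [set: R]) (\1_(J n i) x)%:E.
        apply: ge0_integralZl => //; first exact: mI.
        exact: diam_pow_ge0.
      have [mJ _ hJ] := hJ' (n, i).
      by rewrite integral_indic// setIT; exact: hJ.
    rewrite nneseriesZl; last by move=> *; exact: diam_pow_ge0.
    by rewrite lee_pmul2l// lte_fin mulr_gt0.
  rewrite nneseriesZl; last by move=> *; rewrite lee_fin ltW.
  rewrite -[leRHS]mule1 lee_pmul2l ?lte_fin ?mulr_gt0//.
  have := @epsilon_trick R (fun=> 0) 1%R xpredT (fun=> lexx _) ler01.
  rewrite [X in _ <= X + _]eseries0// add0e; apply: le_trans.
  by rewrite [leRHS](@eq_eseriesr _ _ (fun n => (eps n)%:E))// => n _; rewrite add0e.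
have [c abc Gc] : exists2 c, (a < c < b)%R & G c < +oo.
  apply: contrapT => /forall2NP hno.
  have : +oo <= (2 * L)%:E; last by rewrite leye_eq.
  apply: le_trans intG.
  apply: (@le_trans _ _ (\int[mu]_(c in `]a, b[%classic) G c)); last first.
    by apply: ge0_subset_integral => // x _; apply: nneseries_ge0.
  rewrite (@eq_integral _ _ _ _ _ (cst +oo)); last first.
    move=> x; rewrite inE /= in_itv /= => abx; have [//|] := hno x.
    by move=> /negP; rewrite -leNgt leye_eq => /eqP.
  by rewrite integral_cst//= lebesgue_measure_itv /= lte_fin ab -EFinB gt0_mulye// lte_fin subr_gt0.
(* Since [G c] is finite its tails tend to 0; a large [n] makes both [g n c] at most [e] and the
   mesh [eps n] at most [delta]. *)
exists c => //; apply/hausdorff_null => delta e delta0 e0.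
have /fine_cvgP [] := nneseries_tail_cvg Gc (fun n _ => g0 n c).
move=> tf /cvgrPdist_lt /(_ e e0) te.
have : \forall n \near \oo, (eps n <= delta)%R.
  near=> n; rewrite /eps div1r -(invrK delta) lef_pV2 ?posrE ?invr_gt0 ?ltr0n ?expn_gt0//.
  apply: (@le_trans _ _ n%:R); last by rewrite ler_nat (leq_trans (ltnW (ltn_expl n (isT : 1 < 2)%N)))// leq_exp2l.
  by near: n; exact: nbhs_infty_ger.
move=> epsd; near \oo => n.
have hd : (eps n <= delta)%R by near: n.
have hg : g n c <= e%:E.
  apply: (@le_trans _ _ (\sum_(n <= k <oo) g k c)).
    have := @nneseries_lim_ge R (fun k => g k c) xpredT n n.+1 (fun k _ _ => g0 k c).
    by rewrite big_nat1.
  have h1 : \sum_(n <= k <oo) g k c \is a fin_num by near: n.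
  rewrite -(fineK h1) lee_fin.
  have : (`|0 - fine (\sum_(n <= k <oo) g k c)| < e)%R by near: n.
  by rewrite sub0r normrN => /ltW; exact/le_trans/ler_norm.
have [EV dV _] := hV n.
exists (fun i => if c \in J n i then V n i else set0); split.
- move=> x [Ex /= fx]; have [i _ Vx] := EV x Ex; exists i => //.
  rewrite ifT// inE; have [_ hJ _] := hJ' (n, i); apply: hJ; rewrite -fx; exact: imageP.
- move=> i; case: ifP => _; last by rewrite diameter_set0 leNye.
  by apply: le_trans (dV i) _; rewrite lee_fin.
- apply: le_trans hg; rewrite le_eqVlt; apply/orP; left; apply/eqP/eq_eseriesr => i _.
  rewrite /w indicE; case: ifP => _; first by rewrite mule1.
  by rewrite diam_pow_set0 mule0.
Unshelve. all: end_near. Qed.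

End slicing.

End Hausdorff.

(** * Real derivatives along complex directions *)

Section one_variable.
Context {R : realType}.
Implicit Types (f g H : R -> R).

Lemma is_derive_translate f (s l : R) :
  is_derive (0 : R) (1 : R) (fun t => f (s + t)) l -> is_derive s (1 : R) f l.
Proof.
move=> h.
have h' : is_derive (s - s) (1 : R) (fun t => f (s + t)) l by rewrite subrr.
have hs : is_derive s (1 : R) (shift (- s)) (1 : R) by apply: is_derive_shift.
have := @is_derive1_comp R (fun t => f (s + t)) (shift (- s)) s l 1 h' hs; rewrite mulr1.
rewrite (_ : _ \o _ = f)//; apply/funext => t /=.
by rewrite addrC subrK.
Qed.

(** The difference quotient at 0 is [H] itself, so continuity of [H] is enough. This differentiates
    positive parts at their corner and, further on, sums of directions. *)
Lemma is_derive_mulid H : {for 0, continuous H} ->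
  is_derive (0 : R) (1 : R) (fun t => t * H t) (H 0).
Proof.
move=> cH.
have cvgH : h^-1 *: (((fun t => t * H t) \o shift 0) (h *: 1) - 0 * H 0) @[h --> 0^'] --> H 0.
  apply: cvg_trans (cvg_within_filter _ cH); apply: near_eq_cvg.
  near=> h; have h0 : h != 0 by near: h; exact: nbhs_dnbhs_neq.
  by rewrite /= [h%:A]mulr1 addr0 mul0r subr0 [_ *: _]mulrA mulVf// mul1r.
split; first by apply/cvg_ex; exists (H 0).
exact: cvg_lim cvgH.
Unshelve. all: end_near. Qed.

Lemma mean_value f (df : R -> R) (t : R) :
  (forall s, `|s| <= `|t| -> is_derive s (1 : R) f (df s)) ->
  exists2 s, `|s| <= `|t| & f t - f 0 = t * df s.
Proof.
move=> fd; have [t0|t0|->] := ltgtP t 0.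
- have [s /[!in_itv]/= /andP[s1 s2] e] : exists2 s, s \in `]t, 0[ & f 0 - f t = df s * (0 - t).
    apply: MVT => // [x /[!in_itv]/= /andP[x1 x2]|].
      by apply: fd; rewrite !ltr0_norm// lerN2 ltW.
    apply: derivable_within_continuous => x /[!in_itv]/= /andP[x1 x2].
    by have [] := fd x; rewrite ?(ltr0_norm t0)// ?ler0_norm// ?lerN2.
  exists s; first by rewrite !ltr0_norm// lerN2 ltW.
  by rewrite -opprB e; ring.
- have [s /[!in_itv]/= /andP[s1 s2] e] : exists2 s, s \in `]0, t[ & f t - f 0 = df s * (t - 0).
    apply: MVT => // [x /[!in_itv]/= /andP[x1 x2]|].
      by apply: fd; rewrite !gtr0_norm// ltW.
    apply: derivable_within_continuous => x /[!in_itv]/= /andP[x1 x2].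
    by have [] := fd x; rewrite ?(gtr0_norm t0)// ?ger0_norm//.
  exists s; first by rewrite !gtr0_norm// ltW.
  by rewrite e; ring.
- by exists 0 => //; rewrite subrr mul0r.
Qed.

(** An exponent of at least 2 makes the one-sided derivatives agree at 0, where the function has the
    form t H(t) with [H] continuous and [H 0 = 0]. *)
Lemma is_derive_pos_part_pow (k : nat) (x : R) :
  is_derive x (1 : R) (fun t : R => Num.max 0 t ^+ k.+2) (k.+2%:R * Num.max 0 x ^+ k.+1).
Proof.
have [x0|x0|->] := ltgtP x 0.
- rewrite expr0n mulr0.
  apply: (@near_eq_is_derive R R R (cst 0)).
  near=> t; rewrite max_l ?expr0n// ltW//; near: t; exact: lt_nbhsl.
- apply: (@near_eq_is_derive R R R ((@id R) ^+ k.+2)).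
    near=> t; rewrite exprfctE max_r// ltW//; near: t; exact: lt_nbhsr.
  have := @is_deriveX R R (@id R) k.+2 x 1 1 (@is_derive_id _ _ _ _).
  by rewrite /= [_ *: _]mulr1.
- rewrite ?maxxx expr0n mulr0.
  pose H (t : R) := Num.max 0 t ^+ k.+1.
  have -> : (fun t : R => Num.max 0 t ^+ k.+2) = (fun t => t * H t).
    apply/funext => t; rewrite exprS /H; case: (ltP 0 t) => t0 //.
    by rewrite !expr0n !mulr0.
  have H0 : H 0 = 0 by rewrite /H maxxx expr0n.
  apply: is_derive_eq _ H0; apply: is_derive_mulid.
  have cm : {for 0, continuous (fun t : R => Num.max 0 t)}.
    by apply: continuous_max; [apply: cvg_cst|apply: cvg_id].
  exact: (continuous_comp cm (@exprn_continuous R k.+1 _)).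
Unshelve. all: end_near. Qed.

End one_variable.

Section real_derivatives.
Context {R : realType} {n : nat}.
Local Notation C := R[i].
Local Notation Cn := 'rV[C]_n.
Local Notation Re := (@complex.Re R).
Local Notation Im := (@complex.Im R).
Implicit Types (f g : Cn -> C) (z v : Cn) (U : set Cn) (l : C) (t : R).

(** Existence and value in one predicate: [rderive] has a default value where no derivative exists,
    so computations of values must carry differentiability along. *)
Definition rd f z v l : Prop :=
  is_derive (0 : R) (1 : R) (re_along f z v) (Re l) /\
  is_derive (0 : R) (1 : R) (im_along f z v) (Im l).

Lemma rd_rderivable f z v l : rd f z v l -> rderivable f z v.
Proof. by move=> [h1 h2]; split; exact: ex_derive. Qed.

Lemma rd_rderive f z v l : rd f z v l -> rderive f v z = l.
Proof.
move=> [h1 h2]; rewrite /rderive !derive1E (@derive_val _ _ _ _ _ _ _ h1) (@derive_val _ _ _ _ _ _ _ h2).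
by case: l {h1 h2}.
Qed.

Lemma rderivable_rd f z v : rderivable f z v -> rd f z v (rderive f v z).
Proof.
move=> [h1 h2]; rewrite /rderive; split; (apply: DeriveDef; first by []); by rewrite -derive1E.
Qed.

Lemma along0 (z v : Cn) : z + (0 : R)%:C *: v = z.
Proof. by rewrite scale0r addr0. Qed.

Lemma rd_affine f z v l : (forall t, f (z + t%:C *: v) = f z + t%:C * l) -> rd f z v l.
Proof.
move=> h; split.
  have -> : re_along f z v = cst (Re (f z)) + (Re l \*: @id R).
    by apply/funext => t; rewrite /re_along h !cReImE mul0r subr0 [RHS]/= mulrC.
  have := is_deriveD (@is_derive_cst R R R (Re (f z)) 0 1) (@is_deriveZ R R R id (Re l) 0 1 1 _).
  by rewrite add0r [_ *: _]mulr1; apply; exact: is_derive_id.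
have -> : im_along f z v = cst (Im (f z)) + (Im l \*: @id R).
  by apply/funext => t; rewrite /im_along h !cReImE mul0r addr0 [RHS]/= mulrC.
have := is_deriveD (@is_derive_cst R R R (Im (f z)) 0 1) (@is_deriveZ R R R id (Im l) 0 1 1 _).
by rewrite add0r [_ *: _]mulr1; apply; exact: is_derive_id.
Qed.

Lemma rd_cst (c : C) z v : rd (fun=> c) z v 0.
Proof. by apply: rd_affine => t; rewrite mulr0 addr0. Qed.

Lemma rdD f g z v l l' : rd f z v l -> rd g z v l' -> rd (fun y => f y + g y) z v (l + l').
Proof.
move=> [f1 f2] [g1 g2]; split.
  have -> : re_along (fun y => f y + g y) z v = re_along f z v + re_along g z v.
    by apply/funext => t; rewrite /re_along cReD.
  by rewrite cReD; exact: is_deriveD.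
have -> : im_along (fun y => f y + g y) z v = im_along f z v + im_along g z v.
  by apply/funext => t; rewrite /im_along cImD.
by rewrite cImD; exact: is_deriveD.
Qed.

Lemma rdM f g z v l l' : rd f z v l -> rd g z v l' ->
  rd (fun y => f y * g y) z v (l * g z + f z * l').
Proof.
move=> [f1 f2] [g1 g2]; split.
  have -> : re_along (fun y => f y * g y) z v =
      re_along f z v * re_along g z v - im_along f z v * im_along g z v.
    by apply/funext => t; rewrite /re_along cReM.
  apply: is_derive_eq (is_deriveB (is_deriveM f1 g1) (is_deriveM f2 g2)) _.
  by rewrite /re_along /im_along along0 !cReImE /GRing.scale /=; ring.
have -> : im_along (fun y => f y * g y) z v =
    re_along f z v * im_along g z v + im_along f z v * re_along g z v.
  by apply/funext => t; rewrite /re_along /im_along cImM.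
apply: is_derive_eq (is_deriveD (is_deriveM f1 g2) (is_deriveM f2 g1)) _.
by rewrite /re_along /im_along along0 !cReImE /GRing.scale /=; ring.
Qed.

Lemma rd_sum (I : Type) (r : seq I) (F : I -> Cn -> C) z v (l : I -> C) :
  (forall i, rd (F i) z v (l i)) ->
  rd (fun y => \sum_(i <- r) F i y) z v (\sum_(i <- r) l i).
Proof.
move=> h; elim: r => [|i r IH].
  rewrite big_nil; have -> : (fun y => \sum_(i <- [::]) F i y) = (fun=> 0).
    by apply/funext => y; rewrite big_nil.
  exact: rd_cst.
rewrite big_cons; have -> : (fun y => \sum_(j <- i :: r) F j y) = (fun y => F i y + \sum_(j <- r) F j y).
  by apply/funext => y; rewrite big_cons.
exact: rdD.
Qed.

Lemma along_cvg z v t0 : z + t%:C *: v @[t --> t0] --> z + t0%:C *: v.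
Proof.
apply: cvgD; first exact: cvg_cst.
by apply: cvgZr_tmp; exact: real_complex_continuous.
Qed.

Lemma rd_eq f g z v l U : open U -> U z -> (forall y, U y -> f y = g y) ->
  rd f z v l -> rd g z v l.
Proof.
move=> oU Uz fg [h1 h2].
have h : \forall t \near (0 : R), f (z + t%:C *: v) = g (z + t%:C *: v).
  have /(_ U) := @along_cvg z v 0; rewrite along0.
  move=> /(_ (open_nbhs_nbhs (conj oU Uz))) hU.
  by near=> t; apply: fg; near: t.
split; [apply: (near_eq_is_derive _ h1)|apply: (near_eq_is_derive _ h2)];
  by near=> t; rewrite /re_along /im_along; congr (_ _); near: t.
Unshelve. all: end_near. Qed.

End real_derivatives.

Section continuously_differentiable.
Context {R : realType} {n : nat}.
Local Notation C := R[i].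
Local Notation Cn := 'rV[C]_n.
Local Notation Re := (@complex.Re R).
Local Notation Im := (@complex.Im R).
Implicit Types (f g : Cn -> C) (z v w : Cn) (U V : set Cn) (l : C) (t : R).

Definition cdir (b : bool) (j : 'I_n) : Cn := if b then y_dir j else x_dir j.

Lemma contDiffS k U f : contDiff k.+1 U f <->
  (forall z, U z -> {for z, continuous f}) /\
  forall b j, (forall z, U z -> rderivable f z (cdir b j)) /\
              contDiff k U (rderive f (cdir b j)).
Proof.
split=> [[cf h]|[cf h]]; (split; first exact: cf).
  move=> b j; have [a1 a2 a3 a4] := h j.
  by case: b; split; [exact: a2|exact: a4|exact: a1|exact: a3].
move=> j; have [h1 h2] := h false j; have [h3 h4] := h true j.
by split; [exact: h1|exact: h3|exact: h2|exact: h4].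
Qed.

Lemma contDiff_continuous k U f z : contDiff k U f -> U z -> {for z, continuous f}.
Proof. by case: k => [|k] [h _]; exact: h. Qed.

Lemma contDiff_rderivable k U f z b j : contDiff k.+1 U f -> U z ->
  rd f z (cdir b j) (rderive f (cdir b j) z).
Proof. by move=> /contDiffS [_ /(_ b j) [h _]] Uz; exact/rderivable_rd/h. Qed.

Lemma contDiff_rderive k U f b j : contDiff k.+1 U f -> contDiff k U (rderive f (cdir b j)).
Proof. by move=> /contDiffS [_ /(_ b j) []]. Qed.

Lemma contDiff_setU k U V f : contDiff k U f -> contDiff k V f -> contDiff k (U `|` V) f.
Proof.
elim: k f => [|k IH] f.
  by move=> [h _] [h' _]; split => // z [/h|/h'].
move=> /contDiffS [cU dU] /contDiffS [cV dV]; apply/contDiffS; split.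
  by move=> z [/cU|/cV].
move=> b j; have [rU kU] := dU b j; have [rV kV] := dV b j; split; last exact: IH.
by move=> z [/rU|/rV].
Qed.

Lemma for_continuous_eq U f g z : open U -> U z -> (forall y, U y -> f y = g y) ->
  {for z, continuous f} -> {for z, continuous g}.
Proof.
move=> oU Uz fg cf.
have h : \forall y \near z, f y = g y.
  by near=> y; apply: fg; near: y; exact: open_nbhs_nbhs.
have {}cf : f y @[y --> z] --> g z by rewrite -fg.
exact: cvg_trans (near_eq_cvg h) cf.
Unshelve. all: end_near. Qed.

Lemma contDiff_eq k U f g : open U -> (forall z, U z -> f z = g z) ->
  contDiff k U f -> contDiff k U g.
Proof.
move=> oU; elim: k f g => [|k IH] f g fg.
  move=> [cf _]; split; last exact: I.
  by move=> z Uz; exact: (for_continuous_eq oU Uz fg (cf z Uz)).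
move=> cf; have cg0 : forall z, U z -> {for z, continuous g}.
  by move=> z Uz; exact: (for_continuous_eq oU Uz fg (contDiff_continuous cf Uz)).
apply/contDiffS; split; first exact: cg0.
move=> b j; have h z : U z -> rd g z (cdir b j) (rderive f (cdir b j) z).
  by move=> Uz; apply: (rd_eq oU Uz fg); exact: contDiff_rderivable cf Uz.
split; first by move=> z /h /rd_rderivable.
apply: (IH (rderive f (cdir b j))); last exact: contDiff_rderive.
by move=> z /h /rd_rderive.
Qed.

Lemma contDiff_rd k U f : open U -> (forall z, U z -> {for z, continuous f}) ->
  (forall b j, exists2 h, forall z, U z -> rd f z (cdir b j) (h z) & contDiff k U h) ->
  contDiff k.+1 U f.
Proof.
move=> oU cf h; apply/contDiffS; split; first exact: cf.
move=> b j; have [f' ff' cf'] := h b j; split.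
  by move=> z /ff' /rd_rderivable.
by apply: contDiff_eq cf' => // z /ff' /rd_rderive.
Qed.

Lemma for_continuous_cst (c : C) z : {for z, continuous (fun _ : Cn => c)}.
Proof. exact: (@cst_continuous Cn C c z). Qed.

Lemma for_continuousD f g z : {for z, continuous f} -> {for z, continuous g} ->
  {for z, continuous (fun y => f y + g y)}.
Proof. by move=> cf cg; exact: (cvgD cf cg). Qed.

Lemma for_continuousM f g z : {for z, continuous f} -> {for z, continuous g} ->
  {for z, continuous (fun y => f y * g y)}.
Proof. by move=> cf cg; exact: (cvgM cf cg). Qed.

Lemma contDiffW k U f : contDiff k.+1 U f -> contDiff k U f.
Proof.
elim: k f => [|k IH] f /contDiffS [cf h]; first by split.
apply/contDiffS; split; first exact: cf.
move=> b j; have [h1 h2] := h b j; split; [exact: h1|exact: IH].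
Qed.

Lemma contDiff_cst k U (c : C) : open U -> contDiff k U (fun=> c).
Proof.
move=> oU; elim: k c => [|k IH] c; first by split; [move=> z _; exact: for_continuous_cst|exact: I].
apply: contDiff_rd => // [z _|b j]; first exact: for_continuous_cst.
by exists (fun=> 0) => // z _; exact: rd_cst.
Qed.

Lemma contDiff_affine k U f (l : Cn -> C) : open U -> continuous f ->
  (forall z v t, f (z + t%:C *: v) = f z + t%:C * l v) -> contDiff k U f.
Proof.
move=> oU cf h; case: k => [|k]; first by split=> // z _; exact: cf.
apply: contDiff_rd => // [z _|b j]; first exact: cf.
exists (fun=> l (cdir b j)); last exact: contDiff_cst.
by move=> z _; exact: rd_affine.
Qed.

Lemma contDiffD k U f g : open U -> contDiff k U f -> contDiff k U g ->
  contDiff k U (fun z => f z + g z).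
Proof.
move=> oU; elim: k f g => [|k IH] f g cf cg.
  split; [move=> z Uz|exact: I].
  exact: (for_continuousD (contDiff_continuous cf Uz) (contDiff_continuous cg Uz)).
apply: contDiff_rd => // [z Uz|b j].
  exact: (for_continuousD (contDiff_continuous cf Uz) (contDiff_continuous cg Uz)).
exists (fun z => rderive f (cdir b j) z + rderive g (cdir b j) z).
  by move=> z Uz; apply: rdD; [exact: contDiff_rderivable cf Uz|exact: contDiff_rderivable cg Uz].
by apply: IH; exact: contDiff_rderive.
Qed.

Lemma contDiffM k U f g : open U -> contDiff k U f -> contDiff k U g ->
  contDiff k U (fun z => f z * g z).
Proof.
move=> oU; elim: k f g => [|k IH] f g cf cg.
  split; [move=> z Uz|exact: I].
  exact: (for_continuousM (contDiff_continuous cf Uz) (contDiff_continuous cg Uz)).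
apply: contDiff_rd => // [z Uz|b j].
  exact: (for_continuousM (contDiff_continuous cf Uz) (contDiff_continuous cg Uz)).
exists (fun z => rderive f (cdir b j) z * g z + f z * rderive g (cdir b j) z).
  by move=> z Uz; apply: rdM; [exact: contDiff_rderivable cf Uz|exact: contDiff_rderivable cg Uz].
by apply: contDiffD => //; apply: IH; rewrite ?cdir//;
  (exact: contDiff_rderive || exact: contDiffW).
Qed.

Lemma contDiff_sum (I : Type) (r : seq I) k U (F : I -> Cn -> C) : open U ->
  (forall i, contDiff k U (F i)) -> contDiff k U (fun z => \sum_(i <- r) F i z).
Proof.
move=> oU h; elim: r => [|i r IH].
  have -> : (fun y => \sum_(i <- [::]) F i y) = (fun=> 0) by apply/funext => y; rewrite big_nil.
  exact: contDiff_cst.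
have -> : (fun y => \sum_(j <- i :: r) F j y) = (fun y => F i y + \sum_(j <- r) F j y).
  by apply/funext => y; rewrite big_cons.
exact: contDiffD.
Qed.

(** Each derivative costs one power. The exponent [m.+1] exceeds the order [k], and the induction
    lowers both together. *)
Lemma contDiff_pos_part k m U (h : Cn -> R) : open U -> (k <= m)%N ->
  contDiff k U (fun z => (h z)%:C) -> contDiff k U (fun z => (Num.max 0 (h z) ^+ m.+1)%:C).
Proof.
move=> oU; elim: k m => [|k IH] m km ch.
  split; [move=> z Uz|exact: I].
  have hz : {for z, continuous h}.
    exact: (continuous_comp (contDiff_continuous ch Uz) (@Re_continuous R _)).
  have cm : {for z, continuous (fun y => Num.max 0 (h y))}.
    by apply: continuous_max; [exact: (@cst_continuous Cn R 0 z)|exact: hz].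
  have cm' := continuous_comp cm (@exprn_continuous R m.+1 _).
  exact: (continuous_comp cm' (@real_complex_continuous R _)).
case: m km => // m km.
have cont m' z : U z -> {for z, continuous (fun z => (Num.max 0 (h z) ^+ m'.+1)%:C)}.
  move=> Uz.
  have hz : {for z, continuous h}.
    exact: (continuous_comp (contDiff_continuous ch Uz) (@Re_continuous R _)).
  have cm : {for z, continuous (fun y => Num.max 0 (h y))}.
    by apply: continuous_max; [exact: (@cst_continuous Cn R 0 z)|exact: hz].
  have cm' := continuous_comp cm (@exprn_continuous R m'.+1 _).
  exact: (continuous_comp cm' (@real_complex_continuous R _)).
apply: contDiff_rd => // [z Uz|b j]; first exact: cont.
exists (fun z => m.+2%:R%:C * (Num.max 0 (h z) ^+ m.+1)%:C * rderive (fun z => (h z)%:C) (cdir b j) z).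
  move=> z Uz; have [h1 h2] := contDiff_rderivable b j ch Uz.
  move: h1 h2; move: (rderive _ _ _) => l h1 h2.
  have Il : Im l = 0.
    rewrite -(@derive_val _ _ _ _ _ _ _ h2).
    have -> : im_along (fun z => (h z)%:C) z (cdir b j) = cst 0 by [].
    exact: derive_cst.
  split.
    have := @is_derive1_comp R (fun t : R => Num.max 0 t ^+ m.+2) (re_along (fun z => (h z)%:C) z (cdir b j)) 0 _ _
      (@is_derive_pos_part_pow R m _) h1.
    rewrite {2}/re_along along0 /= => hh; apply: is_derive_eq hh _.
    by rewrite !cReImE Il /=; ring.
  have -> : im_along (fun z => (Num.max 0 (h z) ^+ m.+2)%:C) z (cdir b j) = cst 0 by [].
  have -> : Im (m.+2%:R%:C * (Num.max 0 (h z) ^+ m.+1)%:C * l) = 0 by rewrite !cReImE Il /=; ring.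
  exact: is_derive_cst.
apply: contDiffM => //; last exact: contDiff_rderive.
apply: contDiffM => //; first exact: contDiff_cst.
by apply: IH => //; exact: contDiffW.
Qed.

End continuously_differentiable.

(** * The real differential and the Wirtinger derivative along a direction *)

Section directional.
Context {R : realType} {n : nat}.
Local Notation C := R[i].
Local Notation Cn := 'rV[C]_n.
Local Notation Re := (@complex.Re R).
Local Notation Im := (@complex.Im R).
Implicit Types (f g : Cn -> C) (z v w : Cn) (U V : set Cn) (l : C) (t : R).

(** Write u(z + t(v + w)) = u(z + tv) + t H(t), where H(t) is the difference quotient in direction
    [w] at the moving point z + tv. By the mean value theorem H(t) is a value of [h] near [z], so
    continuity of [h] gives H(t) -> h(z). *)
Lemma is_derive_add_direction (u h : Cn -> R) z v w (a : R) :
  is_derive (0 : R) (1 : R) (fun t => u (z + t%:C *: v)) a ->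
  (\forall y \near z, is_derive (0 : R) (1 : R) (fun t => u (y + t%:C *: w)) (h y)) ->
  {for z, continuous h} ->
  is_derive (0 : R) (1 : R) (fun t => u (z + t%:C *: (v + w))) (a + h z).
Proof.
move=> uv uw ch.
pose H t := if t == 0 then h z
            else t^-1 * (u (z + t%:C *: v + t%:C *: w) - u (z + t%:C *: v)).
have H0 : H 0 = h z by rewrite /H eqxx.
have -> : (fun t => u (z + t%:C *: (v + w))) =
    (fun t => u (z + t%:C *: v)) + (fun t => t * H t).
  apply/funext => t; rewrite -[RHS]/(u (z + t%:C *: v) + t * H t) /H scalerDr addrA.
  have [->|t0] := eqVneq t 0; first by rewrite mul0r addr0 !scale0r !addr0.
  by rewrite mulrA divff// mul1r addrCA subrr addr0.
suff cH : {for 0, continuous H}.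
  by apply: is_deriveD => //; rewrite -H0; exact: is_derive_mulid.
apply/cvgrPdist_lt => e e0.
have hz : \forall y \near z, `|h z - h y| < e by have /cvgrPdist_lt := ch; exact.
pose P y := is_derive (0 : R) (1 : R) (fun t => u (y + t%:C *: w)) (h y) /\ `|h z - h y| < e.
have nP : nbhs z P by apply: filterI.
pose G (p : R * R) : Cn := z + p.1%:C *: v + p.2%:C *: w.
have c2 (x : Cn) : t%:C *: x @[t --> (0 : R)] --> (0 : Cn).
  have := @along_cvg R n 0 x 0; rewrite scale0r addr0.
  by rewrite (_ : (fun t => 0 + t%:C *: x) = (fun t => t%:C *: x))//; apply/funext => t; rewrite add0r.
have cG : G p @[p --> ((0, 0) : R * R)] --> z.
  have c3 : p.1%:C *: v @[p --> ((0, 0) : R * R)] --> (0 : Cn).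
    by apply: (cvg_comp _ _ _ (c2 v)); exact: cvg_fst.
  have c4 : p.2%:C *: w @[p --> ((0, 0) : R * R)] --> (0 : Cn).
    by apply: (cvg_comp _ _ _ (c2 w)); exact: cvg_snd.
  have c5 : z @[_ --> ((0, 0) : R * R)] --> z by apply: cvg_cst.
  have c6 : z + p.1%:C *: v @[p --> ((0, 0) : R * R)] --> z.
    by rewrite -[X in _ --> X]addr0; apply: cvgD; [exact: c5|exact: c3].
  by rewrite -[X in _ --> X]addr0; apply: cvgD; [exact: c6|exact: c4].
have /nbhs_ballP [d /= d0 hd] : nbhs ((0, 0) : R * R) (G @^-1` P) by exact: cG.
have HP t s : `|t| < d -> `|s| < d -> P (z + t%:C *: v + s%:C *: w).
  by move=> td sd; apply: (hd (t, s)); split; rewrite /ball /= sub0r normrN.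
near=> t.
have td : `|t| < d.
  near: t; have /cvgrPdist_lt /(_ d d0) := @cvg_id _ (nbhs (0 : R)).
  by under eq_near do rewrite sub0r normrN.
rewrite H0 /H; have [_|t0] := eqVneq t 0; first by rewrite subrr normr0.
have hd' s : `|s| <= `|t| -> is_derive s (1 : R) (fun s : R => u (z + t%:C *: v + s%:C *: w))
    (h (z + t%:C *: v + s%:C *: w)).
  move=> st; apply: is_derive_translate.
  have [h1 _] := HP t s td (le_lt_trans st td).
  rewrite (_ : (fun r : R => _) = (fun r => u ((z + t%:C *: v + s%:C *: w) + r%:C *: w)))//.
  by apply/funext => r; rewrite rmorphD/= scalerDl addrA.
have [s st e1] := mean_value hd'.
move: e1; rewrite scale0r addr0 => ->.
by rewrite mulrA mulVf// mul1r; have [] := HP t s td (le_lt_trans st td).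
Unshelve. all: end_near. Qed.

Lemma rd_add_direction f (h : Cn -> C) z v w (a : C) : rd f z v a ->
  (\forall y \near z, rd f y w (h y)) -> {for z, continuous h} ->
  rd f z (v + w) (a + h z).
Proof.
move=> [a1 a2] fw ch; split; rewrite ?cReD ?cImD.
  apply: (@is_derive_add_direction (fun y => Re (f y)) (fun y => Re (h y))) => //.
    by apply: filterS fw => y [].
  exact: (continuous_comp ch (@Re_continuous R _)).
apply: (@is_derive_add_direction (fun y => Im (f y)) (fun y => Im (h y))) => //.
  by apply: filterS fw => y [].
exact: (continuous_comp ch (@Im_continuous R _)).
Qed.

Lemma rd_scale_direction f z v l (s : R) : rd f z v l -> rd f z (s%:C *: v) (s%:C * l).
Proof.
have hs : is_derive (0 : R) (1 : R) (fun t => s * t) s.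
  have := @is_deriveZ R R R id s 0 1 1 _; rewrite [_ *: _]mulr1; apply; exact: is_derive_id.
move=> [h1 h2]; split.
  have -> : re_along f z (s%:C *: v) = re_along f z v \o (fun t => s * t).
    by apply/funext => t; rewrite /re_along /= scalerA -rmorphM mulrC.
  rewrite !cReImE mul0r subr0 mulrC; apply: is_derive1_comp => //; by rewrite mulr0.
have -> : im_along f z (s%:C *: v) = im_along f z v \o (fun t => s * t).
  by apply/funext => t; rewrite /im_along /= scalerA -rmorphM mulrC.
rewrite !cReImE mul0r addr0 mulrC; apply: is_derive1_comp => //; by rewrite mulr0.
Qed.

Definition dirderiv f z v : C := \sum_(j < n)
  ((Re (v 0 j))%:C * rderive f (cdir false j) z + (Im (v 0 j))%:C * rderive f (cdir true j) z).

Lemma rV_cdir v : v = \sum_(j < n)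
  ((Re (v 0 j))%:C *: (cdir false j : Cn) + (Im (v 0 j))%:C *: cdir true j).
Proof.
rewrite {1}[v]row_sum_delta; apply: eq_bigr => j _.
rewrite /= /x_dir /y_dir scalerA -scalerDl; congr (_ *: _).
by rewrite {1}[v 0 j]complexE mulrC.
Qed.

(** The coordinate directions of [v] are added one at a time, so continuity is asked only of the
    partial derivatives, which is what [contDiff] provides. *)
Lemma rd_dirderiv U f z v : open U -> U z -> contDiff 1 U f -> rd f z v (dirderiv f z v).
Proof.
move=> oU Uz cf; rewrite {1}[v]rV_cdir /dirderiv.
have nU : \forall y \near z, U y by exact: open_nbhs_nbhs.
have add w l b j (s : R) : rd f z w l ->
    rd f z (w + s%:C *: cdir b j) (l + s%:C * rderive f (cdir b j) z).
  move=> h; apply: (rd_add_direction (h := fun y => s%:C * rderive f (cdir b j) y)) => //.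
    by apply: filterS nU => y Uy; apply: rd_scale_direction; exact: contDiff_rderivable cf Uy.
  apply: for_continuousM; first exact: for_continuous_cst.
  exact: (contDiff_continuous (contDiff_rderive b j cf) Uz).
elim: (index_enum _) => [|j r IH].
  by rewrite !big_nil; apply: rd_affine => t; rewrite scaler0 addr0 mulr0 addr0.
rewrite !big_cons [X in rd _ _ X]addrC [X in rd _ _ _ X]addrC !addrA.
by apply: (add _ _ true); exact: (add _ _ false).
Qed.

Lemma dirderiv_rderive U f z v : open U -> U z -> contDiff 1 U f ->
  rderive f v z = dirderiv f z v.
Proof. by move=> oU Uz cf; exact: rd_rderive (rd_dirderiv v oU Uz cf). Qed.

(** The right side is the Wirtinger derivative in conj s, at s = 0, of f(z + s v). Thus f is
    holomorphic along the direction [v] iff dbar f annihilates the conjugate vector. *)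
Lemma sum_d_dzbar U f z v : open U -> U z -> contDiff 1 U f ->
  \sum_(j < n) conjc (v 0 j) * d_dzbar j f z =
  2^-1 * (rderive f v z + (0 +i* 1) * rderive f ((0 +i* 1) *: v) z).
Proof.
move=> oU Uz cf; rewrite !(dirderiv_rderive _ oU Uz cf) /dirderiv.
rewrite mulr_sumr -big_split /= mulr_sumr; apply: eq_bigr => j _.
rewrite /d_dzbar mxE.
move: (rderive _ _ _) (rderive _ _ _) => B A.
case: (v 0 j) => a b; set c := 2^-1.
have e1 : (Re ((0 +i* 1) * (a +i* b)))%:C = - b%:C :> C.
  by apply: complexP; rewrite !cReImE; ring.
have e2 : (Im ((0 +i* 1) * (a +i* b)))%:C = a%:C :> C.
  by apply: complexP; rewrite !cReImE; ring.
have e3 : conjc (a +i* b) = a%:C - (0 +i* 1) * b%:C :> C.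
  by apply: complexP; rewrite !cReImE; ring.
have e4 : (0 +i* 1) * (0 +i* 1) = -1 :> C by apply: complexP; rewrite !cReImE; ring.
rewrite e1 e2 e3 /=; move: e4; set I := (0 +i* 1) => e4.
have -> : (a%:C - I * b%:C) * (c * (A + I * B)) =
   c * (a%:C * A + a%:C * (I * B) - I * b%:C * A - (I * I) * b%:C * B) by ring.
by rewrite e4; ring.
Qed.

End directional.

Section composition.
Context {R : realType} {n m : nat}.
Local Notation C := R[i].
Variables (w : 'rV[C]_n -> 'rV[C]_m) (dw : 'rV[C]_n -> 'rV[C]_m).
Hypothesis cw : continuous w.
Hypothesis w_affine : forall z v (t : R), w (z + t%:C *: v) = w z + t%:C *: dw v.

Lemma rd_comp_affine (g : 'rV[C]_m -> C) z v l :
  rd g (w z) (dw v) l -> rd (g \o w) z v l.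
Proof.
have e1 : re_along (g \o w) z v = re_along g (w z) (dw v).
  by apply/funext => t; rewrite /re_along /= w_affine.
have e2 : im_along (g \o w) z v = im_along g (w z) (dw v).
  by apply/funext => t; rewrite /im_along /= w_affine.
by rewrite /rd e1 e2.
Qed.

(** By the chain rule, a coordinate derivative of [g \o w] is a combination with constant
    coefficients of partial derivatives of [g] composed with [w]; hence the induction on [k]
    closes. *)
Lemma contDiff_comp_affine k (U : set 'rV[C]_m) (g : 'rV[C]_m -> C) : open U ->
  contDiff k U g -> contDiff k (w @^-1` U) (g \o w).
Proof.
move=> oU; have oV : open (w @^-1` U) by apply: open_comp => // z _; exact: cw.
have cont z (h : 'rV[C]_m -> C) : {for w z, continuous h} -> {for z, continuous (h \o w)}.
  by move=> ch; exact: (continuous_comp (cw (x := z)) ch).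
elim: k g => [|k IH] g cg.
  by split; [move=> z Uz; apply: cont; exact: contDiff_continuous cg Uz|exact: I].
apply: contDiff_rd => // [z Uz|b j].
  by apply: cont; exact: contDiff_continuous cg Uz.
have cg1 : contDiff 1 U g by elim: (k) cg => // k' IH' /contDiffW.
exists (fun z => dirderiv g (w z) (dw (cdir b j))).
  by move=> z Uz; apply: rd_comp_affine; exact: rd_dirderiv oU Uz cg1.
apply: contDiff_sum => // i; apply: contDiffD => //; apply: contDiffM => //;
  (exact: contDiff_cst || (apply: IH; exact: contDiff_rderive cg)).
Qed.

End composition.

(** * Exterior algebra *)

Lemma sum_only1 (V : nmodType) (I : finType) (i0 : I) (P : pred I) (F : I -> V) :
  P i0 -> (forall i, P i -> i != i0 -> F i = 0) -> \sum_(i | P i) F i = F i0.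
Proof.
move=> Pi0 h; rewrite (bigD1 i0)//= big1 ?addr0// => i /andP[]; exact: h.
Qed.

Section exterior_algebra.
Context {R : realType} {n : nat}.
Local Notation C := R[i].
Local Notation form := (ext_form R n).
Local Notation idx := 'I_(n + n).
Implicit Types (a b : form) (S B : {set idx}) (i k : idx).

Definition gen i : form := [ffun S => (S == [set i]%SET)%:R].
Definition scl (c : C) a : form := [ffun S => c * a S].
(** The sign of moving generator [i] from the front of the product over [B] into place: one
    transposition for each index of [B] below [i]. *)
Definition sg i B : C := (-1) ^+ inversions [set i]%SET B.

Lemma inversions1 i B : inversions [set i]%SET B = #|[set s in B | (s < i)%N]|.
Proof.
rewrite /inversions -(card_imset _ (f := fun s : idx => (i, s))); last by move=> s t [].
congr #|pred_of_set _|; apply/setP => -[x y]; rewrite !inE /=.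
apply/andP/imsetP => [[/andP[/eqP -> yB] yi]|[s]]; first by exists y => //; rewrite inE yB.
by rewrite inE => /andP[sB si] [-> ->]; rewrite eqxx sB.
Qed.

Lemma inversions1U i k B : k \notin B ->
  inversions [set i]%SET (k |: B)%SET = ((k < i)%N + inversions [set i]%SET B)%N.
Proof.
move=> kB; rewrite !inversions1.
have [ki|ki] := boolP (k < i)%N.
  have -> : [set s in (k |: B)%SET | (s < i)%N] = (k |: [set s in B | (s < i)%N])%SET.
    apply/setP => s; rewrite !inE; have [->|//] := eqVneq s k; by rewrite ki.
  by rewrite cardsU1 inE (negbTE kB).
rewrite add0n; apply: eq_card => s; rewrite !inE.
by have [->|//] := eqVneq s k; rewrite (negbTE ki) !andbF.
Qed.

Lemma sgU i k B : k \notin B -> sg i (k |: B)%SET = (-1) ^+ (k < i)%N * sg i B.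
Proof. by move=> kB; rewrite /sg inversions1U// exprD. Qed.

Lemma sg_sq i B : sg i B * sg i B = 1.
Proof. by rewrite /sg -exprMn mulrNN mulr1 expr1n. Qed.

Lemma wedge_gen i b S : wedge (gen i) b S =
  if i \in S then sg i (S :\ i)%SET * b (S :\ i)%SET else 0.
Proof.
rewrite ffunE; case: ifPn => iS.
  rewrite (sum_only1 (i0 := [set i]%SET)); first by rewrite ffunE eqxx mul1r.
    by rewrite finset.sub1set.
  by move=> A _ /negbTE Ai; rewrite ffunE Ai mul0r mulr0.
rewrite big1// => A AS; rewrite ffunE; case: eqP => [Ai|_]; last by rewrite mul0r mulr0.
by move: AS; rewrite Ai finset.sub1set (negbTE iS).
Qed.

Lemma wedge_suml (I : Type) (r : seq I) (F : I -> form) b :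
  wedge (\sum_(j <- r) F j) b = \sum_(j <- r) wedge (F j) b.
Proof.
apply/ffunP => S; rewrite sum_ffunE ffunE.
rewrite [RHS](_ : _ = \sum_(j <- r) \sum_(A : {set idx} | A \subset S)
   (-1) ^+ inversions A (S :\: A) * (F j A * b (S :\: A)%SET)); last first.
  by apply: eq_bigr => j _; rewrite ffunE.
rewrite exchange_big /=; apply: eq_bigr => A _.
by rewrite sum_ffunE mulr_suml mulr_sumr.
Qed.

Lemma wedge_sumr (I : Type) (r : seq I) a (F : I -> form) :
  wedge a (\sum_(j <- r) F j) = \sum_(j <- r) wedge a (F j).
Proof.
apply/ffunP => S; rewrite sum_ffunE ffunE.
rewrite [RHS](_ : _ = \sum_(j <- r) \sum_(A : {set idx} | A \subset S)
   (-1) ^+ inversions A (S :\: A) * (a A * F j (S :\: A)%SET)); last first.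
  by apply: eq_bigr => j _; rewrite ffunE.
rewrite exchange_big /=; apply: eq_bigr => A _.
by rewrite sum_ffunE !mulr_sumr.
Qed.

Lemma wedge_scll c a b : wedge (scl c a) b = scl c (wedge a b).
Proof.
apply/ffunP => S; rewrite !ffunE mulr_sumr; apply: eq_bigr => A _.
by rewrite ffunE; ring.
Qed.

Lemma wedge_sclr c a b : wedge a (scl c b) = scl c (wedge a b).
Proof.
apply/ffunP => S; rewrite !ffunE mulr_sumr; apply: eq_bigr => A _.
by rewrite ffunE; ring.
Qed.

Lemma wedge0r a : wedge a 0 = 0.
Proof. by have := wedge_sumr [::] a (fun _ : unit => 0); rewrite !big_nil. Qed.

Lemma scl_sum (I : Type) (r : seq I) c (F : I -> form) :
  scl c (\sum_(j <- r) F j) = \sum_(j <- r) scl c (F j).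
Proof.
apply/ffunP => S; rewrite ffunE !sum_ffunE mulr_sumr.
by apply: eq_bigr => j _; rewrite ffunE.
Qed.

Lemma sclA c d a : scl c (scl d a) = scl (c * d) a.
Proof. by apply/ffunP => S; rewrite !ffunE mulrA. Qed.

Lemma scl0 c : scl c 0 = 0.
Proof. by apply/ffunP => S; rewrite !ffunE mulr0. Qed.

(** This instance of associativity suffices for the powers of d dbar f, where a dz index always
    precedes a dzbar index. For [i < k] the product of the generators is the basis element at {i, k}
    with sign +1, and inversions against the rest add up. *)
Lemma wedge_gen2 i k b : (i < k)%N ->
  wedge (wedge (gen i) (gen k)) b = wedge (gen i) (wedge (gen k) b).
Proof.
move=> ik; have nik : i != k by rewrite -val_eqE neq_ltn ik.
have e : wedge (gen i) (gen k) = [ffun S => (S == [set i; k]%SET)%:R].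
  apply/ffunP => S; rewrite wedge_gen !ffunE; case: ifPn => iS; last first.
    by case: eqP => // e; rewrite e !inE eqxx in iS.
  have -> : (S :\ i == [set k])%SET = (S == [set i; k])%SET.
    apply/eqP/eqP => [e|->].
      by rewrite -(finset.setD1K iS) e.
    by rewrite finset.setU1K// inE.
  case: eqP => [->|_]; last by rewrite mulr0.
  rewrite finset.setU1K ?inE// /sg inversions1 mulr1.
  rewrite (eq_card0 (_ : _ =i pred0))// => s; rewrite !inE.
  by case: eqP => // ->; rewrite ltnNge ltnW.
rewrite e; apply/ffunP => S; rewrite ffunE wedge_gen.
transitivity (if (i \in S) && (k \in S) then
    (-1) ^+ inversions [set i; k]%SET (S :\: [set i; k])%SET * b (S :\: [set i; k])%SET else 0).
  have -> : (i \in S) && (k \in S) = ([set i; k]%SET \subset S) by rewrite finset.subUset !finset.sub1set.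
  case: ifPn => ikS.
    rewrite (sum_only1 (i0 := [set i; k]%SET))//; first by rewrite ffunE eqxx mul1r.
    by move=> A _ /negbTE Ai; rewrite ffunE Ai mul0r mulr0.
  rewrite big1// => A AS; rewrite ffunE; case: eqP => [Ai|_]; last by rewrite mul0r mulr0.
  by rewrite -Ai AS in ikS.
case: (boolP (i \in S)) => iS //=.
rewrite wedge_gen !inE eq_sym nik /=; case: (boolP (k \in S)) => kS; last by rewrite mulr0.
have e2 : (S :\ i :\ k)%SET = (S :\: [set i; k])%SET.
  by apply/setP => s; rewrite !inE negb_or; case: (s == i); case: (s == k).
have e3 : (S :\ i)%SET = (k |: (S :\: [set i; k]))%SET.
  by rewrite -e2 finset.setD1K// !inE eq_sym nik.
rewrite mulrA; congr (_ * b _); last by rewrite e2.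
rewrite e2 e3 sgU; last by rewrite !inE eqxx orbT.
rewrite ltnNge (ltnW ik) /= mul1r /sg -exprD; congr (_ ^+ _).
set T := (S :\: _)%SET; clearbody T; rewrite !inversions1 /inversions.
have e4 (x : idx) : #|[set s in T | (s < x)%N]| =
    #|[set (x, s) | s in [set s in T | (s < x)%N]]%SET|.
  by rewrite card_imset// => s t [].
rewrite !e4.
rewrite -cardsUI; set I := (_ :&: _)%SET.
have -> : #|I| = 0%N.
  apply/eqP; rewrite cards_eq0; apply/eqP/setP => -[x y]; rewrite !inE.
  apply/negbTE/negP => /andP[/imsetP[s _ [-> _]] /imsetP[t _ [ik' _]]].
  by rewrite ik' eqxx in nik.
rewrite addn0.
apply: eq_card => -[x y]; rewrite !inE /=; apply/idP/idP.
  by case/andP => /andP[/orP[/eqP->|/eqP->] yT] yx; apply/orP; [left|right];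
    apply/imsetP; exists y; rewrite ?inE ?yT ?yx.
by case/orP => /imsetP[s]; rewrite inE => /andP[sT si] [-> ->]; rewrite eqxx ?orbT sT.
Qed.

(** Interior product with the vector dual to generator [k]. The relations with [wedge (gen i)]
    proved next are the anticommutation relations of an antiderivation. *)
Definition contract k b : form :=
  [ffun S : {set idx} => if k \in S then 0 else sg k S * b (k |: S)%SET].

Lemma contract_sum (I : Type) (r : seq I) k (F : I -> form) :
  contract k (\sum_(j <- r) F j) = \sum_(j <- r) contract k (F j).
Proof.
apply/ffunP => S; rewrite ffunE [RHS]sum_ffunE; case: ifPn => kS.
  by rewrite big1// => j _; rewrite ffunE kS.
rewrite sum_ffunE mulr_sumr; apply: eq_bigr => j _; by rewrite ffunE (negbTE kS).
Qed.

Lemma contract_scl k c b : contract k (scl c b) = scl c (contract k b).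
Proof. by apply/ffunP => S; rewrite !ffunE; case: ifP => _; rewrite ?mulr0//; ring. Qed.

Lemma contract_wedge_neq i k b : i != k ->
  contract k (wedge (gen i) b) = scl (-1) (wedge (gen i) (contract k b)).
Proof.
move=> ik; apply/ffunP => S; rewrite !ffunE -[in RHS]/(wedge _ _ S).
have -> : \sum_(A : {set idx} | A \subset S) (-1) ^+ inversions A (S :\: A) *
   (gen i A * contract k b (S :\: A)%SET) = wedge (gen i) (contract k b) S by rewrite [RHS]ffunE.
have -> : \sum_(A : {set idx} | A \subset (k |: S)%SET) (-1) ^+ inversions A ((k |: S) :\: A) *
   (gen i A * b ((k |: S) :\: A)%SET) = wedge (gen i) b (k |: S)%SET by rewrite [RHS]ffunE.
rewrite !wedge_gen !inE (negbTE ik) /=.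
case: (boolP (i \in S)) => iS; last by rewrite !mulr0; case: ifP.
rewrite ffunE !inE eq_sym ik /=; case: (boolP (k \in S)) => kS; first by rewrite !mulr0.
have e : ((k |: S) :\ i)%SET = (k |: (S :\ i))%SET.
  by apply/setP => s; rewrite !inE; case: eqP => // ->; rewrite (negbTE ik).
rewrite e sgU ?inE ?negb_and ?kS ?orbT//.
have -> : sg k S = (-1) ^+ (i < k)%N * sg k (S :\ i)%SET.
  by rewrite -{1}(finset.setD1K iS) sgU// !inE eqxx.
have : (-1) ^+ (i < k)%N * (-1) ^+ (k < i)%N = -1 :> C.
  by move: ik; rewrite -val_eqE neq_ltn => /orP[h|h]; rewrite h ltnNge ltnW//= ?mul1r ?mulr1 expr1.
move: (_ ^+ _) (_ ^+ _) => s1 s2 h.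
rewrite -mulN1r -h; ring.
Qed.

Lemma contract_wedge_eq k b :
  contract k (wedge (gen k) b) + wedge (gen k) (contract k b) = b.
Proof.
apply/ffunP => S; rewrite ffunE [contract k _ S]ffunE !wedge_gen !inE eqxx /=.
case: (boolP (k \in S)) => kS.
  by rewrite ffunE !inE eqxx /= add0r mulrA sg_sq mul1r finset.setD1K.
by rewrite addr0 finset.setU1K// mulrA sg_sq mul1r.
Qed.

End exterior_algebra.

(** * Contraction with antiholomorphic vectors and dzbar-degree *)

Section bidegree.
Context {R : realType} {n : nat}.
Local Notation C := R[i].
Local Notation form := (ext_form R n).
Local Notation idx := 'I_(n + n).
Implicit Types (a b : form) (S B : {set idx}).

Definition bar (k : 'I_n) : idx := rshift n k.

(** Interior product with the antiholomorphic vector that has the components [v k] on the duals of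
    the dzbar generators. *)
Definition contract_bar (v : 'I_n -> C) b : form := \sum_k scl (v k) (contract (bar k) b).

Lemma contract_bar_sum (I : Type) (r : seq I) v (F : I -> form) :
  contract_bar v (\sum_(j <- r) F j) = \sum_(j <- r) contract_bar v (F j).
Proof.
rewrite /contract_bar exchange_big /=; apply: eq_bigr => k _.
by rewrite contract_sum scl_sum.
Qed.

Lemma contract_bar_scl v c b : contract_bar v (scl c b) = scl c (contract_bar v b).
Proof.
rewrite /contract_bar scl_sum; apply: eq_bigr => k _.
by rewrite contract_scl !sclA mulrC.
Qed.

Lemma contract_bar_dz v (j : 'I_n) b : contract_bar v b = 0 ->
  contract_bar v (wedge (gen (lshift n j)) b) = 0.
Proof.
move=> h.
have -> : contract_bar v (wedge (gen (lshift n j)) b) =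
   scl (-1) (wedge (gen (lshift n j)) (contract_bar v b)).
  rewrite /contract_bar wedge_sumr scl_sum; apply: eq_bigr => k _.
  rewrite contract_wedge_neq; last by rewrite eq_lrshift.
  by rewrite wedge_sclr !sclA mulrC.
by rewrite h wedge0r scl0.
Qed.

(** With eta the covector of coefficients [c], contracting the product of eta and [b] gives eta(v) b
    minus the product of eta with the contraction of [b]; both terms vanish. *)
Lemma contract_bar_dzbar v (c : 'I_n -> C) b : contract_bar v b = 0 ->
  \sum_k v k * c k = 0 ->
  contract_bar v (\sum_k scl (c k) (wedge (gen (bar k)) b)) = 0.
Proof.
move=> h vc.
have key (k : 'I_n) : contract_bar v (wedge (gen (bar k)) b) =
    scl (v k) b + scl (-1) (wedge (gen (bar k)) (contract_bar v b)).
  rewrite /contract_bar wedge_sumr scl_sum (bigD1 k)// [in RHS](bigD1 k)// addrA.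
  congr (_ + _).
    rewrite wedge_sclr -{2}(contract_wedge_eq (bar k) b).
    by apply/ffunP => S; rewrite !ffunE; ring.
  apply: eq_bigr => l lk; rewrite contract_wedge_neq; last by rewrite eq_rshift eq_sym.
  by rewrite wedge_sclr !sclA mulrC.
rewrite contract_bar_sum.
rewrite (eq_bigr (fun k => scl (v k * c k) b)); last first.
  move=> k _; rewrite contract_bar_scl key h wedge0r scl0 addr0 sclA mulrC//.
apply/ffunP => S; rewrite sum_ffunE !ffunE.
rewrite (eq_bigr (fun k => v k * c k * b S)); last by move=> k _; rewrite ffunE.
by rewrite -mulr_suml vc mul0r.
Qed.

Definition bardeg S : nat := #|[set k : 'I_n | bar k \in S]%SET|.
Definition homog (p : nat) b := forall S, b S != 0 -> bardeg S = p.

Lemma homog_sum (I : Type) (r : seq I) p (F : I -> form) :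
  (forall j, homog p (F j)) -> homog p (\sum_(j <- r) F j).
Proof.
move=> h S; rewrite sum_ffunE => /eqP nz; apply: contrapT => e; apply: nz.
by apply: big1 => j _; apply/eqP/negPn/negP => /h /e.
Qed.

Lemma homog_scl p c b : homog p b -> homog p (scl c b).
Proof. by move=> h S; rewrite ffunE mulf_eq0 negb_or => /andP[_ /h]. Qed.

Lemma homog_dz p (j : 'I_n) b : homog p b -> homog p (wedge (gen (lshift n j)) b).
Proof.
move=> h S; rewrite wedge_gen; case: ifP => [_|]; last by rewrite eqxx.
rewrite mulf_eq0 negb_or => /andP[_ /h <-]; apply: eq_card => k; rewrite !inE.
by rewrite eq_rlshift.
Qed.

Lemma homog_dzbar p (j : 'I_n) b : homog p b -> homog p.+1 (wedge (gen (bar j)) b).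
Proof.
move=> h S; rewrite wedge_gen; case: ifP => [jS|]; last by rewrite eqxx.
rewrite mulf_eq0 negb_or => /andP[_ /h <-].
rewrite /bardeg [LHS](cardsD1 j) inE jS add1n; congr _.+1.
by apply: eq_card => k; rewrite !inE eq_rshift.
Qed.

Lemma contract_bar_one v : contract_bar v (ext_scalar 1 : form) = 0.
Proof.
rewrite /contract_bar big1// => k _; apply/ffunP => S; rewrite !ffunE.
case: ifP => _; first by rewrite mulr0.
have -> : (bar k |: S == finset.set0)%SET = false.
  by apply/negbTE/set0Pn; exists (bar k); rewrite !inE eqxx.
by rewrite !mulr0.
Qed.

Lemma homog_one : homog 0 (ext_scalar 1 : form).
Proof.
move=> S; rewrite ffunE; have [-> _|_] := eqVneq S finset.set0; last by rewrite eqxx.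
by apply: eq_card0 => k; rewrite !inE.
Qed.

(* A form of dzbar-degree q + 1 annihilated by the contractions with an
   independent family of more than n - (q + 1) antiholomorphic vectors vanishes:
   in reduced echelon form, contracting trades a pivot index for non-pivot ones. *)
Lemma contract_bar_eq0 (m q : nat) (M : 'M[C]_(m, n)) b : row_free M -> (n - m <= q)%N ->
  homog q.+1 b -> (forall i, contract_bar (M i) b = 0) -> b = 0.
Proof.
move=> fM nmq hb kb.
have fullMT : row_full M^T by rewrite /row_full mxrank_tr; exact: fM.
pose f := fullrankfun fullMT.
have inj_f : injective f by exact: fullrankfun_inj.
pose B := colsub f M.
have uB : B \in unitmx.
  rewrite -unitmx_tr; have := fullrowsub_unit fullMT.
  by rewrite (_ : rowsub _ _ = B^T)//; apply/matrixP => i j; rewrite !mxE.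
clearbody f; pose M' := invmx B *m M.
have kb' i : contract_bar (M' i) b = 0.
  transitivity (\sum_l scl (invmx B i l) (contract_bar (M l) b)).
    rewrite /contract_bar.
    under [RHS]eq_bigr do rewrite scl_sum.
    rewrite exchange_big /=; apply: eq_bigr => k _.
    apply/ffunP => S; rewrite ffunE sum_ffunE mxE mulr_suml.
    by apply: eq_bigr => l _; rewrite !ffunE mulrA.
  by rewrite big1// => l _; rewrite kb scl0.
have M'f i l : M' i (f l) = (i == l)%:R.
  have := mulVmx uB => /matrixP/(_ i l); rewrite [RHS]mxE => <-.
  by rewrite !mxE; apply: eq_bigr => k _; rewrite !mxE.
pose cnt S := #|[set l : 'I_m | bar (f l) \in S]%SET|.
suff : forall c S, (cnt S < c)%N -> b S = 0.
  by move=> h; apply/ffunP => S; rewrite [RHS]ffunE; exact: h (ltnSn _).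
elim=> // c IH S cS.
have [//|bS] := eqVneq (b S) 0.
(* [S] holds q + 1 barred indices and at most q of them are not pivots. *)
have [l lS] : exists l, bar (f l) \in S.
  apply: contrapT => no; have := hb S bS => dS.
  have : (bardeg S <= #|~: [set f l | l : 'I_m]%SET|)%N.
    apply: subset_leq_card; apply/fintype.subsetP => k; rewrite !inE => kS.
    by apply/imsetP => -[l _ kl]; apply: no; exists l; rewrite -kl.
  rewrite cardsCs finset.setCK card_imset// !card_ord dS => /leq_trans/(_ nmq).
  by rewrite ltnn.
(* Evaluate the contraction by row [l] of [M'] at [S']. The index [f l] gives a sign times [b S];
   other pivots have coefficient 0; a nonpivot gives [b] at a set with fewer pivots, which vanishes
   by induction. *)
pose S' := (S :\ bar (f l))%SET.
have eS' : (bar (f l) \in S') = false by rewrite /S' in_setD1 eqxx.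
have := kb' l => /ffunP/(_ S'); rewrite [RHS]ffunE sum_ffunE (sum_only1 (i0 := f l))//.
rewrite ffunE ffunE eS' M'f eqxx mul1r finset.setD1K// => /eqP.
  by rewrite mulf_eq0 => /orP[|/eqP//]; rewrite /sg signr_eq0.
move=> k _ kl; rewrite !ffunE.
have [[l' kl']|nk] := pselect (exists l', k = f l').
  rewrite kl' M'f; case: eqP => [ll'|_]; last by rewrite mul0r.
  by rewrite kl' ll' eqxx in kl.
case: ifPn => kS'; first by rewrite mulr0.
rewrite IH ?mulr0//.
apply: leq_trans (_ : cnt S <= c)%N => //.
rewrite /cnt [ltnRHS](cardsD1 l) inE lS add1n ltnS; apply: subset_leq_card.
apply/fintype.subsetP => l1; rewrite !inE => /orP[/eqP/rshift_inj e|].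
  by exfalso; apply: nk; exists l1.
by rewrite eq_rshift (inj_eq inj_f) => /andP[-> ->].
Qed.

End bidegree.

(** * q-holomorphic functions *)

Section q_holomorphic_criterion.
Context {R : realType} {n : nat}.
Local Notation C := R[i].
Local Notation Cn := 'rV[C]_n.
Local Notation form := (ext_form R n).
Implicit Types (f g : Cn -> C) (z v : Cn) (U : set Cn) (j k : 'I_n).

Lemma wedge1r (a : form) : wedge a (ext_scalar 1) = a.
Proof.
apply/ffunP => S; rewrite ffunE (sum_only1 (i0 := S)).
- rewrite ffunE finset.setDv eqxx mulr1 /inversions (_ : [set p in _ | _]%SET = finset.set0).
    by rewrite cards0 mul1r.
  by apply/setP => p; rewrite !inE andbF.
- by [].
- move=> A AS AnS; rewrite ffunE ifF ?mulr0//.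
  by apply/negbTE; rewrite finset.setD_eq0; apply: contra AnS => SA; rewrite finset.eqEsubset AS.
Qed.

Lemma rderive_cst (c : C) v z : rderive (fun=> c) v z = 0 :> C.
Proof. exact: rd_rderive (rd_cst c z v). Qed.

Lemma d_dzbar_cst j (c : C) z : d_dzbar j (fun=> c) z = 0 :> C.
Proof. by rewrite /d_dzbar !rderive_cst mulr0 addr0 mulr0. Qed.

Lemma delbar_scalar f z : delbar (fun y => ext_scalar (f y)) z =
  \sum_j scl (d_dzbar j f z) (gen (bar j)).
Proof.
rewrite /delbar; apply: eq_bigr => j _; apply/ffunP => S.
rewrite -[dzbar j]/(gen (bar j)) wedge_gen ffunE.
case: ifPn => jS; last first.
  rewrite !ffunE; have [e|_] := eqVneq S [set bar j]%SET; last by rewrite mulr0.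
  by rewrite e inE eqxx in jS.
rewrite !ffunE; have [->|Sj] := eqVneq S [set bar j]%SET.
  have e : ([set bar j] :\ bar j)%SET = finset.set0 by rewrite finset.setDv.
  rewrite e /sg inversions1 (_ : [set s in _ | _]%SET = finset.set0); last first.
    by apply/setP => s; rewrite !inE.
  rewrite cards0 mul1r mulr1; congr (d_dzbar j _ z).
  by apply/funext => y; rewrite ffunE eqxx.
rewrite mulr0.
rewrite [X in d_dzbar j X](_ : _ = (fun=> 0)); first by rewrite d_dzbar_cst mulr0.
apply/funext => y; rewrite ffunE ifF//; apply/negbTE; apply: contra Sj => /eqP e.
by rewrite -(finset.setD1K jS) e finset.setU0.
Qed.

Lemma delbar_scalarE f z S : delbar (fun y => ext_scalar (f y)) z S =
  \sum_j d_dzbar j f z * (S == [set bar j]%SET)%:R.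
Proof.
by rewrite delbar_scalar sum_ffunE; apply: eq_bigr => j _; rewrite !ffunE.
Qed.

Lemma q_holomorphic0P U g : q_holomorphic 0 U g <->
  contDiff 2 U g /\ forall z, U z -> forall j, d_dzbar j g z = 0.
Proof.
split=> [[cg h]|[cg h]]; split=> //; last first.
  move=> z Uz /=; rewrite wedge1r delbar_scalar big1// => j _.
  by rewrite h//; apply/ffunP => S; rewrite !ffunE mul0r.
move=> z Uz j; have := h z Uz; rewrite /= wedge1r => /ffunP/(_ [set bar j]%SET).
rewrite delbar_scalarE ffunE (sum_only1 (i0 := j))//; first by rewrite eqxx mulr1.
move=> k _ kj; case: eqP => [/finset.set1_inj/rshift_inj e|]; last by rewrite mulr0.
by rewrite e eqxx in kj.
Qed.

Lemma contDiff_d_dzbar p U f k : open U -> contDiff p.+1 U f -> contDiff p U (d_dzbar k f).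
Proof.
move=> oU cf; rewrite /d_dzbar; apply: contDiffM => //; first exact: contDiff_cst.
apply: contDiffD => //; first exact: (contDiff_rderive false k cf).
by apply: contDiffM => //; [exact: contDiff_cst|exact: (contDiff_rderive true k cf)].
Qed.

Lemma d_dz_lincomb (I : Type) (r : seq I) (F : I -> Cn -> C) (c : I -> C) U z j : open U -> U z ->
  (forall i, contDiff 1 U (F i)) ->
  d_dz j (fun y => \sum_(i <- r) F i y * c i) z = \sum_(i <- r) d_dz j (F i) z * c i.
Proof.
move=> oU Uz cF.
have key b : rderive (fun y => \sum_(i <- r) F i y * c i) (cdir b j) z =
    \sum_(i <- r) rderive (F i) (cdir b j) z * c i.
  apply: rd_rderive; apply: rd_sum => i.
  rewrite -[X in rd _ _ _ X]addr0 -[X in _ + X](mulr0 (F i z)).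
  by apply: rdM; [exact: contDiff_rderivable (cF i) Uz|exact: rd_cst].
rewrite /d_dz (key false) (key true).
under [RHS]eq_bigr do rewrite -mulrA mulrBl -[in X in _ - X]mulrA.
by rewrite -mulr_sumr big_split /= sumrN -mulr_sumr.
Qed.

Lemma del_delbar U f z : open U -> U z -> contDiff 2 U f ->
  del (delbar (fun y => ext_scalar (f y))) z =
  \sum_j wedge (gen (lshift n j)) (\sum_k scl (d_dz j (d_dzbar k f) z) (gen (bar k))).
Proof.
move=> oU Uz cf; rewrite /del; apply: eq_bigr => j _.
congr (wedge _ _); apply/ffunP => S; rewrite ffunE sum_ffunE.
rewrite (_ : (fun y => _) = (fun y => \sum_k d_dzbar k f y * (S == [set bar k]%SET)%:R)); last first.
  by apply/funext => y; rewrite delbar_scalarE.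
rewrite (@d_dz_lincomb _ _ (fun k => d_dzbar k f) (fun k => (S == [set bar k]%SET)%:R) U z j oU Uz); last first.
  by move=> k; exact: (contDiff_d_dzbar k oU cf).
by apply: eq_bigr => k _; rewrite !ffunE.
Qed.

Lemma wedge_del_delbar (h : 'I_n -> 'I_n -> C) (b : form) :
  wedge (\sum_j wedge (gen (lshift n j)) (\sum_k scl (h j k) (gen (bar k)))) b =
  \sum_j wedge (gen (lshift n j)) (\sum_k scl (h j k) (wedge (gen (bar k)) b)).
Proof.
rewrite wedge_suml; apply: eq_bigr => j _.
rewrite wedge_sumr wedge_suml wedge_sumr; apply: eq_bigr => k _.
rewrite !wedge_sclr wedge_scll wedge_gen2//=.
by rewrite ltn_addr.
Qed.

(* If f is holomorphic along an m-dimensional space of directions, then dbar f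
   and the second factors of d dbar f span at most n - m antiholomorphic
   covectors, so a product of q + 1 > n - m of them vanishes. *)
Lemma q_holomorphic_directions (m q : nat) (M : 'M[C]_(m, n)) U f : open U ->
  contDiff 2 U f -> row_free M -> (n - m <= q)%N ->
  (forall z i, U z -> \sum_k M i k * d_dzbar k f z = 0) ->
  q_holomorphic q U f.
Proof.
move=> oU cf fM nmq hM; split=> // z Uz /=.
set w := wedge_exp _ q.
have [w0 hw] : (forall i, contract_bar (M i) w = 0) /\ homog q w.
  rewrite /w; elim: (q) => [|p [IH1 IH2]].
    by split; [move=> i; exact: contract_bar_one|exact: homog_one].
  move: IH1 IH2; rewrite /wedge_exp iterS -/(wedge_exp _ p) (del_delbar oU Uz cf) wedge_del_delbar.
  move: (wedge_exp _ p) => w' IH1 IH2; split; last first.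
    by apply: homog_sum => j; apply: homog_dz; apply: homog_sum => k; apply: homog_scl;
      exact: homog_dzbar.
  (* The relation [hM] holds on an open set and [M] is constant, so it may be differentiated by
     [d_dz j]: the second factors of d dbar f also annihilate the vectors [M i]. *)
  move=> i; rewrite contract_bar_sum big1// => j _.
  apply: contract_bar_dz; apply: contract_bar_dzbar => //.
  under eq_bigr do rewrite mulrC.
  rewrite -(@d_dz_lincomb _ _ (fun k => d_dzbar k f) (fun k => M i k) U z j oU Uz); last first.
    by move=> k; exact: (contDiff_d_dzbar k oU cf).
  have key b : rderive (fun y => \sum_k d_dzbar k f y * M i k) (cdir b j) z = 0.
    apply: rd_rderive; apply: (@rd_eq _ _ (fun=> 0) _ _ _ _ U) => //.
      move=> y Uy; transitivity (\sum_k M i k * d_dzbar k f y); first by rewrite hM.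
      by apply: eq_bigr => k _; rewrite mulrC.
    exact: rd_cst.
  by rewrite /d_dz (key false) (key true) mulr0 subr0 mulr0.
have e : wedge (delbar (fun y => ext_scalar (f y)) z) w =
    \sum_k scl (d_dzbar k f z) (wedge (gen (bar k)) w).
  by rewrite delbar_scalar wedge_suml; apply: eq_bigr => k _; rewrite wedge_scll.
rewrite e; apply: (contract_bar_eq0 fM nmq); last first.
  by move=> i; apply: contract_bar_dzbar; [exact: w0|exact: hM].
by apply: homog_sum => k; apply: homog_scl; exact: homog_dzbar.
Qed.

End q_holomorphic_criterion.

(** * Test functions concentrated near a plane *)

Section complement.
Context {F : fieldType}.

(** Stack [A] on a basis [A'] of a complement of its row space; [B] and [B'] are the column blocks
    of the inverse. Then [z *m B] gives coordinates along the plane and [z *m B'] across it. *)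
Lemma row_free_complement (m q N : nat) (A : 'M[F]_(m, N)) : row_free A -> (m + q = N)%N ->
  exists A' : 'M[F]_(q, N), exists B : 'M[F]_(N, m), exists B' : 'M[F]_(N, q),
  [/\ A *m B = 1%:M, A *m B' = 0, A' *m B = 0, A' *m B' = 1%:M & B *m A + B' *m A' = 1%:M].
Proof.
move=> fA e; case: N / e A fA => A fA.
have rC : \rank (A^C)%MS = q by rewrite mxrank_compl (eqP fA) addKn.
have [A' eA'] : exists A' : 'M[F]_(q, m + q), (A' :=: A^C)%MS.
  by move: (row_base (A^C)%MS) (eq_row_base (A^C)%MS); rewrite rC => A' eA'; exists A'.
have U : col_mx A A' \in unitmx.
  rewrite -row_full_unit -sub1mx -(addsmxE A A').
  by rewrite (adds_eqmx (eqmx_refl A) eA') sub1mx addsmx_compl_full.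
exists A', (lsubmx (invmx (col_mx A A'))), (rsubmx (invmx (col_mx A A'))).
have h1 := mulmxV U; have h2 := mulVmx U.
move: (invmx _) h1 h2 => X h1 h2.
move: h1 h2; rewrite -{1 2}[X]hsubmxK mul_col_row mul_row_col scalar_mx_block.
by move=> /eq_block_mx [-> -> -> ->] ->.
Qed.

End complement.

Section peak_limit.
Context {R : realType} {T : topologicalType}.

(* With phi <= 1, the sets where phi^k G >= M decrease with k, and compactness
   gives a point in all of them: there phi = 1. *)
Lemma peak_limit (S : set T) (phi G : T -> R) (M : R) : compact S -> 0 < M ->
  (forall x, S x -> {for x, continuous phi}) -> (forall x, S x -> {for x, continuous G}) ->
  (forall x, S x -> 0 <= phi x <= 1) -> (forall x, S x -> 0 <= G x) ->
  (forall k, exists2 z, S z & M <= phi z ^+ k * G z) ->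
  exists z, [/\ S z, phi z = 1 & M <= G z].
Proof.
move=> cS M0 cphi cG phi01 G0 hk; apply: contrapT => no.
pose P (k : nat) (x : T) := S x -> phi x ^+ k * G x < M.
(* Contrapositive form: near every point of [S] the product is eventually below [M], and compactness
   yields one [k] for all of [S]. *)
have : \forall k \near \oo, S `<=` P k.
  apply: (proj1 (compact_near_coveringP S) cS nat \oo P _) => x Sx.
  have /andP[p0 p1] := phi01 x Sx.
  have [e|ne] := eqVneq (phi x) 1.
    have GM : G x < M by rewrite ltNge; apply/negP => h; apply: no; exists x.
    have nG : \forall y \near x, G y < M by exact: (cG x Sx _ (lt_nbhsl GM)).
    near=> y k => Sy; apply: le_lt_trans (_ : G y < M).
      have /andP[q0 q1] := phi01 y Sy.
      by rewrite ler_piMl ?G0// exprn_ile1.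
    by near: y.
  have px1 : phi x < 1 by rewrite lt_neqAle ne.
  pose r := (phi x + 1) / 2.
  have [r0 r1 pr] : [/\ 0 <= r, r < 1 & phi x < r] by rewrite /r; split; lra.
  have nphi : \forall y \near x, phi y < r by exact: (cphi x Sx _ (lt_nbhsl pr)).
  have nG : \forall y \near x, G y < G x + 1 by apply: (cG x Sx _ (lt_nbhsl _)); lra.
  have Gx1 : 0 < G x + 1 by have := G0 x Sx; lra.
  have nk : \forall k \near \oo, r ^+ k < M / (G x + 1).
    have := @cvg_expr R r; rewrite ger0_norm// => /(_ r1) /cvgrPdist_lt.
    move=> /(_ (M / (G x + 1))); rewrite divr_gt0// => /(_ isT); apply: filterS => k.
    by rewrite sub0r normrN ger0_norm ?exprn_ge0.
  near=> y k => Sy.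
  have /andP[q0 q1] := phi01 y Sy.
  have h1 : phi y < r by near: y.
  have h2 : G y < G x + 1 by near: y.
  have h3 : r ^+ k < M / (G x + 1) by near: k.
  apply: (@le_lt_trans _ _ (r ^+ k * (G x + 1))).
    apply: ler_pM; [exact: exprn_ge0|exact: G0| |exact: ltW].
    by apply: lerXn2r; rewrite ?nnegrE// ltW.
  by rewrite -ltr_pdivlMr.
move=> [k _ /(_ k (leqnn k)) hk'].
have [z Sz] := hk k; have := hk' z Sz Sz; by move=> /lt_le_trans h /h; rewrite ltxx.
Unshelve. all: end_near. Qed.

End peak_limit.

Section affine_maps.
Context {R : realType} {N m : nat}.
Local Notation C := R[i].
Variables (p : 'rV[C]_N) (B : 'M[C]_(N, m)).

Definition proj_mx_at (z : 'rV[C]_N) : 'rV[C]_m := (z - p) *m B.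

Lemma for_continuous_sum (I : Type) (r : seq I) (F : I -> 'rV[C]_N -> C) z :
  (forall i, {for z, continuous (F i)}) ->
  {for z, continuous (fun y => \sum_(i <- r) F i y)}.
Proof.
move=> h; elim: r => [|i r IH].
  have -> : (fun y => \sum_(i <- [::]) F i y) = (fun=> 0) by apply/funext => y; rewrite big_nil.
  exact: for_continuous_cst.
have -> : (fun y => \sum_(j <- i :: r) F j y) = (fun y => F i y + \sum_(j <- r) F j y).
  by apply/funext => y; rewrite big_cons.
exact: (for_continuousD (h i) IH).
Qed.

Lemma proj_mx_at_coord z j : proj_mx_at z 0 j = \sum_k (z 0 k + - p 0 k) * B k j.
Proof. by rewrite mxE; apply: eq_bigr => k _; rewrite !mxE. Qed.

Lemma proj_mx_at_continuous : continuous proj_mx_at.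
Proof.
move=> z; apply: (@rV_cvg _ _ _ (nbhs z)) => j.
rewrite (_ : (fun x => proj_mx_at x 0 j) = (fun x : 'rV[C]_N => \sum_k (x 0 k + - p 0 k) * B k j)).
  rewrite proj_mx_at_coord.
  apply: (@for_continuous_sum _ _ (fun k (x : 'rV[C]_N) => (x 0 k + - p 0 k) * B k j)) => k.
  have ck : {for z, continuous (fun x : 'rV[C]_N => x 0 k)} by exact: coord_cvg.
  exact: (for_continuousM (for_continuousD ck (@for_continuous_cst _ _ (- p 0 k) z)) (@for_continuous_cst _ _ (B k j) z)).
by apply/funext => x; rewrite proj_mx_at_coord.
Qed.

Lemma proj_mx_at_affine z v (t : C) : proj_mx_at (z + t *: v) = proj_mx_at z + t *: (v *m B).
Proof. by rewrite /proj_mx_at addrAC mulmxDl scalemxAl. Qed.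

End affine_maps.

Section slice_boundary.
Context {R : realType} {N m q : nat}.
Local Notation C := R[i].
Local Notation Re := (@complex.Re R).
Local Notation Im := (@complex.Im R).
Variables (A : 'M[C]_(m, N)) (A' : 'M[C]_(q, N)) (B : 'M[C]_(N, m)) (B' : 'M[C]_(N, q)).
Hypotheses (AB : A *m B = 1%:M) (AB' : A *m B' = 0)
  (BB' : B *m A + B' *m A' = 1%:M) (mqN : (m + q)%N = N).
Variables (p : 'rV[C]_N) (K : set 'rV[C]_N).
Hypothesis compactK : compact K.

(** [W] inverts [plane_param] on the plane through [p]; [Z] collects the transverse coordinates and
    has that plane as its zero set. *)
Let W := proj_mx_at p B.
Let Z := proj_mx_at p B'.

Lemma rank_direction : row_free A.
Proof. by apply/row_freeP; exists B. Qed.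

Lemma W_param w : W (plane_param A p w) = w.
Proof. by rewrite /W /proj_mx_at /plane_param addrAC subrr add0r -mulmxA AB mulmx1. Qed.

Lemma Z_param w : Z (plane_param A p w) = 0.
Proof. by rewrite /Z /proj_mx_at /plane_param addrAC subrr add0r -mulmxA AB' mulmx0. Qed.

Lemma affine_planeE z : affine_plane A p z <-> Z z = 0.
Proof.
split=> [[w _ <-]|Zz]; first exact: Z_param.
exists (W z) => //; rewrite /plane_param.
have : (z - p) *m (B *m A + B' *m A') = z - p by rewrite BB' mulmx1.
rewrite mulmxDr !mulmxA -[(z - p) *m B']/(Z z) Zz mul0mx addr0 => ->.
by rewrite addrC subrK.
Qed.

Lemma plane_paramK z : affine_plane A p z -> plane_param A p (W z) = z.
Proof. by move=> [w _ <-]; rewrite W_param. Qed.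

Definition offset (z : 'rV[C]_N) : R := \sum_j nsq (Z z 0 j).

Lemma offset_ge0 z : 0 <= offset z.
Proof. by apply: sumr_ge0 => j _; exact: nsq_ge0. Qed.

Lemma offset_eq0 z : (offset z == 0) = (Z z == 0).
Proof.
rewrite /offset psumr_eq0; last by move=> j _; exact: nsq_ge0.
apply/allP/eqP => [h|h j _]; last by rewrite h mxE nsq0 eqxx.
by apply/rowP => j; rewrite [RHS]mxE; apply/eqP; rewrite -nsq_eq0; have := h j (mem_index_enum j).
Qed.

Lemma offset_complex z : (offset z)%:C = \sum_j Z z 0 j * conjc (Z z 0 j).
Proof.
rewrite /offset rmorph_sum; apply: eq_bigr => j _.
by apply: complexP; rewrite /nsq !cReImE; ring.
Qed.

Lemma Z_affine z v (t : R) : Z (z + t%:C *: v) = Z z + t%:C *: (v *m B').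
Proof. exact: proj_mx_at_affine. Qed.

Lemma Zj_continuous j : continuous (fun z => Z z 0 j).
Proof.
move=> z; exact: (continuous_comp (@proj_mx_at_continuous R N q p B' z) (@coord_continuous C 1 q 0 j _)).
Qed.

Lemma contDiff_offset k U : open U -> contDiff k U (fun z => (offset z)%:C).
Proof.
move=> oU; have -> : (fun z => (offset z)%:C) = (fun z => \sum_j Z z 0 j * conjc (Z z 0 j)).
  by apply/funext => z; rewrite offset_complex.
apply: contDiff_sum => // j; apply: contDiffM => //.
  apply: (@contDiff_affine _ _ _ _ _ (fun v => (v *m B') 0 j)) => //; first exact: Zj_continuous.
  by move=> z v t; rewrite Z_affine !mxE.
apply: (@contDiff_affine _ _ _ _ _ (fun v => conjc ((v *m B') 0 j))) => //.
  move=> z; exact: (continuous_comp (@Zj_continuous j z) (@conjc_continuous R _)).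
by move=> z v t; apply: complexP; rewrite Z_affine !mxE !cReImE; ring.
Qed.

Lemma offset_continuous : continuous offset.
Proof.
move=> z; have := contDiff_continuous (@contDiff_offset 0 setT openT) (I : setT z).
by move=> h; exact: (continuous_comp h (@Re_continuous R _)).
Qed.

Section test_functions.
Variables (eps : R) (U : set 'rV[C]_m) (g : 'rV[C]_m -> C).
Hypotheses (eps0 : 0 < eps) (oU : open U) (gU : q_holomorphic 0 U g).

Definition cutoff (z : 'rV[C]_N) : R := Num.max 0 (1 - offset z / eps).
(** The exponent starts at 3, the least for which [contDiff_pos_part] gives two continuous
    derivatives. *)
Definition test_fun (k : nat) (z : 'rV[C]_N) : C := (cutoff z ^+ k.+3)%:C * g (W z).

Lemma cutoff_ge0 z : 0 <= cutoff z. Proof. by rewrite le_max lexx. Qed.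
Lemma cutoff_le1 z : cutoff z <= 1.
Proof. by rewrite ge_max ler01 gerBl divr_ge0 ?offset_ge0// ltW. Qed.
Lemma cutoff_eq1 z : cutoff z = 1 <-> affine_plane A p z.
Proof.
rewrite affine_planeE; split=> [|h]; last first.
  have e : offset z = 0 by apply/eqP; rewrite offset_eq0 h.
  by rewrite /cutoff e mul0r subr0 max_r.
rewrite /cutoff => h; apply/eqP; rewrite -offset_eq0; apply/eqP.
have e0 := offset_ge0 z; have : offset z / eps = 0.
  have : 0 <= offset z / eps by rewrite divr_ge0// ltW.
  by move: h; case: (lerP 0 (1 - offset z / eps)) => h1 h2 h3; lra.
by move/eqP; rewrite mulf_eq0 invr_eq0 (gt_eqF eps0) orbF => /eqP.
Qed.

Lemma cutoff_continuous : continuous cutoff.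
Proof.
move=> z; apply: (@continuous_max _ _ (fun=> 0) (fun z => 1 - offset z / eps)).
  exact: (@cst_continuous _ R 0 z).
have c1 : offset y / eps @[y --> z] --> offset z / eps by exact: (cvgMr_tmp (b := eps^-1) (@offset_continuous z)).
have c2 : (1 : R) @[y --> z] --> (1 : R) by exact: (@cst_continuous _ R 1 z).
exact: (cvgB c2 c1).
Qed.

(** On [U1] the factor g(W z) is holomorphic in the plane coordinates. On [U2] the cutoff is 0,
    hence so is the test function, whatever value [g] takes there. A suitable [eps] makes the two
    sets cover [K]. *)
Let U1 := W @^-1` U.
Let U2 := [set z | eps < offset z].

Lemma test_domain_open : open U1 /\ open U2.
Proof.
split; first by apply: open_comp => // z _; exact: proj_mx_at_continuous.
by apply: (@open_comp _ _ offset [set x | eps < x]) => [z _|];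
  [exact: offset_continuous|exact: open_gt].
Qed.

Lemma test_fun_eq0 k z : U2 z -> test_fun k z = 0.
Proof.
move=> h; rewrite /test_fun /cutoff max_l; first by rewrite expr0n /= mul0r.
by rewrite subr_le0 ler_pdivlMr// mul1r ltW.
Qed.

Lemma contDiff_test_fun k : contDiff 2 (U1 `|` U2) (test_fun k).
Proof.
have [oU1 oU2] := test_domain_open.
apply: contDiff_setU; last first.
  have e z : U2 z -> 0 = test_fun k z by move=> h; rewrite test_fun_eq0.
  exact: (@contDiff_eq R N 2 U2 (fun=> 0) (test_fun k) oU2 e (@contDiff_cst R N 2 U2 0 oU2)).
have c1 : contDiff 2 U1 (fun z => (1 - offset z / eps)%:C).
  have -> : (fun z => (1 - offset z / eps)%:C) =
      (fun z => 1 + (- eps^-1)%:C * (offset z)%:C).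
    by apply/funext => z; apply: complexP; rewrite !cReImE; ring.
  exact: (contDiffD oU1 (@contDiff_cst _ _ 2 U1 1 oU1)
    (contDiffM oU1 (@contDiff_cst _ _ 2 U1 _ oU1) (@contDiff_offset 2 U1 oU1))).
have c2 : contDiff 2 U1 (fun z => (cutoff z ^+ k.+3)%:C).
  exact: (@contDiff_pos_part R N 2 k.+2 U1 (fun z => 1 - offset z / eps) oU1 isT c1).
have c3 : contDiff 2 U1 (g \o W).
  apply: (@contDiff_comp_affine _ _ _ W (fun v => v *m B) _ _ 2 U g oU).
  - exact: proj_mx_at_continuous.
  - by move=> z v t; exact: proj_mx_at_affine.
  - by have [] := proj1 (q_holomorphic0P U g) gU.
exact: (contDiffM oU1 c2 c3).
Qed.

(** Directions with [v *m B' = 0] are parallel to the plane: the offset, and with it the cutoff, is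
    constant along them. *)
Lemma rderive_test_fun k z v : v *m B' = 0 -> U1 z ->
  rderive (test_fun k) v z = (cutoff z ^+ k.+3)%:C * rderive g (v *m B) (W z).
Proof.
move=> vB' Uz.
have [cg _] := proj1 (q_holomorphic0P U g) gU.
have h := rd_dirderiv (v *m B) oU Uz (contDiffW cg).
have eq t : test_fun k (z + t%:C *: v) = (cutoff z ^+ k.+3)%:C * g (W z + t%:C *: (v *m B)).
  rewrite /test_fun /cutoff /offset Z_affine vB' scaler0 addr0; congr (_ * g _).
  exact: proj_mx_at_affine.
have -> : rderive g (v *m B) (W z) = dirderiv g (W z) (v *m B) by exact: rd_rderive h.
apply: rd_rderive.
have h2 := rdM (rd_cst ((cutoff z ^+ k.+3)%:C) (W z) (v *m B)) h.
rewrite mul0r add0r in h2.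
have e1 : re_along (test_fun k) z v = re_along (fun y => (cutoff z ^+ k.+3)%:C * g y) (W z) (v *m B).
  by apply/funext => t; rewrite /re_along eq.
have e2 : im_along (test_fun k) z v = im_along (fun y => (cutoff z ^+ k.+3)%:C * g y) (W z) (v *m B).
  by apply/funext => t; rewrite /im_along eq.
by rewrite /rd e1 e2.
Qed.

Lemma q_holomorphic_test_fun k : q_holomorphic q (U1 `|` U2) (test_fun k).
Proof.
have [oU1 oU2] := test_domain_open.
have cf := contDiff_test_fun k.
(* The holomorphic directions are the [m] rows of [A]; they enter conjugated because dbar f is
   paired with conjugate vectors, as in [sum_d_dzbar]. *)
apply: (@q_holomorphic_directions _ _ m q (map_mx (@conjc R) A) _ _ (openU oU1 oU2) cf).
- by rewrite row_free_map; exact: rank_direction.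
- by rewrite -mqN addKn.
move=> z i Uz.
have -> : \sum_l map_mx (@conjc R) A i l * d_dzbar l (test_fun k) z =
    \sum_l conjc (row i A 0 l) * d_dzbar l (test_fun k) z.
  by apply: eq_bigr => l _; rewrite !mxE.
have [Uz1|Uz2] := Uz; last first.
  apply: big1 => l _; rewrite [d_dzbar _ _ _](_ : _ = 0) ?mulr0//.
  have key b : rderive (test_fun k) (cdir b l) z = 0.
    apply: rd_rderive; apply: (@rd_eq _ _ (fun=> 0) _ _ _ _ U2 oU2 Uz2); last exact: rd_cst.
    by move=> y h; rewrite test_fun_eq0.
  by rewrite /d_dzbar (key false) (key true) mulr0 addr0 mulr0.
rewrite (sum_d_dzbar _ (openU oU1 oU2) Uz (contDiffW cf)).
have rB' : row i A *m B' = 0 by rewrite -row_mul AB' row0.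
have rB : row i A *m B = delta_mx 0 i by rewrite -row_mul AB row1.
rewrite !rderive_test_fun//; last by rewrite -scalemxAl rB' scaler0.
rewrite -scalemxAl rB.
have [_ /(_ _ Uz1 i)] := proj1 (q_holomorphic0P U g) gU.
rewrite /d_dzbar -/(x_dir i) -/(y_dir i); move=> h.
rewrite [RHS](_ : _ = (cutoff z ^+ k.+3)%:C * 0); last by rewrite mulr0.
rewrite -[in RHS]h /x_dir /y_dir.
move: (rderive _ _ _) (rderive _ _ _) (_ ^+ _)%:C => a b c; ring.
Qed.

End test_functions.
End slice_boundary.

(** * Traces of closed boundaries on a plane *)

Section slice_closed_boundary.
Context {R : realType} {N m q : nat}.
Local Notation C := R[i].
Variables (A : 'M[C]_(m, N)) (A' : 'M[C]_(q, N)) (B : 'M[C]_(N, m)) (B' : 'M[C]_(N, q)).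
Hypotheses (AB : A *m B = 1%:M) (AB' : A *m B' = 0)
  (BB' : B *m A + B' *m A' = 1%:M) (mqN : (m + q)%N = N).
Variables (p : 'rV[C]_N) (K S : set 'rV[C]_N).
Hypothesis compactK : compact K.
Hypothesis closedK : closed K.
Hypothesis boundaryS : closed_boundary K (q_holomorphic_on q K) S.

Let W := proj_mx_at p B.

Lemma plane_closed : closed (affine_plane A p).
Proof.
have -> : affine_plane A p = (offset B' p) @^-1` [set x | x <= 0].
  apply/seteqP; split=> z.
    move=> /(affine_planeE AB' BB' p z) h /=.
    by rewrite le_eqVlt offset_eq0 h eqxx.
  move=> /= h; apply/(affine_planeE AB' BB' p z); apply/eqP; rewrite -offset_eq0.
  by rewrite eq_le h offset_ge0.
apply: closed_comp; [by move=> z _; exact: offset_continuous|exact: closed_le].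
Qed.

Lemma compactS : compact S.
Proof. by have [cS SK _] := boundaryS; exact: (subclosed_compact cS compactK SK). Qed.

(** On the plane each test function equals [g], so its maximum over [K], attained on [S], is at
    least |g(w0)|. By [peak_limit] some point of [S] keeps this bound with cutoff 1, which puts it
    on the plane. *)
Lemma slice_peak (U : set 'rV[C]_m) (g : 'rV[C]_m -> C) (w0 : 'rV[C]_m) : open U ->
  q_holomorphic 0 U g -> (forall w, K (plane_param A p w) -> U w) ->
  K (plane_param A p w0) -> 0 < nsq (g w0) ->
  exists2 w, S (plane_param A p w) & nsq (g w0) <= nsq (g w).
Proof.
move=> oU gU KU Kw0 g0.
(* The points of [K] that [W] sends outside [U] form a compact set disjoint from the plane. The
   offset has a positive minimum there, and half of it serves. *)
have [eps eps0 heps] : exists2 eps : R, 0 < eps & forall z, K z -> offset B' p z <= eps -> U (W z).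
  pose bad := K `&` ~` (W @^-1` U).
  have cbad : compact bad.
    apply: (subclosed_compact _ compactK) => [|z []//].
    apply: closedI => //; apply: open_closedC; apply: open_comp => // z _.
    exact: proj_mx_at_continuous.
  have [bad0|/set0P/negP/negPn/eqP bad0] := pselect (bad !=set0); last first.
    exists 1 => // z Kz _; apply: contrapT => h.
    by have : bad z by []; rewrite bad0.
  have [|z1] := @compact_EVT_max _ _ (fun z => - offset B' p z) bad bad0 cbad.
    by apply: continuous_subspaceT => z; exact: (cvgN (@offset_continuous _ _ _ B' p z)).
  rewrite inE => -[Kz1 nU] hmin.
  have o1 : 0 < offset B' p z1.
    rewrite lt_neqAle offset_ge0 andbT eq_sym; apply/negP => /eqP e; apply: nU.
    have /(affine_planeE AB' BB' p z1) [w _ ew] : proj_mx_at p B' z1 = 0.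
      by apply/eqP; rewrite -offset_eq0 e.
    by rewrite /= -ew /W (W_param AB p w); apply: KU; rewrite ew.
  exists (offset B' p z1 / 2); first by rewrite divr_gt0.
  move=> z Kz oz; apply: contrapT => h.
  have /hmin : z \in bad by rewrite inE.
  by rewrite lerN2 => /le_trans/(_ oz); rewrite leNgt ltr_pdivrMr// ltr_pMr// ltr1n.
have KV : K `<=` (W @^-1` U) `|` [set z | eps < offset B' p z].
  by move=> z Kz; case: (leP (offset B' p z) eps) => h; [left; exact: heps|right].
pose F k := test_fun B B' p eps g k.
have Fcont k z : K z -> {for z, continuous (F k)}.
  move=> Kz; exact: (contDiff_continuous (contDiff_test_fun B B' p eps0 oU gU k) (KV z Kz)).
have Fhol k : q_holomorphic_on q K (F k).
  split; first by apply: continuous_in_subspaceT => z; rewrite inE; exact: Fcont.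
  exists ((W @^-1` U) `|` [set z | eps < offset B' p z]), (F k); split=> //.
    by have := test_domain_open B B' p eps oU; case=> o1 o2; exact: openU.
  exact: (q_holomorphic_test_fun AB AB' mqN p eps0 oU gU k).
have [cS SK hS] := boundaryS.
pose phi z := cutoff B' p eps z ^+ 2.
pose G z := nsq (F 0%N z).
have FkE k z : nsq (F k z) = phi z ^+ k * G z.
  rewrite /G /F /test_fun !nsqM !nsq_real /phi mulrA; congr (_ * _).
  by rewrite -!exprM -exprD; congr (_ ^+ _); rewrite -[in LHS]addn3 mulnDl mulnC.
have c01 z : 0 <= cutoff B' p eps z <= 1 by rewrite cutoff_ge0 cutoff_le1.
have [z [Sz phiz Gz]] : exists z, [/\ S z, phi z = 1 & nsq (g w0) <= G z].
  apply: (peak_limit compactS g0) => [x Sx|x Sx|x Sx|x Sx|k].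
  - exact: (continuous_comp (@cutoff_continuous _ _ _ B' p eps x) (@exprn_continuous R 2 _)).
  - exact: (continuous_comp (Fcont 0%N x (SK x Sx)) (@nsq_continuous R _)).
  - by have /andP[h1 h2] := c01 x; rewrite exprn_ge0//= exprn_ile1.
  - exact: nsq_ge0.
  have [z Sz hz] := hS _ (Fhol k); exists z => //; rewrite -FkE.
  have := hz _ Kw0; rewrite ler_norm_nsq; apply: le_trans.
  have c1 : cutoff B' p eps (plane_param A p w0) = 1.
    by apply/(cutoff_eq1 AB' BB' p eps0 _); exists w0.
  by rewrite /F /test_fun c1 expr1n (W_param AB p w0) nsqM nsq_real expr1n mul1r.
have cz1 : cutoff B' p eps z = 1.
  have /andP[h1 h2] := c01 z; apply/eqP; rewrite -(@eqrXn2 _ 2)// ?expr1n//.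
  exact/eqP.
have pz : affine_plane A p z by apply/(cutoff_eq1 AB' BB' p eps0 _).
exists (W z); first by rewrite (plane_paramK AB).
by move: Gz; rewrite /G /F /test_fun cz1 expr1n nsqM nsq_real expr1n mul1r.
Qed.

Lemma slice_closed_boundary : (K `&` affine_plane A p) !=set0 ->
  closed_boundary (K `&` affine_plane A p)
    (holomorphic_on_plane A p (K `&` affine_plane A p)) (S `&` affine_plane A p).
Proof.
move=> KA0; have [cS SK hS] := boundaryS.
split; [exact: (closedI cS plane_closed)|by move=> z [/SK]|].
move=> f [cf [U [g [oU KU gU fg]]]].
have cKA : compact (K `&` affine_plane A p).
  apply: (subclosed_compact _ compactK) => [|z []//]; exact: (closedI closedK plane_closed).
have KU' w : K (plane_param A p w) -> U w.
  by move=> Kw; apply: KU; split => //; exists w.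
have fg' w : K (plane_param A p w) -> f (plane_param A p w) = g w.
  by move=> Kw; apply: fg; split => //; exists w.
have cnf : {within K `&` affine_plane A p, continuous (fun z => nsq (f z))}.
  by move=> x; exact: (continuous_comp (cf x) (@nsq_continuous R _)).
have [z0] := @compact_EVT_max _ _ (fun z => nsq (f z)) _ KA0 cKA cnf.
rewrite inE => -[Kz0 [w0 _ wz0]] hmax.
have hmax' w : K (plane_param A p w) -> nsq (g w) <= nsq (g w0).
  move=> Kw; rewrite -!fg' ?wz0//; apply: hmax; rewrite inE; split => //; by exists w.
have Kw0 : K (plane_param A p w0) by rewrite wz0.
suff [w Sw hw] : exists2 w, S (plane_param A p w) & nsq (g w0) <= nsq (g w).
  exists (plane_param A p w); first by split => //; exists w.
  move=> y [Ky [wy _ ey]]; rewrite -ey ler_norm_nsq !fg' ?ey//; last exact: SK.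
  by apply: le_trans hw; apply: hmax'; rewrite ey.
have [g0|g0] := ltP 0 (nsq (g w0)); first exact: slice_peak oU gU KU' Kw0 g0.
(* If the maximum of |f| is 0, any point of [S] on the plane will do; the constant function 1
   produces one. *)
have h1 : q_holomorphic 0 setT (fun _ : 'rV[C]_m => 1 : C).
  apply/q_holomorphic0P; split; first exact: (@contDiff_cst _ _ 2 setT 1 openT).
  by move=> z _ j; exact: d_dzbar_cst.
have n1 : 0 < nsq (1 : C) by rewrite nsq1.
have [w Sw _] := slice_peak openT h1 (fun w _ => I) Kw0 n1.
by exists w => //; apply: (le_trans g0); exact: nsq_ge0.
Qed.

End slice_closed_boundary.

(** * Supporting hyperplanes *)

Section hermitian.
Context {R : realType} {m : nat}.
Local Notation C := R[i].
Local Notation Cm := 'rV[C]_m.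
Local Notation Re := (@complex.Re R).
Local Notation Im := (@complex.Im R).
Implicit Types (x y z v w : Cm) (t : R) (K : set Cm).

Definition hdot z v : C := \sum_j z 0 j * conjc (v 0 j).
Definition nrm2 z : R := \sum_j nsq (z 0 j).

Lemma hdotDl x y v : hdot (x + y) v = hdot x v + hdot y v.
Proof. by rewrite /hdot -big_split /=; apply: eq_bigr => j _; rewrite !mxE mulrDl. Qed.
Lemma hdotZl (c : C) x v : hdot (c *: x) v = c * hdot x v.
Proof. by rewrite /hdot mulr_sumr; apply: eq_bigr => j _; rewrite !mxE mulrA. Qed.
Lemma hdotNl x v : hdot (- x) v = - hdot x v.
Proof. by rewrite -scaleN1r hdotZl mulN1r. Qed.
Lemma hdotBl x y v : hdot (x - y) v = hdot x v - hdot y v.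
Proof. by rewrite hdotDl hdotNl. Qed.
Lemma hdotC x y : hdot y x = conjc (hdot x y).
Proof.
rewrite /hdot rmorph_sum; apply: eq_bigr => j _.
by apply: complexP; rewrite !cReImE; ring.
Qed.
Lemma hdot_self x : hdot x x = (nrm2 x)%:C.
Proof.
rewrite /hdot /nrm2 rmorph_sum; apply: eq_bigr => j _.
by apply: complexP; rewrite /nsq !cReImE; ring.
Qed.
Lemma hdotDr x v w : hdot x (v + w) = hdot x v + hdot x w.
Proof. by rewrite hdotC hdotDl rmorphD /= -!hdotC. Qed.
Lemma hdotNr x v : hdot x (- v) = - hdot x v.
Proof. by rewrite hdotC hdotNl rmorphN /= -!hdotC. Qed.
Lemma hdotZr (c : R) x v : hdot x (c%:C *: v) = c%:C * hdot x v.
Proof.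
rewrite hdotC hdotZl rmorphM /= -!hdotC; congr (_ * _).
by apply: complexP; rewrite !cReImE ?oppr0.
Qed.

Lemma Re_hdotC x y : Re (hdot y x) = Re (hdot x y).
Proof. by rewrite hdotC cRe_conj. Qed.

Lemma nrm2_ge0 x : 0 <= nrm2 x.
Proof. by apply: sumr_ge0 => j _; exact: nsq_ge0. Qed.

Lemma nrm2_eq0 x : (nrm2 x == 0) = (x == 0).
Proof.
rewrite /nrm2 psumr_eq0; last by move=> j _; exact: nsq_ge0.
apply/allP/eqP => [h|h j _]; last by rewrite h mxE nsq0 eqxx.
by apply/rowP => j; rewrite [RHS]mxE; apply/eqP; rewrite -nsq_eq0; have := h j (mem_index_enum j).
Qed.

Lemma nrm2_gt0 x : (0 < nrm2 x) = (x != 0).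
Proof. by rewrite lt_neqAle nrm2_ge0 andbT eq_sym nrm2_eq0. Qed.

Lemma nrm2E x : nrm2 x = Re (hdot x x).
Proof. by rewrite hdot_self. Qed.

Lemma nrm2D x y : nrm2 (x + y) = nrm2 x + 2 * Re (hdot x y) + nrm2 y.
Proof. by rewrite !nrm2E hdotDl !hdotDr !cReD (Re_hdotC x y); ring. Qed.
Lemma nrm2N x : nrm2 (- x) = nrm2 x.
Proof. by rewrite !nrm2E hdotNl hdotNr opprK. Qed.
Lemma nrm2B x y : nrm2 (x - y) = nrm2 x - 2 * Re (hdot x y) + nrm2 y.
Proof. by rewrite nrm2D nrm2N hdotNr cReN; ring. Qed.
Lemma nrm2Z (c : C) x : nrm2 (c *: x) = nsq c * nrm2 x.
Proof. by rewrite /nrm2 mulr_sumr; apply: eq_bigr => j _; rewrite mxE nsqM. Qed.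
Lemma nrm2_sub x y : nrm2 (x - y) = nrm2 (y - x).
Proof. by rewrite -opprB nrm2N. Qed.

Lemma Re_hdot_le (e : R) x v : 0 < e -> nrm2 v = 1 -> nrm2 x <= e ^+ 2 -> Re (hdot x v) <= e.
Proof.
move=> e0 v1 xe; have := nrm2_ge0 (x - e%:C *: v).
rewrite nrm2B nrm2Z v1 nsq_real hdotZr cReM cRe_real cIm_real mul0r subr0 => h.
have : 2 * e * (e - Re (hdot x v)) >= 0 by nra.
by rewrite pmulr_rge0 ?mulr_gt0// subr_ge0.
Qed.

Lemma coord_sq_le x j : nsq (x 0 j) <= nrm2 x.
Proof.
by rewrite /nrm2 (bigD1 j)//= lerDl; apply: sumr_ge0 => k _; exact: nsq_ge0.
Qed.

Lemma hdot_continuous v : continuous (fun x : Cm => hdot x v).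
Proof.
move=> x; apply: (@for_continuous_sum _ _ _ _ (fun j (x : Cm) => x 0 j * conjc (v 0 j))) => j.
have cj : {for x, continuous (fun x : Cm => x 0 j)} by exact: coord_cvg.
exact: (for_continuousM cj (@for_continuous_cst _ _ (conjc (v 0 j)) x)).
Qed.

Lemma hdot_continuousr x : continuous (fun v : Cm => hdot x v).
Proof.
move=> v; have -> : (fun v : Cm => hdot x v) = (fun v => conjc (hdot v x)).
  by apply/funext => w; rewrite hdotC.
exact: (continuous_comp (@hdot_continuous x v) (@conjc_continuous R _)).
Qed.

Lemma nrm2_continuous : continuous nrm2.
Proof.
move=> x; have h : {for x, continuous (fun x : Cm => \sum_j x 0 j * conjc (x 0 j))}.
  apply: (@for_continuous_sum _ _ _ _ (fun j (x : Cm) => x 0 j * conjc (x 0 j))) => j.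
  have cj : {for x, continuous (fun x : Cm => x 0 j)} by exact: coord_cvg.
  exact: (for_continuousM cj (continuous_comp cj (@conjc_continuous R _))).
have -> : nrm2 = Re \o (fun x : Cm => \sum_j x 0 j * conjc (x 0 j)).
  by apply/funext => y; rewrite nrm2E.
exact: (continuous_comp h (@Re_continuous R _)).
Qed.

Lemma compact_bounded_nrm2 K : closed K -> (exists M, forall x, K x -> nrm2 x <= M) -> compact K.
Proof.
move=> clK [M hM].
have M0 : 0 <= `|M| + 1 by rewrite addr_ge0.
pose B := [set v : Cm | forall i, [set z : C | `|Re z| <= `|M| + 1 /\ `|Im z| <= `|M| + 1] (v 0 i)].
have cB : compact B.
  by apply: (@rV_compact C m (fun=> [set z : C | `|Re z| <= `|M| + 1 /\ `|Im z| <= `|M| + 1])) => i; exact: compact_square.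
apply: (subclosed_compact clK cB) => x Kx i.
have h : nsq (x 0 i) <= `|M| by apply: (le_trans (coord_sq_le x i)); apply: (le_trans (hM x Kx)); exact: ler_norm.
have sq (a : R) : a ^+ 2 <= `|M| -> `|a| <= `|M| + 1.
  move=> ha; have := normr_ge0 M; move: ha; move: `|M| => b ha b0.
  by rewrite ler_norml; apply/andP; split; nra.
by split; apply: sq; apply: (le_trans _ h); [exact: cRe_sq_le|exact: cIm_sq_le].
Qed.

Lemma compact_sphere : compact [set v : Cm | nrm2 v = 1].
Proof.
apply: compact_bounded_nrm2; last by exists 1 => x /= ->.
rewrite (_ : [set v | _] = nrm2 @^-1` [set 1]); last by [].
by apply: closed_comp; [move=> z _; exact: nrm2_continuous|exact: closed_eq].
Qed.

Lemma rV_subr_continuous x : continuous (fun z : Cm => z - x).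
Proof.
move=> z; have h1 : z0 @[z0 --> z] --> z by exact: cvg_id.
have h2 : x @[_ --> z] --> x by exact: (@cst_continuous _ Cm x z).
exact: (cvgB h1 h2).
Qed.

(** Convexity with a real parameter, in place of weights taken in [R[i]]. *)
Definition segment_convex K := forall x y t, K x -> K y -> 0 <= t <= 1 ->
  K (x + t%:C *: (y - x)).

Lemma nearest_point K x : compact K -> segment_convex K -> K !=set0 ->
  exists2 c, K c & forall z, K z -> Re (hdot (z - c) (x - c)) <= 0.
Proof.
move=> cK cvK K0.
have [|c] := @compact_EVT_max _ _ (fun z => - nrm2 (z - x)) K K0 cK.
  apply: continuous_subspaceT => z.
  have cs : {for z, continuous (fun z : Cm => z - x)} by exact: rV_subr_continuous.
  exact: (cvgN (continuous_comp cs (@nrm2_continuous _))).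
rewrite inE => Kc hc; exists c => // z Kz.
rewrite leNgt; apply/negP => h0.
set a := Re _ in h0; pose b := nrm2 (z - c).
have key t : 0 <= t <= 1 -> 2 * a * t <= b * t ^+ 2.
  move=> t01; have := hc (c + t%:C *: (z - c)); rewrite inE => /(_ (cvK _ _ _ Kc Kz t01)).
  rewrite lerN2.
  have -> : c + t%:C *: (z - c) - x = t%:C *: (z - c) - (x - c) by rewrite opprB addrCA addrA.
  rewrite [nrm2 (_ - (x - c))]nrm2B nrm2Z nsq_real hdotZl cReM cRe_real cIm_real mul0r subr0.
  rewrite -/a -/b nrm2_sub; lra.
have b0 : 0 <= b := nrm2_ge0 _.
have ab : 0 < a + b by lra.
(* At t = a / (a + b), inequality [key] divided by t reads 2 (a + b) <= b, impossible for a > 0 and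
   b >= 0. *)
have t01 : 0 <= a / (a + b) <= 1.
  by rewrite divr_ge0 ?(ltW h0) ?(ltW ab)//= ler_pdivrMr// mul1r lerDl.
have := key _ t01.
rewrite expr_div_n => h.
have : 2 * a * (a / (a + b)) * (a + b) ^+ 2 <= b * (a ^+ 2 / (a + b) ^+ 2) * (a + b) ^+ 2.
  by rewrite ler_pM2r// exprn_gt0.
have e1 : 2 * a * (a / (a + b)) * (a + b) ^+ 2 = 2 * a ^+ 2 * (a + b) by field; rewrite gt_eqF.
have e2 : b * (a ^+ 2 / (a + b) ^+ 2) * (a + b) ^+ 2 = b * a ^+ 2 by field; rewrite gt_eqF.
rewrite e1 e2 => h'; have a2 : 0 < a ^+ 2 by rewrite exprn_gt0.
have : a ^+ 2 * (2 * a + b) <= 0 by lra.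
by rewrite pmulr_rle0//; lra.
Qed.

(** Were there no supporting vector, compactness of the unit sphere would give one k such that every
    unit [v] has a z in [K] with Re <z - q, v> > 1/(k+1). Take x outside [K] within 1/(k+1) of [q],
    with nearest point c: the unit vector along x - c contradicts this, by the splitting z - q = (z
    - c) - (x - c) + (x - q). *)
Lemma supporting_hyperplane K q : compact K -> segment_convex K -> K q ->
  (forall e, 0 < e -> exists2 x, ~ K x & nrm2 (x - q) <= e ^+ 2) ->
  exists2 v, v != 0 & forall z, K z -> Re (hdot (z - q) v) <= 0.
Proof.
move=> cK cvK Kq out; apply: contrapT => no.
pose P (k : nat) (v : Cm) := exists2 z, K z & k.+1%:R^-1 < Re (hdot (z - q) v).
have : \forall k \near \oo, [set v : Cm | nrm2 v = 1] `<=` P k.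
  apply: (proj1 (compact_near_coveringP _) compact_sphere nat \oo P _) => v /= v1.
  have [z Kz hz] : exists2 z, K z & 0 < Re (hdot (z - q) v).
    apply: contrapT => h; apply: no; exists v.
      by rewrite -nrm2_gt0 v1.
    by move=> z Kz; rewrite leNgt; apply/negP => h'; apply: h; exists z.
  have cv : {for v, continuous (fun v => Re (hdot (z - q) v))}.
    exact: (continuous_comp (@hdot_continuousr (z - q) v) (@Re_continuous R _)).
  have h2 : Re (hdot (z - q) v) / 2 < Re (hdot (z - q) v) by lra.
  have nv : \forall v' \near v, Re (hdot (z - q) v) / 2 < Re (hdot (z - q) v').
    exact: (cv _ (lt_nbhsr h2)).
  have nk : \forall k \near \oo, (k.+1%:R^-1 : R) < Re (hdot (z - q) v) / 2.
    have r0 : 0 < Re (hdot (z - q) v) / 2 by lra.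
    exact: (near_infty_natSinv_lt (PosNum r0)).
  near=> v' k.
  have l1 : (k.+1%:R^-1 : R) < Re (hdot (z - q) v) / 2 by near: k.
  have l2 : Re (hdot (z - q) v) / 2 < Re (hdot (z - q) v') by near: v'.
  by exists z => //; exact: lt_trans l1 l2.
move=> [k _ /(_ k (leqnn k)) hk].
have k0 : 0 < (k.+1%:R^-1 : R) by rewrite invr_gt0 ltr0n.
have [x Kx xq] := out _ k0.
have [c Kc hc] := @nearest_point K x cK cvK (ex_intro _ q Kq).
have xc : x - c != 0 by apply/eqP => /subr0_eq e; apply: Kx; rewrite e.
pose s := Num.sqrt (nrm2 (x - c)).
have s0 : 0 < s by rewrite sqrtr_gt0 nrm2_gt0.
have s2 : s ^+ 2 = nrm2 (x - c) by rewrite sqr_sqrtr ?nrm2_ge0.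
pose v := (s^-1)%:C *: (x - c).
have v1 : nrm2 v = 1.
  by rewrite /v nrm2Z nsq_real -s2 exprVn mulVf// expf_neq0// gt_eqF.
have [z Kz] := hk v v1; rewrite ltNge => /negP; apply.
have -> : z - q = (z - c) - (x - c) + (x - q) by apply/rowP => j; rewrite !mxE; ring.
rewrite hdotDl [hdot (_ - (x - c)) v]hdotBl cReD cReB.
have h1 : Re (hdot (z - c) v) <= 0.
  rewrite /v hdotZr cReM cRe_real cIm_real mul0r subr0.
  by rewrite pmulr_rle0 ?invr_gt0// hc.
have h2 : 0 <= Re (hdot (x - c) v).
  rewrite /v hdotZr cReM cRe_real cIm_real mul0r subr0 -nrm2E.
  by rewrite mulr_ge0 ?nrm2_ge0// invr_ge0 ltW.
have h3 := Re_hdot_le k0 v1 xq.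
move: h1 h2 h3; move: (Re _) (Re _) (Re _) (_^-1) => r1 r2 r3 r4; lra.
Unshelve. all: end_near. Qed.

End hermitian.

(** * Peak points of compact subsets of a plane *)

Section entire_functions.
Context {R : realType} {m : nat}.
Local Notation C := R[i].
Local Notation Cm := 'rV[C]_m.
Local Notation Re := (@complex.Re R).
Local Notation Im := (@complex.Im R).
Implicit Types (f g : Cm -> C).

Definition entire f := q_holomorphic 0 [set: Cm] f.

Lemma entire_continuous f : entire f -> continuous f.
Proof. by move=> /q_holomorphic0P [cf _] z; exact: (contDiff_continuous cf (I : setT z)). Qed.

Lemma entire_cst (c : C) : entire (fun=> c).
Proof.
apply/q_holomorphic0P; split; first exact: (@contDiff_cst _ _ 2 setT c openT).
by move=> z _ j; exact: d_dzbar_cst.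
Qed.

Lemma entireD f g : entire f -> entire g -> entire (fun z => f z + g z).
Proof.
move=> /q_holomorphic0P [cf hf] /q_holomorphic0P [cg hg]; apply/q_holomorphic0P.
split; first exact: (contDiffD openT cf cg).
move=> z _ j.
have e b : rderive (fun z => f z + g z) (cdir b j) z =
    rderive f (cdir b j) z + rderive g (cdir b j) z.
  by apply: rd_rderive; apply: rdD; [exact: (contDiff_rderivable b j cf (I : setT z))|
    exact: (contDiff_rderivable b j cg (I : setT z))].
have := hf z I j; have := hg z I j; rewrite /d_dzbar (e false) (e true) /cdir.
move: (rderive g _ _) (rderive g _ _) (rderive f _ _) (rderive f _ _) => a b c d h1 h2.
by rewrite -[RHS]addr0 -{1}h1 -h2; ring.
Qed.

Lemma entireM f g : entire f -> entire g -> entire (fun z => f z * g z).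
Proof.
move=> /q_holomorphic0P [cf hf] /q_holomorphic0P [cg hg]; apply/q_holomorphic0P.
split; first exact: (contDiffM openT cf cg).
move=> z _ j.
have e b : rderive (fun z => f z * g z) (cdir b j) z =
    rderive f (cdir b j) z * g z + f z * rderive g (cdir b j) z.
  by apply: rd_rderive; apply: rdM; [exact: (contDiff_rderivable b j cf (I : setT z))|
    exact: (contDiff_rderivable b j cg (I : setT z))].
have := hf z I j; have := hg z I j; rewrite /d_dzbar (e false) (e true) /cdir.
move: (rderive g _ _) (rderive g _ _) (rderive f _ _) (rderive f _ _) => a b c d h1 h2.
rewrite [RHS](_ : _ = f z * 0 + 0 * g z); last by rewrite mulr0 mul0r addr0.
by rewrite -{1}h1 -h2; ring.
Qed.

Lemma entireX f k : entire f -> entire (fun z => f z ^+ k).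
Proof.
move=> hf; elim: k => [|k IH].
  have -> : (fun z => f z ^+ 0) = (fun=> 1) by apply/funext => z; rewrite expr0.
  exact: entire_cst.
have -> : (fun z => f z ^+ k.+1) = (fun z => f z * f z ^+ k) by apply/funext => z; rewrite exprS.
exact: entireM.
Qed.

Lemma entire_affine f (l : Cm -> C) : continuous f ->
  (forall z v (c : C), f (z + c *: v) = f z + c * l v) -> entire f.
Proof.
move=> cf h; apply/q_holomorphic0P; split.
  exact: (@contDiff_affine R m 2 setT f l openT cf (fun z v t => h z v t%:C)).
move=> z _ j; have e v : rderive f v z = l v by apply: rd_rderive; apply: rd_affine => t; exact: h.
have li : l (y_dir j) = (0 +i* 1) * l (x_dir j).
  by have := h z (x_dir j) (0 +i* 1); have := h z (y_dir j) 1; rewrite scale1r => -> /addrI; rewrite mul1r.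
rewrite /d_dzbar !e li mulrA.
have -> : (0 +i* 1) * (0 +i* 1) = -1 :> C by apply: complexP; rewrite !cReImE; ring.
by rewrite mulN1r subrr mulr0.
Qed.

Lemma entire_hdot q v : entire (fun w => hdot (w - q) v).
Proof.
apply: (@entire_affine (fun w => hdot (w - q) v) (fun w => hdot w v)).
  move=> z; have c1 := @rV_subr_continuous R m q z.
  have c2 := @hdot_continuous R m v (z - q).
  exact: (continuous_comp c1 c2).
move=> z x c; rewrite -hdotZl -hdotDl; congr (hdot _ v).
by rewrite addrAC.
Qed.

(** 1 + v alone has modulus above 1 on the imaginary axis; the square replaces + y^2 by - y^2 to
    second order. With |v| <= 1/4, the two brackets in identity [e] are at least 1 and 1/2. *)
Lemma quadratic_peak (v : C) : Re v <= 0 -> nsq v <= 16^-1 ->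
  nsq (1 + v + v * v) <= 1 /\ (1 <= nsq (1 + v + v * v) -> v = 0).
Proof.
case: v => x y; rewrite /nsq !cReImE => x0 h.
have x1 : -1 <= 4 * x by have := sqr_ge0 y; nra.
have y1 : 16 * y ^+ 2 <= 1 by have := sqr_ge0 x; lra.
have e : (1 + x + (x * x - y * y)) ^+ 2 + (0 + y + (x * y + y * x)) ^+ 2 =
  1 + x * (2 + 3 * x + 2 * x ^+ 2 + x ^+ 3) - y ^+ 2 * (1 - 2 * x - 2 * x ^+ 2 - y ^+ 2).
  by ring.
rewrite e.
have h1 : 1 <= 2 + 3 * x + 2 * x ^+ 2 + x ^+ 3 by nra.
have h2 : 2^-1 <= 1 - 2 * x - 2 * x ^+ 2 - y ^+ 2 by nra.
have h3 : x * (2 + 3 * x + 2 * x ^+ 2 + x ^+ 3) <= x by nra.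
have h4 : y ^+ 2 * 2^-1 <= y ^+ 2 * (1 - 2 * x - 2 * x ^+ 2 - y ^+ 2).
  by rewrite ler_wpM2l// sqr_ge0.
have y0 := sqr_ge0 y.
split; first by lra.
move=> h5; have /eqP : y ^+ 2 = 0 by lra.
rewrite sqrf_eq0 => /eqP y00; have x00 : x = 0 by nra.
by rewrite x00 y00.
Qed.

(* Near 0 in the left half-plane, |1 + v + v^2| <= 1 with equality only at v = 0;
   take v a small multiple of l. *)
Lemma halfplane_peak (K : set Cm) (l : Cm -> C) : compact K -> entire l ->
  (forall w, K w -> Re (l w) <= 0) ->
  exists P, [/\ entire P, forall w, K w -> nsq (P w) <= 1,
    forall w, K w -> 1 <= nsq (P w) -> l w = 0 & forall w, l w = 0 -> P w = 1].
Proof.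
move=> cK el lK.
have [M M0 hM] : exists2 M : R, 0 <= M & forall w, K w -> nsq (l w) <= M.
  have [K0|/set0P/negP/negPn/eqP ->] := pselect (K !=set0); last by exists 0.
  have [|w] := @compact_EVT_max _ _ (fun w => nsq (l w)) K K0 cK.
    apply: continuous_subspaceT => z.
    exact: (continuous_comp (@entire_continuous _ el z) (@nsq_continuous R _)).
  rewrite inE => Kw hw; exists (nsq (l w)); first exact: nsq_ge0.
  by move=> z Kz; apply: hw; rewrite inE.
(* Chosen so that |e l|^2 <= e^2 M <= 1/16, since M <= (1 + M)^2. *)
pose e : R := (4 * (1 + M))^-1.
have e0 : 0 < e by rewrite invr_gt0; lra.
pose v w := e%:C * l w.
have Rv w : Re (v w) = e * Re (l w) by rewrite /v !cReImE; ring.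
have ev : entire v by exact: (entireM (entire_cst e%:C) el).
have vK w : K w -> Re (v w) <= 0 /\ nsq (v w) <= 16^-1.
  move=> Kw; rewrite Rv /v nsqM nsq_real pmulr_rle0// lK//; split => //.
  apply: (@le_trans _ _ (e ^+ 2 * M)); first by rewrite ler_wpM2l ?sqr_ge0// hM.
  rewrite /e exprVn mulrC ler_pdivrMr ?exprn_gt0//; last by lra.
  by nra.
exists (fun w => 1 + v w + v w * v w); split.
- exact: (entireD (entireD (entire_cst 1) ev) (entireM ev ev)).
- by move=> w /vK [h1 h2]; have [] := quadratic_peak h1 h2.
- move=> w /vK [h1 h2] h3; have [_ /(_ h3) h4] := quadratic_peak h1 h2.
  move/eqP: h4; rewrite /v mulf_eq0 => /orP[|/eqP//].
  by rewrite -nsq_eq0 nsq_real sqrf_eq0 (gt_eqF e0).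
- by move=> w h; rewrite /v h !mulr0 !addr0.
Qed.

End entire_functions.

Section peak_points.
Context {R : realType} {N m : nat}.
Local Notation C := R[i].
Local Notation Re := (@complex.Re R).
Variables (A : 'M[C]_(m, N)) (B : 'M[C]_(N, m)).
Hypothesis AB : A *m B = 1%:M.
Variables (p : 'rV[C]_N) (K : set 'rV[C]_N).
Hypothesis compactK : compact K.
Local Notation boundary := (closed_boundary K (holomorphic_on_plane A p K)).

Lemma entire_on_plane (f : 'rV[C]_m -> C) : entire f ->
  holomorphic_on_plane A p K (f \o proj_mx_at p B).
Proof.
move=> ef; split.
  apply: continuous_subspaceT => z.
  exact: (continuous_comp (@proj_mx_at_continuous _ _ _ p B z) (@entire_continuous _ _ _ ef _)).
exists setT, f; split=> //; first exact: openT.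
by move=> w _; rewrite /= (W_param AB).
Qed.

(** A two-stage peak. The functions P1^k P2 attain their maxima on [S]; in the limit a point of [S]
    has |P1| = 1 and |P2| at least its value at [w0], and [w0] is the only such point. *)
Lemma peak_point (S : set 'rV[C]_N) (P1 P2 : 'rV[C]_m -> C) w0 :
  boundary S -> K `<=` affine_plane A p -> entire P1 -> entire P2 ->
  K (plane_param A p w0) -> nsq (P1 w0) = 1 -> 0 < nsq (P2 w0) ->
  (forall w, K (plane_param A p w) -> nsq (P1 w) <= 1) ->
  (forall w, K (plane_param A p w) -> nsq (P1 w) = 1 -> nsq (P2 w0) <= nsq (P2 w) -> w = w0) ->
  S (plane_param A p w0).
Proof.
move=> [clS SK hS] KA e1 e2 Kw0 P11 P20 P1le peak.
have cS : compact S by exact: (subclosed_compact clS compactK SK).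
pose phi z := nsq (P1 (proj_mx_at p B z)).
pose G z := nsq (P2 (proj_mx_at p B z)).
have cont f z : entire f -> {for z, continuous (fun z => nsq (f (proj_mx_at p B z)))}.
  move=> ef; have c1 := continuous_comp (@proj_mx_at_continuous _ _ _ p B z) (@entire_continuous _ _ _ ef _).
  exact: (continuous_comp c1 (@nsq_continuous R _)).
have [z [Sz phiz Gz]] : exists z, [/\ S z, phi z = 1 & nsq (P2 w0) <= G z].
  apply: (peak_limit cS P20) => [x Sx|x Sx|x Sx|x Sx|k].
  - exact: cont.
  - exact: cont.
  - rewrite nsq_ge0 /=; have [w _ ew] := KA x (SK x Sx).
    by rewrite /phi -ew (W_param AB); apply: P1le; rewrite ew; exact: SK.
  - exact: nsq_ge0.
  have := hS _ (entire_on_plane (entireM (entireX k e1) e2)) => -[z Sz hz].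
  exists z => //; have := hz _ Kw0; rewrite ler_norm_nsq /= !nsqM !nsqX (W_param AB).
  by rewrite P11 expr1n mul1r.
have [w _ ew] := KA z (SK z Sz).
move: phiz Gz; rewrite /phi /G -ew (W_param AB) => h1 h2.
have <- : w = w0 by apply: peak => //; rewrite ew; exact: SK.
by rewrite ew.
Qed.

(** The point of [K] farthest from the origin in plane coordinates is a peak point: the supporting
    half-space of the ball through it touches the ball there only. Nonemptiness later excludes
    negative exponents. *)
Lemma shilov_boundary_nonempty : K `<=` affine_plane A p -> K !=set0 ->
  shilov_boundary K (holomorphic_on_plane A p K) !=set0.
Proof.
move=> KA K0.
have cKw z : {for z, continuous (fun z => nrm2 (proj_mx_at p B z))}.
  exact: (continuous_comp (@proj_mx_at_continuous _ _ _ p B z) (@nrm2_continuous _ _ _)).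
have [|z0] := @compact_EVT_max _ _ (fun z => nrm2 (proj_mx_at p B z)) K K0 compactK.
  exact: continuous_subspaceT.
rewrite inE => Kz0 hz0; have [w0 _ ew0] := KA z0 Kz0.
pose K' := [set w : 'rV[C]_m | nrm2 w <= nrm2 w0].
have KK' w : K (plane_param A p w) -> K' w.
  by move=> Kw; have := hz0 _ (mem_set Kw); rewrite -ew0 !(W_param AB).
have cK' : compact K'.
  apply: compact_bounded_nrm2; last by exists (nrm2 w0).
  by apply: (@closed_comp _ _ nrm2 [set x | x <= nrm2 w0]); [move=> z _; exact: nrm2_continuous|exact: closed_le].
have [|P [eP P1 Pl lP]] := halfplane_peak cK' (@entire_hdot _ _ w0 w0).
  move=> w hw; have := nrm2_ge0 (w - w0); rewrite nrm2B hdotBl cReB -nrm2E.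
  by move: hw; rewrite /K' /=; lra.
have l0 : hdot (w0 - w0) w0 = 0 by rewrite subrr -(scale0r w0) hdotZl mul0r.
exists z0; split=> // S bS; rewrite -ew0.
have n1 : nsq (P w0) = 1 by rewrite lP// nsq1.
have n2 : 0 < nsq (1 : C) by rewrite nsq1.
have Kw0 : K (plane_param A p w0) by rewrite ew0.
apply: (@peak_point S P (fun=> 1) w0 bS KA eP (entire_cst 1) Kw0 n1 n2).
  by move=> w /KK' /P1.
move=> w Kw hw _; have := Pl w (KK' _ Kw); rewrite hw => /(_ (lexx _)) h.
apply/eqP; rewrite -subr_eq0 -nrm2_eq0 eq_le nrm2_ge0 andbT nrm2B.
have : Re (hdot (w - w0) w0) = 0 by rewrite h.
rewrite hdotBl cReB -nrm2E; have := KK' _ Kw; rewrite /K' /=; lra.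
Qed.

End peak_points.

(** * Convex sets and their closures *)

Section convexity.
Context {R : realType} {N : nat}.
Local Notation C := R[i].
Local Notation CN := 'rV[C]_N.
Implicit Types (D K : set CN) (x y z : CN) (t : R).

Lemma convex_set_segment D : convex_set D -> segment_convex D.
Proof.
move=> cD x y t Dx Dy /andP[t0 t1].
have t0' : 0 <= t%:C :> C by rewrite ler0c.
have t1' : t%:C <= 1 :> C by rewrite -[1]/((1 : R)%:C) lecR.
have := cD y x (Itv01 t0' t1') (mem_set Dy) (mem_set Dx); rewrite inE.
rewrite [conv _ _ _](_ : _ = x + t%:C *: (y - x))//.
rewrite [LHS](_ : _ = t%:C *: y + (1 - t%:C) *: x)//.
by apply/rowP => j; rewrite !mxE; ring.
Qed.

(** [g y'] is the point from which the segment to [y'] passes through w = z + t(y - z) at time [t].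
    As [g y = z] lies in the open set [D], some [y'] in [D] close to [y] has [g y'] in [D] too, and
    w lies between them. *)
Lemma closure_segment D z y t : segment_convex D -> open D -> D z -> closure D y ->
  0 <= t < 1 -> D (z + t%:C *: (y - z)).
Proof.
move=> cvD oD Dz cDy /andP[t0 t1].
pose b := (1 - t)^-1.
have t10 : 1 - t != 0 by rewrite gt_eqF// subr_gt0.
pose w := z + t%:C *: (y - z).
pose g (y' : CN) : CN := b%:C *: w + (- (b * t))%:C *: y'.
have gy : g y = z.
  apply/rowP => j; rewrite /g /w !mxE; apply: complexP; rewrite !cReImE /b; field => //.
have cg : g y' @[y' --> y] --> g y.
  have f0 : b%:C *: w @[y' --> y] --> b%:C *: w by exact: (@cst_continuous _ CN (b%:C *: w) y).
  have f1 : y' @[y' --> y] --> y by exact: cvg_id.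
  have h := cvgD f0 (cvgZl_tmp (k := (- (b * t))%:C) f1); exact: h.
have nD : nbhs y (g @^-1` D) by apply: cg; rewrite gy; exact: open_nbhs_nbhs.
have [y' [Dy' Dgy']] := cDy _ nD.
have -> : z + t%:C *: (y - z) = g y' + t%:C *: (y' - g y').
  apply/rowP => j; rewrite /g /w !mxE; apply: complexP; rewrite !cReImE /b; field => //.
by apply: cvD => //; rewrite t0 ltW.
Qed.

Lemma closure_convex D : segment_convex D -> segment_convex (closure D).
Proof.
move=> cvD x y t cx cy t01 V nV.
have c2 : p.1 + t%:C *: (p.2 - p.1) @[p --> (x, y)] --> x + t%:C *: (y - x).
  have f1 : p.1 @[p --> (x, y)] --> x by exact: cvg_fst.
  have f2 : p.2 @[p --> (x, y)] --> y by exact: cvg_snd.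
  exact: (cvgD f1 (cvgZl_tmp (k := t%:C) (cvgB f2 f1))).
have [[V1 V2] [nV1 nV2] sV] := c2 V nV.
have [x' [Dx' Vx']] := cx _ nV1; have [y' [Dy' Vy']] := cy _ nV2.
exists (x' + t%:C *: (y' - x')); split; first exact: cvD.
exact: (sV (x', y') (conj Vx' Vy')).
Qed.

End convexity.

(** * Leaves through boundary points *)

Section leaf.
Context {R : realType} {N : nat}.
Local Notation C := R[i].
Local Notation C2 := 'rV[C]_2.
Local Notation Re := (@complex.Re R).
Local Notation Im := (@complex.Im R).

Lemma plane_param_continuous (m n : nat) (A : 'M[C]_(m, n)) (p : 'rV[C]_n) :
  continuous (plane_param A p).
Proof.
move=> z; have -> : plane_param A p = (fun w => p + proj_mx_at 0 A w).
  by apply/funext => w; rewrite /plane_param /proj_mx_at subr0.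
have h1 : p @[_ --> z] --> p by exact: (@cst_continuous _ 'rV[C]_n p z).
exact: (cvgD h1 (@proj_mx_at_continuous _ _ _ 0 A z)).
Qed.

Lemma sum_ord2 (V : nmodType) (F : 'I_2 -> V) : \sum_j F j = F 0 + F 1.
Proof.
rewrite big_ord_recl big_ord1; congr (_ + F _); exact: val_inj.
Qed.

Definition perp (v : C2) : C2 := \row_j (if j == 0 then - conjc (v 0 1) else conjc (v 0 0)).

Lemma hdot_perp v : hdot (perp v) v = 0.
Proof. by rewrite /hdot sum_ord2 !mxE /=; ring. Qed.

Lemma nrm2_perp v : nrm2 (perp v) = nrm2 v.
Proof. by rewrite /nrm2 !sum_ord2 !mxE /= nsqN !nsq_conj addrC. Qed.

Lemma nsqE (c : C) : (nsq c)%:C = c * conjc c.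
Proof. by apply: complexP; rewrite /nsq !cReImE; ring. Qed.

Lemma perp_span v x : v != 0 -> hdot x v = 0 -> exists s : C, x = s *: perp v.
Proof.
rewrite -nrm2_eq0 => n0 xv.
have n0' : (nrm2 v)%:C != 0 by apply: contra n0 => /eqP [->].
exists (hdot x (perp v) / (nrm2 v)%:C).
have e : x 0 0 * conjc (v 0 0) + x 0 1 * conjc (v 0 1) = 0 by move: xv; rewrite /hdot sum_ord2.
have en : (nrm2 v)%:C = v 0 0 * conjc (v 0 0) + v 0 1 * conjc (v 0 1).
  by rewrite /nrm2 sum_ord2 rmorphD /= !nsqE.
have ed : hdot x (perp v) = - x 0 0 * v 0 1 + x 0 1 * v 0 0.
  rewrite /hdot sum_ord2 !mxE /=; congr (_ + _); last by case: (v 0 0) => a b; rewrite /conjc opprK.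
  by case: (v 0 1) => a b; apply: complexP; rewrite !cReImE; ring.
apply/rowP => j; rewrite !mxE ed mulrAC; apply/eqP; rewrite eq_sym.
rewrite -(inj_eq (mulIf n0')) mulfVK// en.
have [->|] := eqVneq j 0.
  rewrite -subr_eq0; apply/eqP.
  transitivity (- v 0 0 * (conjc (v 0 1) * x 0 1 + conjc (v 0 0) * x 0 0)); first by ring.
  by rewrite [X in _ * X](_ : _ = 0) ?mulr0// -e; ring.
move=> j0; have -> : j = 1.
  by apply/eqP; move: j j0 => [[|[|]]].
rewrite -subr_eq0; apply/eqP.
transitivity (- v 0 1 * (x 0 0 * conjc (v 0 0) + x 0 1 * conjc (v 0 1))); first by ring.
by rewrite e mulr0.
Qed.

Section leaf_boundary.
Variables (A : 'M[C]_(2, N)) (B : 'M[C]_(N, 2)).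
Hypothesis AB : A *m B = 1%:M.
Variables (p : 'rV[C]_N) (K : set 'rV[C]_N).
Hypothesis compactK : compact K.
Hypothesis KA : K `<=` affine_plane A p.
Variables (K' D' : set C2).
Hypothesis K'E : forall w, K' w <-> K (plane_param A p w).
Hypothesis compactK' : compact K'.
Hypothesis closedK' : closed K'.
Hypothesis convexK' : segment_convex K'.
Hypothesis openD' : open D'.
Hypothesis D'K' : D' `<=` K'.
Hypothesis D'0 : D' !=set0.
Hypothesis D'K'_segment : forall z y (t : R), D' z -> K' y -> 0 <= t < 1 -> D' (z + t%:C *: (y - z)).
Variable p' : C2.
Hypothesis K'p' : K' p'.
Hypothesis D'p' : ~ D' p'.

Lemma bounded_K' (x : C2) : exists2 M : R, 0 <= M & forall y, K' y -> nrm2 (y - x) <= M.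
Proof.
have [|w] := @compact_EVT_max _ _ (fun w : C2 => nrm2 (w - x)) K' (ex_intro _ p' K'p') compactK'.
  apply: continuous_subspaceT => z.
  have c1 : {for z, continuous (fun z : C2 => z - x)} by exact: rV_subr_continuous.
  exact: (continuous_comp c1 (@nrm2_continuous _ _ _)).
rewrite inE => Kw hw; exists (nrm2 (w - x)); first exact: nrm2_ge0.
by move=> y Ky; apply: hw; rewrite inE.
Qed.

(** Pushing [p'] slightly away from an interior point leaves [K']: otherwise [p'] would be strictly
    inside a segment from that point to [K'], hence in [D']. So [p'] is a limit of exterior
    points. *)
Lemma boundary_support : exists2 v, v != 0 & forall z, K' z -> Re (hdot (z - p') v) <= 0.
Proof.
apply: (supporting_hyperplane compactK' convexK' K'p') => e e0.
have [z0 Dz0] := D'0.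
pose c := nrm2 (p' - z0); have c0 : 0 <= c := nrm2_ge0 _.
pose t := e / (1 + c).
have t0 : 0 < t by rewrite divr_gt0//; lra.
exists (p' + t%:C *: (p' - z0)); last first.
  rewrite addrAC subrr add0r nrm2Z nsq_real -/c /t expr_div_n mulrAC ler_pdivrMr ?exprn_gt0//; last by lra.
  by rewrite ler_wpM2l ?sqr_ge0//; nra.
move=> Kq; apply: D'p'.
have := D'K'_segment (t := (1 + t)^-1) Dz0 Kq.
have t1 : 1 + t != 0 by rewrite gt_eqF//; lra.
have -> : z0 + ((1 + t)^-1)%:C *: (p' + t%:C *: (p' - z0) - z0) = p'.
  by apply/rowP => j; rewrite !mxE; apply: complexP; rewrite !cReImE; field.
by apply; rewrite invr_ge0 invf_lt1; lra.
Qed.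

Lemma last_point (d : C2) (u : C) : d != 0 -> u != 0 ->
  exists r : R, [/\ 0 <= r, K' (p' + (r%:C * u) *: d) &
    forall r' : R, r < r' -> ~ K' (p' + (r'%:C * u) *: d)].
Proof.
move=> d0 u0; have [M M0 hM] := bounded_K' p'.
pose c := nsq u * nrm2 d.
have c0 : 0 < c by rewrite mulr_gt0 ?nrm2_gt0// lt_neqAle nsq_ge0 eq_sym nsq_eq0 u0.
pose Rm := M / c + 1.
have bound (r : R) : 0 <= r -> K' (p' + (r%:C * u) *: d) -> r <= Rm.
  move=> r0 /hM; rewrite addrAC subrr add0r nrm2Z nsqM nsq_real -mulrA -/c.
  rewrite -ler_pdivlMr// /Rm; move: (M / c) => a ha; nra.
pose K1 : set R := `[0, Rm]%classic `&` [set r | K' (p' + r%:C *: (u *: d))].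
have cK1 : compact K1.
  apply: (subclosed_compact _ (@segment_compact R 0 Rm)) => [|r []//].
  apply: closedI; first exact: itv_closed.
  apply: (@closed_comp _ _ (fun r : R => p' + r%:C *: (u *: d)) K') => // r _.
  exact: along_cvg.
have K10 : K1 !=set0.
  exists 0; split; first by rewrite /= in_itv /= lexx /Rm addr_ge0// divr_ge0// ltW.
  by rewrite /= scale0r addr0.
have [|r] := @compact_EVT_max _ _ (@id R) K1 K10 cK1.
  by apply: continuous_subspaceT => r; exact: cvg_id.
rewrite inE => -[/=]; rewrite in_itv /= => /andP[r0 rm] Kr hr.
exists r; split=> //; first by rewrite -scalerA.
move=> r' rr' Kr'; have r'0 : 0 <= r' by rewrite (le_trans r0)// ltW.
have /hr : r' \in K1.
  rewrite inE; split; last by rewrite /= scalerA.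
  by rewrite /= in_itv /= r'0 bound.
by rewrite leNgt rr'.
Qed.

(* The leaf is the complex line orthogonal to a supporting vector v. The boundary
   point is reached by a peak function of the supporting half-space followed by a
   peak function, inside the leaf, at the last point of the ray. *)
Lemma leaf_boundary : exists2 d : C2, d != 0 & (forall s : C, ~ D' (p' + s *: d)) /\
  forall u : C, u != 0 -> exists2 r : R, 0 <= r &
    forall S, closed_boundary K (holomorphic_on_plane A p K) S ->
      S (plane_param A p (p' + (r%:C * u) *: d)).
Proof.
have [v v0 hv] := boundary_support.
pose d := perp v.
have d0 : d != 0 by rewrite -nrm2_eq0 nrm2_perp nrm2_eq0.
exists d => //; split=> [s Ds|u u0].
  (* A leaf point in the open set [D'] could be moved a little along [v], across the supporting
     hyperplane. *)
  have n0 : nbhs (p' + s *: d) D' by exact: open_nbhs_nbhs.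
  have := @along_cvg R 2 (p' + s *: d) v 0; rewrite along0 => /(_ _ n0).
  move=> /nbhs_ballP [e /= e0 he].
  have h2 : D' (p' + s *: d + (e / 2)%:C *: v).
    by apply: he; rewrite /ball /= sub0r normrN gtr0_norm ?divr_gt0//; lra.
  have := hv _ (D'K' h2).
  rewrite (_ : _ - p' = s *: d + (e / 2)%:C *: v); last by apply/rowP => j; rewrite !mxE; ring.
  rewrite hdotDl !hdotZl hdot_perp mulr0 add0r cReM cRe_real cIm_real mul0r subr0 -nrm2E.
  by rewrite pmulr_rle0 ?divr_gt0// leNgt nrm2_gt0 v0.
have [r [r0 Kq hr]] := last_point d0 u0.
exists r => // S bS.
pose q := p' + (r%:C * u) *: d.
(* The trace of [K'] on the leaf, a convex subset of C. The parameter [sq] of the last point is a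
   limit of exterior ones, so [Delta] has a supporting half-plane there. *)
pose Delta := plane_param d p' @^-1` K'.
have plane_d (s : 'rV[C]_1) : plane_param d p' s = p' + s 0 0 *: d.
  rewrite /plane_param; congr (_ + _); apply/rowP => j; rewrite !mxE big_ord1.
  by rewrite !mxE.
have [M M0 hM] := bounded_K' p'.
have cDelta : compact Delta.
  apply: compact_bounded_nrm2.
    by apply: closed_comp => // z _; exact: plane_param_continuous.
  exists (M / nrm2 d) => s; rewrite /Delta /= plane_d => /hM.
  rewrite addrAC subrr add0r nrm2Z ler_pdivlMr ?nrm2_gt0//.
  by rewrite /nrm2 big_ord1.
have cvDelta : segment_convex Delta.
  move=> x y t hx hy t01; rewrite /Delta /=.
  have := convexK' hx hy t01; rewrite !plane_d !mxE.
  rewrite (_ : _ + t%:C *: _ = p' + (x 0 0 + t%:C * (y 0 0 - x 0 0)) *: d)//.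
  by apply/rowP => j; rewrite !mxE; ring.
pose sq : 'rV[C]_1 := const_mx (r%:C * u).
have Dsq : Delta sq by rewrite /Delta /= plane_d mxE.
have [v1 v10 hv1] : exists2 v1 : 'rV[C]_1, v1 != 0 & forall s, Delta s -> Re (hdot (s - sq) v1) <= 0.
  apply: (supporting_hyperplane cDelta cvDelta Dsq) => e e0.
  pose t := e / (1 + nsq u).
  have nu := nsq_ge0 u.
  have t0 : 0 < t by rewrite divr_gt0//; lra.
  exists (const_mx ((r + t)%:C * u)).
    by rewrite /Delta /= plane_d mxE; apply: hr; rewrite ltrDl.
  rewrite /nrm2 big_ord1 !mxE.
  have -> : (r + t)%:C * u - r%:C * u = t%:C * u by apply: complexP; rewrite !cReImE; ring.
  rewrite nsqM nsq_real /t expr_div_n mulrAC ler_pdivrMr ?exprn_gt0//; last by lra.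
  by rewrite ler_wpM2l ?sqr_ge0//; nra.
pose c := conjc (v1 0 0).
have c0 : c != 0.
  rewrite -nsq_eq0 nsq_conj; apply: contra v10 => /eqP h.
  by rewrite -nrm2_eq0 /nrm2 big_ord1 h.
pose l1 w := hdot (w - p') v.
(* An affine function on C^2 that restricts on the leaf to a positive multiple of (s - r u) c, whose
   real part is nonpositive on [Delta]. *)
pose l2 w := hdot (w - q) d * c.
have el1 : entire l1 by exact: entire_hdot.
have el2 : entire l2 by exact: (entireM (entire_hdot q d) (entire_cst c)).
have [P1 [eP1 P1le P1l P1v]] := halfplane_peak compactK' el1 hv.
pose K2 := K' `&` [set w | l1 w = 0].
have cK2 : compact K2.
  apply: (subclosed_compact _ compactK') => [|z []//].
  apply: closedI => //.
  have -> : [set w | l1 w = 0] = (fun w => nsq (l1 w)) @^-1` [set 0].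
    by apply/seteqP; split=> w /=; [move=> ->; exact: nsq0|move=> /eqP; rewrite nsq_eq0 => /eqP].
  apply: closed_comp; last exact: closed_eq.
  by move=> w _; exact: (continuous_comp (@entire_continuous _ _ _ el1 w) (@nsq_continuous R _)).
have K2line w : K2 w -> exists2 s : C, w = p' + s *: d & Delta (const_mx s).
  move=> [Kw /= h]; have [s es] := perp_span v0 h.
  have e : w = p' + s *: d by rewrite -/d in es; rewrite -es addrC subrK.
  by exists s => //; rewrite /Delta /= plane_d mxE -e.
have l2line s : l2 (p' + s *: d) = (nrm2 d)%:C * ((s - r%:C * u) * c).
  rewrite /l2 (_ : _ - q = (s - r%:C * u) *: d).
    by rewrite hdotZl hdot_self; ring.
  by rewrite /q; apply/rowP => j; rewrite !mxE; ring.
have l2K2 w : K2 w -> Re (l2 w) <= 0.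
  move=> /K2line [s -> Ds]; rewrite l2line cReM cRe_real cIm_real mul0r subr0.
  rewrite pmulr_rle0 ?nrm2_gt0//; have := hv1 _ Ds.
  by rewrite /hdot big_ord1 !mxE.
have [P2 [eP2 P2le P2l P2v]] := halfplane_peak cK2 el2 l2K2.
have l2q : l2 q = 0 by rewrite l2line subrr mul0r mulr0.
have l1q : l1 q = 0 by rewrite /l1 /q addrAC subrr add0r hdotZl hdot_perp mulr0.
have P1q : nsq (P1 q) = 1 by rewrite P1v// nsq1.
have P2q : 0 < nsq (P2 q) by rewrite P2v// nsq1.
have Kqp : K (plane_param A p q) by apply/K'E.
apply: (@peak_point _ _ _ _ _ AB p K compactK S P1 P2 q bS KA eP1 eP2 Kqp P1q P2q).
  by move=> w /K'E /P1le.
move=> w /K'E Kw h1 h2.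
have l1w : l1 w = 0 by apply: P1l; rewrite ?h1.
have K2w : K2 w by [].
have : l2 w = 0 by apply: P2l => //; move: h2; rewrite P2v// nsq1.
have [s -> _] := K2line w K2w; rewrite l2line => /eqP; rewrite mulf_eq0 => /orP[|].
  by move=> /eqP [/eqP]; rewrite nrm2_eq0 (negbTE d0).
by rewrite mulf_eq0 (negbTE c0) orbF subr_eq0 => /eqP ->.
Qed.

End leaf_boundary.
End leaf.

(** * An energy estimate *)

Section energy.
Context {R : realType}.

(** Young's inequality for y^a and 1, with exponents 1/a and 1/(1-a). *)
Lemma powR_bernoulli (a y : R) : 0 < a < 1 -> 0 <= y -> y `^ a <= 1 - a + a * y.
Proof.
move=> /andP[a0 a1] y0.
have := @conjugate_powR R (y `^ a) 1 a^-1 (1 - a)^-1 (powR_ge0 _ _) ler01.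
rewrite !invrK addrCA subrr addr0 !invr_gt0 subr_gt0 a0 a1 mulr1 => /(_ isT isT erefl).
by rewrite -powRrM divff ?gt_eqF// powRr1// powR1 mul1r addrC mulrC.
Qed.

Variable sigma : R.
Hypothesis sigma01 : 0 < sigma < 1.
Let a := 1 - sigma.
Let s0 : 0 < sigma. Proof. by case/andP: sigma01. Qed.
Let a0 : 0 < a. Proof. by rewrite subr_gt0; case/andP: sigma01. Qed.
Let a01 : 0 < a < 1. Proof. by rewrite a0 ltrBlDr ltrDl s0. Qed.

(** Discrete form of the integral of x^(-sigma): Bernoulli at y = M/(M+1) gives a (M+1)^(-sigma) <=
    (M+1)^a - M^a, and this telescopes. *)
Lemma sum_powRN (M : nat) :
  \sum_(1 <= k < M.+1) k%:R `^ (- sigma) <= M%:R `^ a / a.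
Proof.
elim: M => [|M IH]; first by rewrite big_geq// divr_ge0 ?powR_ge0// ltW.
rewrite big_nat_recr//= (le_trans (lerD IH (lexx _)))// -lerBrDl -mulrBl ler_pdivlMr//.
have x0 : 0 < M.+1%:R :> R by rewrite ltr0n.
set x := M.+1%:R in x0 *.
have y0 : 0 <= M%:R / x by rewrite divr_ge0// ltW.
have := powR_bernoulli a01 y0.
have xi0 : 0 <= x^-1 by rewrite invr_ge0 ltW.
rewrite (powRM a (ler0n R M) xi0) -[in X in _ * X](powR_inv1 (ltW x0)) -powRrM mulN1r => h.
have xa : 0 < x `^ a by rewrite powR_gt0.
have h2 : x `^ a * (M%:R `^ a * x `^ (- a)) <= x `^ a * (1 - a + a * (M%:R / x)).
  by rewrite ler_pM2l.
rewrite mulrCA powRN divff ?gt_eqF// mulr1 in h2.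
have -> : x `^ (- sigma) = x `^ a * x^-1.
  rewrite -[in RHS](powR_inv1 (ltW x0)) -powRD; last by rewrite (gt_eqF x0) implybT.
  by congr (_ `^ _); rewrite /a; ring.
have e : M%:R = x - 1 by rewrite /x -natr1 addrK.
have e2 : 1 - a + a * (M%:R / x) = 1 - a / x by rewrite e; field; rewrite gt_eqF.
rewrite e2 in h2; move: h2; rewrite mulrBr mulr1 => h2.
have -> : x `^ a * x^-1 * a = x `^ a * (a / x) by ring.
by rewrite lerBrDr addrC -lerBrDr.
Qed.

(* The diagonal value is set to 0 so that sums may run over all indices. *)
Definition weight (n k : nat) : R := if k == 0%N then 0 else (k%:R / n%:R) `^ (- sigma).

Lemma weight_ge0 n k : 0 <= weight n k.
Proof. by rewrite /weight; case: ifP => // _; exact: powR_ge0. Qed.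

(** Linear in n because sigma + a = 1: the sum is at most n^sigma (4n)^a / a = (4^a / a) n, and 4^a
    <= 4. *)
Lemma sum_weight (n : nat) : (0 < n)%N ->
  \sum_(k < (4 * n).+1) weight n k <= 4 / a * n%:R.
Proof.
move=> n0; have n0R : 0 < n%:R :> R by rewrite ltr0n.
rewrite -(big_mkord xpredT (weight n)) big_ltn// /weight eqxx add0r.
have e k : (1 <= k < (4 * n).+1)%N ->
    (if k == 0%N then 0 else (k%:R / n%:R) `^ (- sigma)) = n%:R `^ sigma * k%:R `^ (- sigma) :> R.
  move=> /andP[k0 _]; rewrite ifN ?gtn_eqF//.
  rewrite powRM ?invr_ge0 ?ler0n// mulrC -(powR_inv1 (ltW n0R)) -powRrM mulrNN mul1r//.
rewrite big_nat (eq_bigr _ e) -big_nat -mulr_sumr.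
apply: (le_trans (ler_wpM2l (powR_ge0 _ _) (sum_powRN _))).
rewrite natrM powRM// !mulrA.
rewrite (_ : n%:R `^ sigma * 4 `^ a * n%:R `^ a / a = 4 `^ a / a * (n%:R `^ sigma * n%:R `^ a)); last by ring.
rewrite -powRD; last by rewrite (gt_eqF n0R) implybT.
have e1 : sigma + a = 1 by rewrite /a; ring.
rewrite e1 (powRr1 (ltW n0R)).
rewrite ler_pM2r// ler_pM2r ?invr_gt0//.
rewrite -[leRHS]powRr1//; apply: ler_powR; first by rewrite ler1n.
by rewrite ltW//; case/andP: a01.
Qed.

(** Each distance k is attained at most twice, at [mu + k] and [mu - k], which doubles the constant
    of [sum_weight]. *)
Lemma sum_weight_dist (n : nat) (mu : int) : (0 < n)%N ->
  (forall j : 'I_n, `|j%:Z - mu|%N <= 4 * n)%N ->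
  \sum_(j < n) weight n `|j%:Z - mu|%N <= 8 / a * n%:R.
Proof.
move=> n0 hmu.
pose I (x : int) (j : 'I_n) : R := (j%:Z == x)%:R.
have I1 x : \sum_j I x j <= 1.
  have [[j0 h]|no] := pselect (exists j0 : 'I_n, j0%:Z = x).
    rewrite (bigD1 j0)//= big1; first by rewrite /I h eqxx addr0.
    move=> j jj0; rewrite /I -h eqz_nat; case: eqP => // /val_inj e.
    by rewrite e eqxx in jj0.
  rewrite big1// => j _; rewrite /I; case: eqP => // h; by case: no; exists j.
apply: (@le_trans _ _ (\sum_(j < n) \sum_(k < (4 * n).+1)
    weight n k * (I (mu + k%:Z) j + I (mu - k%:Z) j))).
  apply: ler_sum => j _; have kj : (`|j%:Z - mu| < (4 * n).+1)%N by rewrite ltnS.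
  rewrite (bigD1 (Ordinal kj))//= -[leLHS]addr0 lerD//.
    rewrite ler_peMr ?weight_ge0// /I.
    have [h|h] := lerP 0 (j%:Z - mu).
      by rewrite gez0_abs// [mu + _]addrC subrK eqxx lerDl.
    have -> : mu - `|j%:Z - mu|%N%:Z = j%:Z by rewrite lez0_abs ?ltW//; lia.
    by rewrite eqxx lerDr.
  by apply: sumr_ge0 => k _; rewrite mulr_ge0 ?weight_ge0// addr_ge0.
rewrite exchange_big /=.
apply: (@le_trans _ _ (\sum_(k < (4 * n).+1) weight n k * 2)).
  apply: ler_sum => k _; rewrite -mulr_sumr ler_wpM2l ?weight_ge0// big_split /=.
  by rewrite -[2]/(1 + 1 : R) lerD.
rewrite -mulr_suml (_ : 8 / a * n%:R = 4 / a * n%:R * 2); last by ring.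
by rewrite ler_pM2r//; exact: sum_weight.
Qed.

Lemma ord_dist_le n (i j : 'I_n) : (`|i%:Z - j%:Z| <= 4 * n)%N.
Proof. by have := ltn_ord i; have := ltn_ord j; lia. Qed.

(* Quadratic counting: n^2 = sum of the class sizes N_k, and
   N_k <= t b_k + N_k^2 / (4 t b_k), where N_k^2 counts pairs in the class k. *)
Lemma energy_bound (n K : nat) (f : 'I_n -> 'I_n -> 'I_K) (b : 'I_K -> R)
    (mu : 'I_n -> 'I_n -> int) (eps C0 bmin : R) :
  (0 < n)%N -> 0 < bmin -> (forall k, bmin <= b k) -> \sum_k b k <= eps -> 0 < C0 ->
  (forall i i' (j : 'I_n), `|j%:Z - mu i i'|%N <= 4 * n)%N ->
  (forall i i' j j', f i j = f i' j' -> i != i' -> j != j' -> j%:Z != mu i i' ->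
    1 <= b (f i j) * (C0 * (weight n `|i%:Z - i'%:Z|%N * weight n `|j%:Z - mu i i'|%N *
                            weight n `|j%:Z - j'%:Z|%N))) ->
  let Q := C0 * (8 / a) ^+ 3 in
  Q * eps <= 4^-1 -> n%:R <= 3 / (2 * Q * bmin).
Proof.
move=> n0 bm0 hb sb C00 hmu hf Q Qe.
have nR : 0 < n%:R :> R by rewrite ltr0n.
have Q0 : 0 < Q by rewrite /Q mulr_gt0// exprn_gt0// divr_gt0.
have b0 k : 0 < b k := lt_le_trans bm0 (hb k).
pose w := weight n.
pose T (i i' j j' : 'I_n) : R := C0 * (w `|i%:Z - i'%:Z|%N * w `|j%:Z - mu i i'|%N * w `|j%:Z - j'%:Z|%N).
(* Degenerate quadruples, where a weight has its default value 0. There are at most 3 n^3 of them,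
   each charged 1 / bmin, which is of lower order than n^4. *)
pose bad (i i' j j' : 'I_n) : R := (i == i')%:R + (j == j')%:R + (j%:Z == mu i i')%:R.
have T0 i i' j j' : 0 <= T i i' j j'.
  by rewrite /T mulr_ge0 ?(ltW C00)// !mulr_ge0 ?weight_ge0.
have pair i i' j j' : f i j = f i' j' -> (b (f i j))^-1 <= T i i' j j' + bad i i' j j' / bmin.
  move=> ef; have bi : (b (f i j))^-1 <= bmin^-1 by rewrite lef_pV2 ?posrE.
  have bb (x y z : bool) : x || y || z -> 1 <= x%:R + y%:R + z%:R :> R.
    by case: x; case: y; case: z => //= _; lra.
  have [h|] := boolP [|| i == i', j == j' | j%:Z == mu i i'].
    rewrite (le_trans bi)// -[leLHS]add0r lerD// ler_peMl ?invr_ge0 ?(ltW bm0)//.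
    by rewrite /bad; apply: bb; rewrite -orbA.
  rewrite !negb_or => /and3P[h1 h2 h3]; rewrite -[leLHS]addr0 lerD//.
    by rewrite -[leLHS]mulr1 mulrC -ler_pdivlMr ?invr_gt0// invrK mulrC; exact: hf.
  by rewrite divr_ge0 ?(ltW bm0)// /bad !addr_ge0.
pose N k : R := \sum_i \sum_j (f i j == k)%:R.
have sumN : \sum_k N k = n%:R ^+ 2.
  rewrite /N exchange_big /=; under eq_bigr do rewrite exchange_big /=.
  rewrite (eq_bigr (fun=> n%:R)); last first.
    move=> i _; rewrite (eq_bigr (fun=> 1)); first by rewrite sumr_const card_ord.
    move=> j _; rewrite (bigD1 (f i j))//= eqxx big1 ?addr0// => k kf.
    by rewrite eq_sym (negbTE kf).
  by rewrite sumr_const card_ord -[LHS]mulr_natr expr2.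
have sumN2 : \sum_k N k ^+ 2 / b k <= \sum_i \sum_i' \sum_j \sum_j' (T i i' j j' + bad i i' j j' / bmin).
  have -> : \sum_k N k ^+ 2 / b k = \sum_i \sum_i' \sum_j \sum_j'
      \sum_k (f i j == k)%:R * (f i' j' == k)%:R / b k.
    transitivity (\sum_k \sum_i \sum_i' \sum_j \sum_j' (f i j == k)%:R * (f i' j' == k)%:R / b k).
      apply: eq_bigr => k _; rewrite expr2 /N big_distrlr /= mulr_suml.
      apply: eq_bigr => i _; rewrite mulr_suml; apply: eq_bigr => i' _.
      rewrite big_distrlr /= mulr_suml; apply: eq_bigr => j _.
      by rewrite mulr_suml.
    rewrite exchange_big /=; apply: eq_bigr => i _.
    rewrite exchange_big /=; apply: eq_bigr => i' _.
    rewrite exchange_big /=; apply: eq_bigr => j _.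
    by rewrite exchange_big.
  apply: ler_sum => i _; apply: ler_sum => i' _; apply: ler_sum => j _; apply: ler_sum => j' _.
  rewrite (bigD1 (f i j))//= eqxx mul1r big1 ?addr0; last first.
    by move=> k kf; rewrite eq_sym (negbTE kf) !mul0r.
  case: eqP => [/esym e|_]; first by rewrite mul1r; exact: pair.
  by rewrite mul0r addr_ge0// divr_ge0 ?(ltW bm0)// /bad !addr_ge0.
(* The kernel factors: summing over j', then j, then i' costs [W] each time, and the sum over i
   costs n. *)
have sumT : \sum_i \sum_i' \sum_j \sum_j' T i i' j j' <= Q * n%:R ^+ 4.
  pose W := 8 / a * n%:R : R.
  have W0 : 0 <= W by rewrite !mulr_ge0 ?invr_ge0 ?ltW.
  have dist (i : 'I_n) : \sum_(j < n) w `|i%:Z - j%:Z|%N <= W.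
    under eq_bigr do rewrite distnC.
    apply: sum_weight_dist => // j.
    exact: ord_dist_le.
  apply: (@le_trans _ _ (\sum_(i < n) C0 * (W * W * W))).
    apply: ler_sum => i _.
    rewrite (eq_bigr (fun i' : 'I_n => C0 * (w `|i%:Z - i'%:Z|%N *
      \sum_(j < n) (w `|j%:Z - mu i i'|%N * \sum_(j' < n) w `|j%:Z - j'%:Z|%N)))); last first.
      move=> i' _; rewrite !mulr_sumr; apply: eq_bigr => j _.
      by rewrite !mulr_sumr; apply: eq_bigr => j' _; rewrite /T; ring.
    rewrite -mulr_sumr ler_pM2l//.
    apply: (@le_trans _ _ (\sum_(i' < n) w `|i%:Z - i'%:Z|%N * (W * W))).
      apply: ler_sum => i' _; rewrite ler_wpM2l ?weight_ge0//.
      apply: (@le_trans _ _ (\sum_(j < n) w `|j%:Z - mu i i'|%N * W)).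
        by apply: ler_sum => j _; rewrite ler_wpM2l ?weight_ge0.
      by rewrite -mulr_suml ler_wpM2r//; apply: sum_weight_dist => //.
    by rewrite -mulr_suml -[leRHS]mulrA; apply: ler_wpM2r; [exact: mulr_ge0|exact: dist].
  rewrite sumr_const card_ord -mulr_natr /Q /W.
  by rewrite le_eqVlt; apply/orP; left; apply/eqP; ring.
have sumbad : \sum_i \sum_i' \sum_j \sum_j' (bad i i' j j' / bmin) <= 3 * n%:R ^+ 3 / bmin.
  have I1 (F : 'I_n -> bool) : (forall x y, F x -> F y -> x = y) -> \sum_x (F x)%:R <= 1 :> R.
    move=> inj; have [[x Fx]|no] := pselect (exists x, F x).
      rewrite (bigD1 x)//= Fx big1 ?addr0// => y yx.
      by case: (boolP (F y)) => // Fy; rewrite (inj _ _ Fy Fx) eqxx in yx.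
    by rewrite big1// => x _; case: (boolP (F x)) => // Fx; case: no; exists x.
  have cst (c : R) : \sum_(x < n) c = c * n%:R by rewrite sumr_const card_ord mulr_natr.
  rewrite (eq_bigr (fun i => (\sum_i' \sum_j \sum_j' bad i i' j j') / bmin)); last first.
    move=> i _; rewrite mulr_suml; apply: eq_bigr => i' _; rewrite mulr_suml.
    by apply: eq_bigr => j _; rewrite mulr_suml.
  rewrite -mulr_suml ler_pM2r ?invr_gt0//.
  apply: (@le_trans _ _ (\sum_(i < n) (3 * n%:R ^+ 2))); last first.
    by rewrite cst le_eqVlt; apply/orP; left; apply/eqP; ring.
  apply: ler_sum => i _; rewrite /bad.
  rewrite (eq_bigr (fun i' : 'I_n => (i == i')%:R * n%:R ^+ 2 + n%:R + n%:R * (\sum_(j < n) (j%:Z == mu i i')%:R))); last first.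
    move=> i' _; rewrite (eq_bigr (fun j : 'I_n => (i == i')%:R * n%:R + 1 + n%:R * (j%:Z == mu i i')%:R)).
      rewrite big_split /= big_split /= !cst -mulr_sumr; ring.
    move=> j _; rewrite big_split /= big_split /= !cst [X in _ + X + _](_ : _ = 1); first by ring.
    by rewrite (bigD1 j)//= eqxx big1 ?addr0// => k kj; rewrite eq_sym (negbTE kj).
  rewrite big_split /= big_split /= cst -mulr_suml -mulr_sumr.
  have h1 : \sum_(i' < n) (i == i')%:R <= 1 :> R by apply: I1 => x y /eqP <- /eqP <-.
  have h2 : \sum_(i' < n) \sum_(j < n) (j%:Z == mu i i')%:R <= n%:R :> R.
    rewrite -[leRHS]mul1r -cst; apply: ler_sum => i' _; apply: I1 => x y /eqP <- /eqP [] e.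
    exact: val_inj.
  by have := ler_wpM2r (exprn_ge0 2 (ltW nR)) h1; have := ler_wpM2l (ltW nR) h2; lra.
(* This [t] turns the energy term into n^2/4, and the hypothesis on [eps] bounds t eps by n^2/4;
   half of n^2 remains against the degenerate term. *)
pose t := Q * n%:R ^+ 2.
have t0 : 0 < t by rewrite mulr_gt0// exprn_gt0.
have main : n%:R ^+ 2 <= t * eps + (4 * t)^-1 * (Q * n%:R ^+ 4 + 3 * n%:R ^+ 3 / bmin).
  rewrite -sumN; apply: (@le_trans _ _ (\sum_k (t * b k + (4 * t)^-1 * (N k ^+ 2 / b k)))).
    apply: ler_sum => k _; rewrite -subr_ge0.
    rewrite (_ : _ - N k = (2 * t * b k - N k) ^+ 2 / (4 * t * b k)).
      apply: divr_ge0; first exact: sqr_ge0.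
      by apply: mulr_ge0 (ltW (b0 k)); apply: mulr_ge0 (ltW t0).
    by field; rewrite !gt_eqF.
  have t4 : 0 < (4 * t)^-1 by rewrite invr_gt0 mulr_gt0.
  rewrite big_split /= -!mulr_sumr; apply: lerD; first by rewrite ler_pM2l.
  rewrite ler_pM2l//; apply: (le_trans sumN2).
  rewrite (eq_bigr (fun i => \sum_i' \sum_j \sum_j' T i i' j j' + \sum_i' \sum_j \sum_j' (bad i i' j j' / bmin))).
    by rewrite big_split lerD.
  move=> i _; rewrite -big_split; apply: eq_bigr => i' _; rewrite -big_split.
  by apply: eq_bigr => j _; rewrite -big_split.
have e1 : (4 * t)^-1 * (Q * n%:R ^+ 4 + 3 * n%:R ^+ 3 / bmin) =
    n%:R ^+ 2 / 4 + n%:R * (3 / (4 * Q * bmin)).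
  by rewrite /t; field; rewrite !gt_eqF.
rewrite e1 /t in main.
have h : n%:R ^+ 2 / 2 <= n%:R * (3 / (4 * Q * bmin)).
  have : Q * n%:R ^+ 2 * eps <= n%:R ^+ 2 / 4.
    rewrite (_ : _ * eps = n%:R ^+ 2 * (Q * eps)); last by ring.
    by rewrite ler_pM2l ?exprn_gt0.
  by lra.
rewrite -(ler_pM2l nR) -expr2.
rewrite (_ : 3 / (2 * Q * bmin) = 2 * (3 / (4 * Q * bmin))); last by field; rewrite !gt_eqF.
by lra.
Qed.

End energy.

(** * Euclidean covers *)

Section euclidean.
Context {R : realType} {n : nat}.
Local Notation C := R[i].
Local Notation Cn := 'rV[C]_n.
Local Notation Re := (@complex.Re R).
Local Notation Im := (@complex.Im R).
Implicit Types (x y z : Cn) (X : set Cn).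
Local Notation d := (@euclidean_dist R n).

Lemma euclidean_distE x y : d x y = Num.sqrt (nrm2 (x - y)).
Proof.
rewrite /euclidean_dist /nrm2; congr Num.sqrt; apply: eq_bigr => j _.
by rewrite !mxE.
Qed.

Lemma euclidean_dist_ge0 x y : 0 <= d x y.
Proof. exact: sqrtr_ge0. Qed.

Lemma sqr_euclidean_dist x y : d x y ^+ 2 = nrm2 (x - y).
Proof. by rewrite euclidean_distE sqr_sqrtr ?nrm2_ge0. Qed.

Lemma euclidean_distC x y : d x y = d y x.
Proof. by rewrite !euclidean_distE nrm2_sub. Qed.

Lemma Re_hdot_CauchySchwarz x y : Re (hdot x y) ^+ 2 <= nrm2 x * nrm2 y.
Proof.
have [->|y0] := eqVneq y 0.
  rewrite /hdot big1; last by move=> j _; rewrite mxE conjc0 mulr0.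
  by rewrite cRe0 expr0n /= mulr_ge0 ?nrm2_ge0.
have ny : 0 < nrm2 y by rewrite nrm2_gt0.
have := nrm2_ge0 ((nrm2 y)%:C *: x - (Re (hdot x y))%:C *: y).
rewrite nrm2B !nrm2Z hdotZl hdotZr !nsq_real !cReImE => h.
have : 0 <= nrm2 y * (nrm2 x * nrm2 y - Re (hdot x y) ^+ 2) by nra.
by rewrite pmulr_rge0// subr_ge0.
Qed.

Lemma euclidean_dist_triangle x y z : d x z <= d x y + d y z.
Proof.
rewrite -(@ler_pXn2r _ 2) ?nnegrE ?addr_ge0 ?euclidean_dist_ge0//.
rewrite sqrrD !sqr_euclidean_dist (_ : x - z = (x - y) + (y - z)); last by rewrite addrA subrK.
rewrite nrm2D lerD2r lerD2l.
have h : Re (hdot (x - y) (y - z)) <= d x y * d y z.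
  apply: (le_trans (ler_norm _)); rewrite -sqrtr_sqr !euclidean_distE -sqrtrM ?nrm2_ge0//.
  by rewrite ler_sqrt ?mulr_ge0 ?nrm2_ge0//; exact: Re_hdot_CauchySchwarz.
by rewrite mulr2n; lra.
Qed.

Lemma euclidean_dist_continuous x : continuous (d x).
Proof.
move=> y.
have -> : d x = Num.sqrt \o (fun y => nrm2 (y - x)).
  by apply/funext => w; rewrite euclidean_distE nrm2_sub.
have c1 : {for y, continuous (fun z : Cn => z - x)} by exact: rV_subr_continuous.
exact: (continuous_comp (continuous_comp c1 (@nrm2_continuous _ _ _)) (@sqrt_continuous R _)).
Qed.

Lemma coord_lipschitz (f : Cn -> C) (L : R) : 0 <= L ->
  (forall x y, nsq (f x - f y) <= L ^+ 2 * nrm2 (x - y)) ->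
  forall x y, `|Re (f x) - Re (f y)| <= L * d x y /\ `|Im (f x) - Im (f y)| <= L * d x y.
Proof.
move=> L0 hf x y.
have key (a : R) : a ^+ 2 <= nsq (f x - f y) -> `|a| <= L * d x y.
  move=> h; rewrite -sqrtr_sqr euclidean_distE -[L in leRHS]ger0_norm// -sqrtr_sqr -sqrtrM ?sqr_ge0//.
  by rewrite ler_sqrt ?mulr_ge0 ?sqr_ge0 ?nrm2_ge0//; exact: (le_trans h).
by split; apply: key; rewrite -?cReB -?cImB; [exact: cRe_sq_le|exact: cIm_sq_le].
Qed.

(* The sets of a countable cover are enlarged to neighbourhoods at the cost of an
   additional eps / 2^(i+2) in the i-th term. *)
Lemma null_finite_cover X (s eps : R) : compact X -> 0 < s -> 0 < eps ->
  hausdorff_measure d s X = 0 ->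
  exists (K : nat) (V : nat -> set Cn) (b : nat -> R),
    [/\ forall i, 0 < b i, \sum_(i < K) b i <= eps,
        forall x, X x -> exists2 i, (i < K)%N & V i x &
        forall i x y, V i x -> V i y -> d x y `^ s <= b i].
Proof.
move=> cX s0 e0 hX.
have d0 := euclidean_dist_ge0.
have e20 : 0 < eps / 2 by rewrite divr_gt0.
have [W [XW dW sW]] := (hausdorff_null d s X).1 hX 1 (eps / 2) ltr01 e20.
have fW i : diam_pow d s (W i) \is a fin_num.
  rewrite ge0_fin_numE ?diam_pow_ge0//.
  have [->|/set0P W0] := eqVneq (W i) set0; first by rewrite diam_pow_set0 ltry.
  have [r _ hr] := diameter_fin d0 W0 (dW i).
  by rewrite (diam_powE _ W0 hr) ltry.
pose c i := fine (diam_pow d s (W i)).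
have c0 i : 0 <= c i by rewrite fine_ge0// diam_pow_ge0.
pose b i := c i + eps / 2 * (2^-1) ^+ i.+1.
have b0 i : 0 < b i by rewrite ltr_wpDl// mulr_gt0// exprn_gt0.
(* [r i] and [del i] are the diameters whose powers of exponent [s] are [b i] and [c i]. Thickening
   [W i] by half of the gap keeps mutual distances at most [r i]. *)
pose r i := b i `^ s^-1.
have rs i : r i `^ s = b i by rewrite /r -powRrM mulVf ?gt_eqF// powRr1// ltW.
pose del i := c i `^ s^-1.
have dr i : del i < r i.
  rewrite /del /r gt0_ltr_powR ?invr_gt0 ?nnegrE ?(ltW (b0 i))//.
  by rewrite /b ltrDl mulr_gt0// exprn_gt0.
have dWd i x y : W i x -> W i y -> d x y <= del i.
  move=> Wx Wy; have W0 : W i !=set0 by exists x.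
  have [t /andP[t0 _] ht] := diameter_fin d0 W0 (dW i).
  have ct : c i = t `^ s by rewrite /c (diam_powE _ W0 ht).
  rewrite /del ct -powRrM divff ?gt_eqF// powRr1//.
  by rewrite -lee_fin -ht; exact: le_diameter.
pose V i : set Cn := [set x | exists2 v, W i v & d x v < (r i - del i) / 2].
have oV i x : W i x -> nbhs x (V i).
  move=> Wx; have h : nbhs (d x x) [set t : R | t < (r i - del i) / 2].
    apply: lt_nbhsl; rewrite euclidean_distE subrr (eqP (_ : nrm2 (0 : Cn) == 0)) ?nrm2_eq0//.
    by rewrite sqrtr0 divr_gt0// subr_gt0.
  apply: (@filterS _ (nbhs x) _ _ _ _ (euclidean_dist_continuous h)) => y /= hy; exists x => //; by rewrite euclidean_distC.
have [] := (compact_near_coveringP X).1 cX nat \oo (fun N x => exists2 i, (i < N)%N & V i x) _.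
  move=> x Xx; have [i _ Wx] := XW x Xx.
  exists (V i, [set N | (i < N)%N]); first by split; [exact: oV|exists i.+1].
  by move=> [y N] [/= Vy iN]; exists i.
move=> K _ hK; exists K, V, b; split => //.
- have hs : \sum_(i < K) c i <= eps / 2.
    rewrite -lee_fin; apply: le_trans sW.
    apply: (@le_trans _ _ (\sum_(0 <= i < K) diam_pow d s (W i))%E).
      rewrite big_mkord -sumEFin le_eqVlt; apply/orP; left; apply/eqP.
      by apply: eq_bigr => i _; rewrite fineK.
    by apply: (@nneseries_lim_ge R (fun i => diam_pow d s (W i)) xpredT 0%N K) => i _ _; exact: diam_pow_ge0.
  have hg : forall k, \sum_(i < k) eps / 2 * (2^-1) ^+ i.+1 = eps / 2 * (1 - (2^-1) ^+ k).
    elim=> [|k IH]; first by rewrite big_ord0 expr0 subrr mulr0.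
    by rewrite big_ord_recr /= IH exprS; lra.
  rewrite big_split /= hg.
  have : 0 <= eps / 2 * (2^-1) ^+ K by rewrite mulr_ge0 ?exprn_ge0// ltW.
  by lra.
- by move=> x Xx; exact: (hK K (leqnn K) x Xx).
- move=> i x y [v Wv xv] [w Ww yw].
  have h : d x y <= r i.
    have := euclidean_dist_triangle x v y; have := euclidean_dist_triangle v w y.
    have := dWd i _ _ Wv Ww; rewrite (euclidean_distC w y); lra.
  by rewrite -rs; apply: ge0_ler_powR => //; rewrite ?nnegrE ?(ltW s0)// powR_ge0.
Qed.

End euclidean.

(** * Boundaries of two-dimensional slices *)

Section leaves.
Context {R : realType}.
Local Notation C := R[i].
Local Notation C2 := 'rV[C]_2.
Local Notation Re := (@complex.Re R).
Local Notation Im := (@complex.Im R).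

Lemma cauchy2 (x y t : R) : (y - t * x) ^+ 2 <= (1 + t ^+ 2) * (x ^+ 2 + y ^+ 2).
Proof. by rewrite -subr_ge0 (_ : _ - _ = (x + t * y) ^+ 2) ?sqr_ge0//; ring. Qed.

(* With k = a * conj b, the cross product of conj b * (a + b r (1 + i t)) with
   1 + i t is Im k - t Re k, which does not depend on r and vanishes only at
   t = Im k / Re k. For slopes beyond 2 it stays away from 0 on [0, 1], and
   phi = 2 serves. *)
Lemma ray_slope (a b : C) : exists2 phi : R, - 2 <= phi <= 2 &
  forall r t : R, 0 <= t <= 1 ->
    nsq a * (t - phi) ^+ 2 <= 40 * nsq (a + b * (r%:C * (1 +i* t))).
Proof.
have t2 (t : R) : 0 <= t <= 1 -> (t - 2) ^+ 2 <= 4 by move=> /andP[t0 t1]; nra.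
have [->|b0] := eqVneq b 0.
  exists 2; first by apply/andP; split; lra.
  move=> r t /t2 h; rewrite mul0r addr0; have := nsq_ge0 a; nra.
have nb : 0 < nsq b by rewrite lt_neqAle nsq_ge0 eq_sym nsq_eq0 b0.
pose k1 := Re (a * conjc b); pose k2 := Im (a * conjc b).
have kE : k1 ^+ 2 + k2 ^+ 2 = nsq a * nsq b.
  by rewrite -[LHS]/(nsq (a * conjc b)) nsqM nsq_conj.
have low (r t : R) : 0 <= t <= 1 -> (k2 - t * k1) ^+ 2 <= 2 * (nsq (a + b * (r%:C * (1 +i* t))) * nsq b).
  move=> /andP[t0 t1]; rewrite -(nsq_conj b) -nsqM.
  have -> : k2 - t * k1 = (k2 + nsq b * r * t) - t * (k1 + nsq b * r) by ring.
  apply: (le_trans (cauchy2 _ _ _)).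
  have -> : nsq ((a + b * (r%:C * (1 +i* t))) * conjc b) = (k1 + nsq b * r) ^+ 2 + (k2 + nsq b * r * t) ^+ 2.
    by rewrite /nsq /k1 /k2 !cReImE; ring.
  by rewrite ler_wpM2r ?addr_ge0 ?sqr_ge0//; nra.
suff [phi hp hphi] : exists2 phi : R, - 2 <= phi <= 2 & forall t, 0 <= t <= 1 ->
    (k1 ^+ 2 + k2 ^+ 2) * (t - phi) ^+ 2 <= 20 * (k2 - t * k1) ^+ 2.
  exists phi => // r t t01; rewrite -(ler_pM2r nb).
  have := hphi t t01; have := low r t t01; rewrite kE; lra.
have [h|h] := lerP (k2 ^+ 2) (4 * k1 ^+ 2).
  have [e|n0] := eqVneq k1 0.
    exists 0; first by apply/andP; split; lra.
    have e2 : k2 = 0 by apply/eqP; rewrite -sqrf_eq0 eq_le sqr_ge0 andbT; move: h; rewrite e; lra.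
    by move=> t _; rewrite e e2; lra.
  have k10 : 0 < k1 ^+ 2 by rewrite lt_neqAle sqr_ge0 eq_sym sqrf_eq0 n0.
  exists (k2 / k1).
    rewrite -ler_norml -(@ler_pXn2r _ 2) ?nnegrE// real_normK ?num_real// expr_div_n ler_pdivrMr//; lra.
  move=> t _; have -> : k2 - t * k1 = k1 * (k2 / k1 - t) by field.
  rewrite exprMn -[(t - _) ^+ 2]sqrrN opprB; have := sqr_ge0 (k2 / k1 - t); nra.
exists 2; first by apply/andP; split; lra.
move=> t t01; have h4 := t2 t t01; have /andP[t0 t1] := t01.
have : k2 ^+ 2 <= 4 * (k2 - t * k1) ^+ 2.
  suff : 0 <= (k2 - 2 * t * k1) * (3 * k2 - 2 * t * k1) by nra.
  have {}h : `|2 * k1| <= `|k2|.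
    rewrite -(@ler_pXn2r _ 2) ?nnegrE// !real_normK ?num_real//; lra.
  have [k20|k20] := lerP 0 k2.
    move: h; rewrite (ger0_norm k20) ler_norml => /andP[h1 h2].
    by apply: mulr_ge0; nra.
  move: h; rewrite (ltr0_norm k20) ler_norml opprK => /andP[h1 h2].
  by apply: mulr_le0; nra.
by have := sqr_ge0 k1; nra.
Qed.

(** For the difference x + i y one has y - t' x = r (t - t'), free of [r'], and the Cauchy-Schwarz
    factor 1 + t'^2 is at most 2. *)
Lemma ray_separation (r r' t t' : R) : 0 <= t' <= 1 ->
  r ^+ 2 * (t - t') ^+ 2 <= 2 * nsq (r%:C * (1 +i* t) - r'%:C * (1 +i* t')).
Proof.
move=> /andP[t0 t1]; rewrite /nsq !cReImE.
set x := (X in X ^+ 2 + _); set y := (X in _ + X ^+ 2).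
have -> : r ^+ 2 * (t - t') ^+ 2 = (y - t' * x) ^+ 2 by rewrite /x /y; ring.
apply: (le_trans (cauchy2 x y t')).
by rewrite ler_wpM2r ?addr_ge0 ?sqr_ge0//; nra.
Qed.

(** Replaces the exceptional slope by an integer centre, as [sum_weight_dist] requires. For j
    different from mu, rounding by at most 1/2 loses at most half of |j - mu|, whence the factor 4;
    |phi| <= 2 keeps distances within 4n. *)
Lemma nearest_int (n : nat) (phi : R) : (0 < n)%N -> - 2 <= phi <= 2 ->
  exists mu : int, forall j : 'I_n, (`|j%:Z - mu| <= 4 * n)%N /\
    (j%:Z != mu -> (`|j%:Z - mu|%N%:R / n%:R) ^+ 2 <= 4 * (j%:R / n%:R - phi) ^+ 2).
Proof.
move=> n0 /andP[p1 p2]; have nR : 1 <= n%:R :> R by rewrite ler1n.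
pose mu := Num.floor (n%:R * phi + 2^-1).
have m1 : mu%:~R <= n%:R * phi + 2^-1 by exact: floor_le_tmp.
have m2 : n%:R * phi + 2^-1 < mu%:~R + 1 by rewrite -intrD1; exact: floorD1_gt.
exists mu => j.
have jn : (j%:R + 1 <= n%:R :> R) by rewrite natr1 ler_nat.
have j0 : 0 <= j%:R :> R by [].
have absE : `|j%:Z - mu|%N%:R = `|j%:R - mu%:~R| :> R.
  by rewrite natr_absz intr_norm rmorphB.
split.
  rewrite -(ler_nat R) absE natrM ler_norml; apply/andP; split; nra.
move=> jmu; rewrite absE.
have h1 : 1 <= `|j%:R - mu%:~R| :> R.
  by rewrite -absE ler1n absz_gt0 subr_eq0.
have -> : j%:R / n%:R - phi = (j%:R - n%:R * phi) / n%:R by field; lra.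
rewrite !expr_div_n mulrA ler_pM2r ?invr_gt0 ?exprn_gt0; try lra.
rewrite real_normK ?num_real//.
move: h1; rewrite ler_normr => /orP[h1|h1]; nra.
Qed.

End leaves.

Section slice_boundary.
Context {R : realType}.
Local Notation C := R[i].
Local Notation C2 := 'rV[C]_2.
Local Notation Re := (@complex.Re R).
Local Notation Im := (@complex.Im R).

Definition pair_row (a b : C) : C2 := \row_j (if j == 0 then a else b).

Lemma pair_row0 a b : pair_row a b 0 0 = a. Proof. by rewrite mxE. Qed.
Lemma pair_row1 a b : pair_row a b 0 1 = b. Proof. by rewrite mxE. Qed.

Lemma pair_rowP (w : C2) a b : w 0 0 = a -> w 0 1 = b -> w = pair_row a b.
Proof.
move=> wa wb; apply/rowP => j; rewrite mxE; case: ifPn => [/eqP ->//|j0].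
by have -> // : j = 1; case: j j0 => -[|[|//]] h // _; exact: val_inj.
Qed.

Lemma nrm2_pair (w : C2) : nrm2 w = nsq (w 0 0) + nsq (w 0 1).
Proof. by rewrite /nrm2 sum_ord2. Qed.

(** A leaf as the graph of slope [m] over the first coordinate through (c0, zeta), restricted to the
    ray of direction 1 + i t; the real radius [r] is left free. *)
Definition leaf_point (c0 zeta m : C) (r t : R) : C2 :=
  pair_row (c0 + r%:C * (1 +i* t)) (zeta + m * (r%:C * (1 +i* t))).

(** Two bounds are multiplied. The first coordinates give c3 |t - t'|^2 <= |E0|^2, and the gap
    between the leaves gives c3 (x y)^2 <= |E0|^2 + |E1|^2; then 2 x y z <= (x y)^2 + z^2. The
    constant 320 (1 + Mb) is 4 * 40 from the slope bounds times 2 (1 + Mb) from [hV]. *)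
Lemma leaf_point_separation (c0 ze ze' m m' : C) (r r' t t' : R) (Mb rho kappa x y phi c3 : R) :
  0 <= t <= 1 -> 0 <= t' <= 1 -> 0 < rho -> 0 <= Mb -> nsq m' <= Mb ->
  rho ^+ 2 <= 2 * r ^+ 2 -> kappa ^+ 2 * x ^+ 2 <= nsq (ze - ze') ->
  y ^+ 2 <= 4 * (t - phi) ^+ 2 ->
  nsq (ze - ze') * (t - phi) ^+ 2 <= 40 * nsq (ze - ze' + (m - m') * (r%:C * (1 +i* t))) ->
  0 <= c3 -> 4 * c3 <= rho ^+ 2 -> c3 * (320 * (1 + Mb)) <= kappa ^+ 2 -> 0 <= x -> 0 <= y ->
  c3 * (x * y * `|t - t'|) <= nrm2 (leaf_point c0 ze m r t - leaf_point c0 ze' m' r' t').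
Proof.
move=> t01 t'01 rho0 Mb0 mM rr xk yphi slope c30 c3rho c3k x0 y0.
have coordB (v v' : C2) j : (v - v') 0 j = v 0 j - v' 0 j by rewrite !mxE.
rewrite nrm2_pair; set w := leaf_point _ _ _ _ _; set w' := leaf_point _ _ _ _ _.
have -> : (w - w') 0 0 = r%:C * (1 +i* t) - r'%:C * (1 +i* t').
  rewrite coordB [w 0 0]pair_row0 [w' 0 0]pair_row0; apply: complexP; rewrite !cReImE; ring.
have -> : (w - w') 0 1 = ze - ze' + m * (r%:C * (1 +i* t)) - m' * (r'%:C * (1 +i* t')).
  rewrite coordB [w 0 1]pair_row1 [w' 0 1]pair_row1; apply: complexP; rewrite !cReImE; ring.
set E0 := (X in nsq X + _); set E1 := (X in _ + nsq X).
have hz : c3 * (t - t') ^+ 2 <= nsq E0.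
  have := @ray_separation R r r' t t' t'01; rewrite -/E0 => h.
  have := sqr_ge0 (t - t'); nra.
(* The vertical gap between the two leaves over the first point is E1 - m' E0, hence controlled by
   the distance of the two points. *)
have hV : nsq (ze - ze' + (m - m') * (r%:C * (1 +i* t))) <= 2 * (1 + Mb) * (nsq E0 + nsq E1).
  have -> : ze - ze' + (m - m') * (r%:C * (1 +i* t)) = E1 - m' * E0.
    by rewrite /E0 /E1; apply: complexP; rewrite !cReImE; ring.
  apply: (@le_trans _ _ (2 * nsq E1 + 2 * nsq (m' * E0))).
    rewrite -subr_ge0 (_ : _ - _ = nsq (E1 + m' * E0)) ?nsq_ge0//.
    by move: (m' * E0) => F; rewrite /nsq !cReImE; ring.
  rewrite nsqM; have := nsq_ge0 E0; have := nsq_ge0 E1; nra.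
have hxy : c3 * (x * y) ^+ 2 <= nsq E0 + nsq E1.
  have h1 : kappa ^+ 2 * (x * y) ^+ 2 <= 160 * nsq (ze - ze' + (m - m') * (r%:C * (1 +i* t))).
    rewrite [(x * y) ^+ 2]exprMn [leLHS]mulrA; apply: (@le_trans _ _ (nsq (ze - ze') * (4 * (t - phi) ^+ 2))).
      by apply: ler_pM; [exact: (mulr_ge0 (sqr_ge0 _) (sqr_ge0 _))|exact: sqr_ge0|exact: xk|exact: yphi].
    by lra.
  have M1 : 0 < 320 * (1 + Mb) by lra.
  rewrite -(ler_pM2l M1).
  have : c3 * (320 * (1 + Mb)) * (x * y) ^+ 2 <= kappa ^+ 2 * (x * y) ^+ 2 by rewrite ler_wpM2r ?sqr_ge0.
  by lra.
have hE1 := nsq_ge0 E1; have hE0 := nsq_ge0 E0.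
have : 0 <= c3 * (x * y - `|t - t'|) ^+ 2 by rewrite mulr_ge0 ?sqr_ge0.
have : `|t - t'| ^+ 2 = (t - t') ^+ 2 by rewrite real_normK ?num_real.
by move: `|t - t'| => z ez; rewrite -ez in hz; lra.
Qed.

Section domain.
Variables (K' D' X' : set C2) (c0 zeta : C) (kappa : R).
Hypothesis compactK' : compact K'.
Hypothesis closedK' : closed K'.
Hypothesis compactX' : compact X'.
Hypothesis openD' : open D'.
Hypothesis D'K' : D' `<=` K'.
Hypothesis X'_avoid : forall w, X' w -> w 0 0 != c0.
Hypothesis kappa_gt0 : 0 < kappa.
Hypothesis ball_D' : forall w : C2, nsq (w 0 0 - c0) + nsq (w 0 1 - zeta) <= kappa ^+ 2 -> D' w.
Hypothesis leaf : forall p, K' p -> ~ D' p -> exists2 d : C2, d != 0 &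
  (forall s : C, ~ D' (p + s *: d)) /\
  forall u : C, u != 0 -> exists2 r : R, 0 <= r & X' (p + (r%:C * u) *: d).

Lemma avoid_distance : exists2 rho : R, 0 < rho &
  forall w, X' w -> rho ^+ 2 <= nsq (w 0 0 - c0).
Proof.
have [[w0 Xw0]|no] := pselect (X' !=set0); last first.
  by exists 1 => // w Xw; case: no; exists w.
have [|w] := @compact_EVT_min _ _ (fun w : C2 => nsq (w 0 0 - c0)) X' (ex_intro _ w0 Xw0) compactX'.
  apply: continuous_subspaceT => z.
  have c1 : {for z, continuous (fun w : C2 => w 0 0)} by exact: coord_cvg.
  have c2 := for_continuousD c1 (@for_continuous_cst _ _ (- c0) z).
  exact: (continuous_comp c2 (@nsq_continuous R _)).
rewrite inE => Xw hw; exists (Num.sqrt (nsq (w 0 0 - c0))).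
  by rewrite sqrtr_gt0 lt_neqAle nsq_ge0 eq_sym nsq_eq0 subr_eq0 X'_avoid.
by move=> y Xy; rewrite sqr_sqrtr ?nsq_ge0//; apply: hw; rewrite inE.
Qed.

(** From a point of the ball at height kappa h on the line over [c0], move in the real direction to
    the last point of [K']. The imaginary part is unchanged, so different h give base points at a
    known distance. *)
Lemma top_point (h : R) : 0 <= h <= 1 -> exists ze : C,
  [/\ Im ze = Im zeta + kappa * h, K' (pair_row c0 ze) & ~ D' (pair_row c0 ze)].
Proof.
move=> /andP[h0 h1].
pose p := pair_row c0 (zeta + (0 +i* (kappa * h))); pose d := pair_row 0 1.
have Dp : D' p.
  apply: ball_D'; rewrite pair_row0 pair_row1 subrr nsq0 add0r [zeta + _]addrC addrK.
  rewrite /nsq !cReImE expr0n add0r exprMn ler_piMr ?sqr_ge0//; nra.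
have d0 : d != 0.
  apply/eqP => /rowP /(_ 1); rewrite pair_row1 mxE => /eqP; by rewrite oner_eq0.
have [r [r0 Kr hr]] := last_point compactK' closedK' (D'K' Dp) d0 (oner_neq0 _).
have pE (s : R) : p + (s%:C * 1) *: d = pair_row c0 (zeta + (s +i* (kappa * h))).
  apply: pair_rowP; rewrite !mxE; apply: complexP; rewrite !cReImE; ring.
rewrite pE in Kr.
exists (zeta + (r +i* (kappa * h))); split => //; first by rewrite cImD.
rewrite -pE => Dr.
have nD : nbhs (p + (r%:C * 1) *: d) D' by exact: open_nbhs_nbhs.
have cv : p + (t%:C * 1) *: d @[t --> r] --> p + (r%:C * 1) *: d.
  have -> : (fun t : R => p + (t%:C * 1) *: d) = (fun t => p + t%:C *: d).
    by apply/funext => t; rewrite mulr1.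
  by rewrite mulr1; exact: along_cvg.
have /nbhs_ballP[e /= e0 he] := cv _ nD.
have := he (r + e / 2); rewrite /ball /= opprD addrA subrr add0r normrN gtr0_norm ?divr_gt0//.
move=> /(_ (ltac:(lra)))/D'K'; apply: hr; lra.
Qed.

(** A vertical leaf would contain (c0, zeta), and a steep one would reach height [zeta] within
    horizontal distance kappa; either way it would meet the ball inside [D'], which leaves avoid. *)
Lemma leaf_slope (M : R) (ze : C) : (forall w, K' w -> nsq (w 0 1 - zeta) <= M) ->
  K' (pair_row c0 ze) -> ~ D' (pair_row c0 ze) ->
  exists2 m : C, nsq m <= M / kappa ^+ 2 &
    forall t : R, exists r : R, X' (leaf_point c0 ze m r t).
Proof.
move=> hM Kz Dz; have [d d0 [hD hX]] := leaf Kz Dz.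
have k2 : 0 < kappa ^+ 2 by rewrite exprn_gt0.
have addE (s : C) : pair_row c0 ze + s *: d = pair_row (c0 + s * d 0 0) (ze + s * d 0 1).
  by apply: pair_rowP; rewrite !mxE.
have d00 : d 0 0 != 0.
  apply/eqP => e; have d1 : d 0 1 != 0.
    apply/eqP => e1; move/eqP: d0; apply; rewrite (pair_rowP e e1).
    by apply/rowP => j; rewrite !mxE; case: ifP.
  apply: (hD ((zeta - ze) / d 0 1)); apply: ball_D'.
  rewrite addE pair_row0 pair_row1 e mulr0 addr0 subrr nsq0 add0r divfK//.
  by rewrite [ze + _]addrC subrK subrr nsq0 ltW.
pose m := d 0 1 / d 0 0.
exists m.
  have := hM _ Kz; rewrite pair_row1 => hMz.
  have M0 : 0 <= M by exact: le_trans (nsq_ge0 _) hMz.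
  have [m0|m0] := eqVneq m 0; first by rewrite m0 nsq0 divr_ge0// ltW.
  have nm : 0 < nsq m by rewrite lt_neqAle nsq_ge0 eq_sym nsq_eq0 m0.
  rewrite ler_pdivlMr// leNgt; apply/negP => lt.
  apply: (hD ((zeta - ze) / m / d 0 0)); apply: ball_D'.
  rewrite addE pair_row0 pair_row1 divfK// [c0 + _]addrC addrK.
  have -> : (zeta - ze) / m / d 0 0 * d 0 1 = (zeta - ze) / m * m by rewrite -[LHS]mulrA [_^-1 * _]mulrC.
  rewrite divfK// [ze + _]addrC subrK subrr nsq0 addr0 -(ler_pM2r nm) -nsqM divfK//.
  by rewrite -nsqN opprB; lra.
move=> t; have u0 : (1 +i* t : C) / d 0 0 != 0.
  rewrite mulf_neq0 ?invr_eq0//; apply/eqP => /(congr1 Re); rewrite cRe_mk cRe0.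
  by move=> /eqP; rewrite oner_eq0.
have [r _ Xr] := hX _ u0; exists r.
have -> // : leaf_point c0 ze m r t = pair_row c0 ze + (r%:C * ((1 +i* t) / d 0 0)) *: d.
rewrite addE /leaf_point /m; congr (pair_row (c0 + _) (ze + _)); field => //.
Qed.

Lemma leaf_grid : exists (Mb rho : R), [/\ 0 <= Mb, 0 < rho &
  forall h : R, 0 <= h <= 1 -> exists (ze m : C), [/\ Im ze = Im zeta + kappa * h, nsq m <= Mb &
    forall t : R, 0 <= t <= 1 -> exists2 r : R, rho ^+ 2 <= 2 * r ^+ 2 & X' (leaf_point c0 ze m r t)]].
Proof.
have Kz : K' (pair_row c0 zeta).
  by apply: D'K'; apply: ball_D'; rewrite pair_row0 pair_row1 !subrr nsq0 addr0 sqr_ge0.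
have [M0 M00 hM] := bounded_K' compactK' Kz (pair_row c0 zeta).
have hM' w : K' w -> nsq (w 0 1 - zeta) <= M0.
  move=> /hM; rewrite nrm2_pair !mxE /= => h; apply: (le_trans _ h).
  by rewrite lerDr nsq_ge0.
have [rho rho0 hrho] := avoid_distance.
exists (M0 / kappa ^+ 2), rho; split => //; first by rewrite divr_ge0 ?sqr_ge0.
move=> h h01; have [ze [zeI Kze Dze]] := top_point h01.
have [m mM hm] := leaf_slope hM' Kze Dze.
exists ze, m; split => // t /andP[t0 t1]; have [r Xr] := hm t; exists r => //.
have := hrho _ Xr; rewrite pair_row0 addrAC subrr add0r nsqM nsq_real /nsq cRe_mk cIm_mk.
have : r ^+ 2 * t ^+ 2 <= r ^+ 2 by rewrite ler_piMr ?sqr_ge0//; nra.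
lra.
Qed.

Lemma boundary_not_null (s : R) : 1 <= s < 2 ->
  hausdorff_measure (@euclidean_dist R 2) s X' <> 0.
Proof.
move=> /andP[s1 s2] hX.
have [Mb [rho [Mb0 rho0 grid]]] := leaf_grid.
(* Half of [s], since [leaf_point_separation] bounds squared distances. *)
pose sigma := s / 2.
have sig01 : 0 < sigma < 1 by apply/andP; split; rewrite /sigma; lra.
have k2 : 0 < kappa ^+ 2 by rewrite exprn_gt0.
have r2 : 0 < rho ^+ 2 by rewrite exprn_gt0.
pose c3 := Num.min (rho ^+ 2 / 4) (kappa ^+ 2 / (320 * (1 + Mb))).
have M1 : 0 < 320 * (1 + Mb) by lra.
have c30 : 0 < c3 by rewrite lt_min !divr_gt0.
have c3a : 4 * c3 <= rho ^+ 2.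
  have : c3 <= rho ^+ 2 / 4 by rewrite ge_min lexx.
  by lra.
have c3b : c3 * (320 * (1 + Mb)) <= kappa ^+ 2 by rewrite -ler_pdivlMr// ge_min lexx orbT.
pose C0 := c3 `^ (- sigma).
have C00 : 0 < C0 by rewrite powR_gt0.
pose Q := C0 * (8 / (1 - sigma)) ^+ 3.
have a0 : 0 < 1 - sigma by case/andP: sig01 => *; lra.
have Q0 : 0 < Q by rewrite mulr_gt0// exprn_gt0// divr_gt0.
have eps0 : 0 < (4 * Q)^-1 by rewrite invr_gt0 mulr_gt0.
have s0 : 0 < s by lra.
have [K [V [b [b0 sb covX hb]]]] := null_finite_cover compactX' s0 eps0 hX.
(* A positive lower bound for the finitely many [b i], in a form that also makes sense for
   [K = 0]. *)
pose bmin := (1 + \sum_(i < K) (b i)^-1)^-1.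
have S0 : 0 <= \sum_(i < K) (b i)^-1 by apply: sumr_ge0 => i _; rewrite invr_ge0 ltW.
have bm0 : 0 < bmin by rewrite invr_gt0; lra.
have hbm (k : 'I_K) : bmin <= b k.
  rewrite /bmin -[b k]invrK lef_pV2 ?posrE ?invr_gt0//; last by lra.
  rewrite (bigD1 k)//=; set S := \sum_(_ | _) _.
  have : 0 <= S by apply: sumr_ge0 => i _; rewrite invr_ge0 ltW.
  by lra.
suff main n : (0 < n)%N -> n%:R <= 3 / (2 * Q * bmin).
  have := main (Num.truncn (3 / (2 * Q * bmin))).+1 isT.
  by rewrite leNgt truncnS_gt.
move=> n0; have nR : 0 < n%:R :> R by rewrite ltr0n.
have frac (i : 'I_n) : 0 <= (i%:R / n%:R : R) <= 1.
  by rewrite divr_ge0//= ler_pdivrMr// mul1r ler_nat ltnW.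
have /choice[zm hzm] : forall i : 'I_n, exists zm : C * C,
    [/\ Im zm.1 = Im zeta + kappa * (i%:R / n%:R), nsq zm.2 <= Mb &
    forall t : R, 0 <= t <= 1 -> exists2 r : R, rho ^+ 2 <= 2 * r ^+ 2 & X' (leaf_point c0 zm.1 zm.2 r t)].
  by move=> i; have [ze [m hm]] := grid _ (frac i); exists (ze, m).
(* A radius and a cover index are picked independently for each leaf and ray; [phi] and [mu] below
   depend on the pair of leaves only. *)
have /choice[rk hrk] : forall ij : 'I_n * 'I_n, exists rk : R * 'I_K,
    rho ^+ 2 <= 2 * rk.1 ^+ 2 /\ V rk.2 (leaf_point c0 (zm ij.1).1 (zm ij.1).2 rk.1 (ij.2%:R / n%:R)).
  move=> [i j]; have [_ _ h] := hzm i; have [r hr Xr] := h _ (frac j).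
  by have [k kK Vk] := covX _ Xr; exists (r, Ordinal kK).
have /choice[phi hphi] : forall ii : 'I_n * 'I_n, exists phi : R, -2 <= phi <= 2 /\
    forall r t : R, 0 <= t <= 1 -> nsq ((zm ii.1).1 - (zm ii.2).1) * (t - phi) ^+ 2 <=
     40 * nsq ((zm ii.1).1 - (zm ii.2).1 + ((zm ii.1).2 - (zm ii.2).2) * (r%:C * (1 +i* t))).
  move=> [i i']; have [ph h1 h2] := ray_slope ((zm i).1 - (zm i').1) ((zm i).2 - (zm i').2).
  by exists ph.
have /choice[mu hmu] : forall ii : 'I_n * 'I_n, exists mu : int, forall j : 'I_n,
    (`|j%:Z - mu| <= 4 * n)%N /\
    (j%:Z != mu -> (`|j%:Z - mu|%N%:R / n%:R) ^+ 2 <= 4 * (j%:R / n%:R - phi ii) ^+ 2).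
  by move=> ii; have [h _] := hphi ii; exact: nearest_int n0 h.
apply: (@energy_bound R sigma sig01 n K (fun i j => (rk (i, j)).2) (fun k => b k)
  (fun i i' => mu (i, i')) (4 * Q)^-1 C0 bmin) => //.
- by move=> i i' j; have [] := hmu (i, i') j.
- move=> i i' j j' ef ii jj jmu.
  have [hr hV] := hrk (i, j); have [_ hV'] := hrk (i', j').
  have [hI hm _] := hzm i; have [hI' hm' _] := hzm i'.
  rewrite ef in hV *; have hd := hb _ _ _ hV hV'; move: hd.
  set w := leaf_point _ _ _ _ _; set w' := leaf_point _ _ _ _ _ => hd.
  set x := `|i%:Z - i'%:Z|%N; set y := `|j%:Z - mu (i, i')|%N; set z := `|j%:Z - j'%:Z|%N.
  have natE (k k' : 'I_n) : `|k%:Z - k'%:Z|%N%:R = `|k%:R - k'%:R| :> R.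
    by rewrite natr_absz intr_norm rmorphB.
  have x0 : x != 0%N by rewrite absz_eq0 subr_eq0 eqz_nat.
  have y0 : y != 0%N by rewrite absz_eq0 subr_eq0.
  have z0 : z != 0%N by rewrite absz_eq0 subr_eq0 eqz_nat.
  have sep : c3 * ((x%:R / n%:R) * (y%:R / n%:R) * (z%:R / n%:R)) <= nrm2 (w - w').
    have -> : z%:R / n%:R = `|j%:R / n%:R - j'%:R / n%:R| :> R.
      by rewrite /z natE -mulrBl normrM (gtr0_norm (_ : 0 < n%:R^-1)) ?invr_gt0.
    apply: (@leaf_point_separation c0 _ _ _ _ _ _ _ _ Mb rho kappa _ _ (phi (i, i'))) => //.
    + have -> : kappa ^+ 2 * (x%:R / n%:R) ^+ 2 = Im ((zm i).1 - (zm i').1) ^+ 2.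
        rewrite /x natE cImB hI hI' expr_div_n real_normK ?num_real//.
        by field; rewrite gt_eqF.
      exact: cIm_sq_le.
    + by have [_] := hmu (i, i') j; apply.
    + by have [_] := hphi (i, i'); apply.
    + exact: ltW.
  rewrite /weight (negbTE x0) (negbTE y0) (negbTE z0).
  have pn (k : nat) : k != 0%N -> 0 < k%:R / n%:R :> R by move=> k0; rewrite divr_gt0// ltr0n lt0n.
  have px := pn _ x0; have py := pn _ y0; have pz := pn _ z0.
  move: px py pz sep; move: (x%:R / n%:R) (y%:R / n%:R) (z%:R / n%:R) => X Y Z px py pz sep.
  have pXYZ : 0 < c3 * (X * Y * Z) by rewrite !mulr_gt0.
  have -> : C0 * (X `^ (- sigma) * Y `^ (- sigma) * Z `^ (- sigma)) = (c3 * (X * Y * Z)) `^ (- sigma).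
    by rewrite !powRM ?ltW ?mulr_gt0.
  rewrite powRN ler_pdivlMr ?powR_gt0// mul1r.
  apply: le_trans hd; rewrite euclidean_distE.
  have -> : Num.sqrt (nrm2 (w - w')) `^ s = nrm2 (w - w') `^ sigma.
    by rewrite -powR12_sqrt ?nrm2_ge0// -powRrM; congr (_ `^ _); rewrite /sigma; lra.
  have sig0 : 0 <= sigma by rewrite /sigma; lra.
  by apply: ge0_ler_powR => //; rewrite nnegrE ?nrm2_ge0// ltW.
- by rewrite le_eqVlt; apply/orP; left; apply/eqP; rewrite -/Q; field; rewrite gt_eqF.
Qed.

End domain.

End slice_boundary.

(** * Slices of null sets *)

Section null.
Context {R : realType} {T : Type} (d : T -> T -> R).
Hypothesis d_ge0 : forall x y, 0 <= d x y.
Implicit Types (E : set T) (s t : R).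

(* A set of negative dimension is empty. *)
Definition null_at s E := if 0 <= s then hausdorff_measure d s E = 0 else E = set0.

Lemma hausdorff_measure_set0 s : hausdorff_measure d s set0 = 0.
Proof.
apply/hausdorff_null => delta e d0 e0; exists (fun=> set0); split => [//|_|].
  by rewrite diameter_set0 leNye.
by rewrite eseries0 ?lee_fin ?ltW// => i _ _; rewrite diam_pow_set0.
Qed.

(** With exponent 0 every nonempty set of a cover counts 1, even at diameter 0, so a cover of total
    size 1/2 contains no point. *)
Lemma hausdorff_null0 E : hausdorff_measure d 0 E = 0 -> E = set0.
Proof.
move=> /hausdorff_null h; apply/seteqP; split => // x Ex.
have e0 : 0 < 2^-1 :> R by rewrite invr_gt0.
have [V [EV dV sV]] := h 1 2^-1 ltr01 e0.
have [i _ Vx] := EV x Ex.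
have V0 : V i !=set0 by exists x.
have [r _ hr] := diameter_fin d_ge0 V0 (dV i).
have : (1%:E <= 2^-1%:E :> \bar R)%E.
  apply: le_trans sV; rewrite -(powRr0 r) -(diam_powE 0 V0 hr).
  apply: (@le_trans _ _ (\sum_(0 <= k < i.+1) diam_pow d 0 (V k))%E).
    rewrite big_nat_recr//= leeDr//; apply: sume_ge0 => k _; exact: diam_pow_ge0.
  by apply: (@nneseries_lim_ge R (fun k => diam_pow d 0 (V k)) xpredT 0%N i.+1) => k _ _; exact: diam_pow_ge0.
by rewrite lee_fin; lra.
Qed.

Lemma null_at_le s t E : s <= t -> 0 <= t -> null_at s E -> hausdorff_measure d t E = 0.
Proof.
move=> st t0; rewrite /null_at; case: ifPn => [s0 h|_ ->]; last exact: hausdorff_measure_set0.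
by apply: (hausdorff_null_le d_ge0 _ h); rewrite s0.
Qed.

(** The convention for negative exponents makes the loss of 1 uniform: for 0 <= s < 1 the exponent
    is first raised to 1, and a slice that is null at exponent 0 is empty. *)
Lemma null_at_slice (f : T -> R) L s E (a b : R) : 0 < L ->
  (forall x y, `|f x - f y| <= L * d x y) -> a < b -> null_at s E ->
  exists2 c, a < c < b & null_at (s - 1) (E `&` f @^-1` [set c]).
Proof.
move=> L0 fL ab nE; have [s0|s0] := lerP 0 s; last first.
  exists ((a + b) / 2); first by apply/andP; split; lra.
  move: nE; rewrite /null_at !ifN -?ltNge//; last by lra.
  by move=> ->; rewrite set0I.
have [s1|s1] := lerP 1 s.
  have hE : hausdorff_measure d s E = 0 by exact: null_at_le nE.
  have [c abc hc] := slice_null d_ge0 L0 fL s1 ab hE.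
  by exists c => //; rewrite /null_at ifT// subr_ge0.
have hE : hausdorff_measure d 1 E = 0 by apply: null_at_le nE => //; exact: ltW.
have [c abc hc] := slice_null d_ge0 L0 fL (lexx 1) ab hE.
exists c => //; rewrite /null_at ifN -?ltNge ?subr_lt0//.
by apply: hausdorff_null0; rewrite subrr in hc.
Qed.

End null.

Lemma null_at_preimage (R : realType) (T T' : Type) (d : T -> T -> R) (d' : T' -> T' -> R)
    (f : T' -> T) s E : (forall x y, 0 <= d x y) ->
  (forall x y, d' x y = d (f x) (f y)) -> null_at d s E -> null_at d' s (f @^-1` E).
Proof.
move=> d0 d'E; rewrite /null_at; case: ifP => [s0|_ ->]; last by rewrite preimage_set0.
have d'0 x y : 0 <= d' x y by rewrite d'E.
move=> /hausdorff_null h; apply/hausdorff_null => delta e delta0 e0.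
have [V [EV dV sV]] := h _ _ delta0 e0.
have dle A : (diameter d' (f @^-1` A) <= diameter d A)%E.
  apply: ge_ereal_sup => _ [[x y] [/= Vx Vy] <-].
  by rewrite d'E; exact: le_diameter.
exists (fun i => f @^-1` V i); split.
- by move=> x /EV [i _ Vx]; exists i.
- by move=> i; exact: le_trans (dle _) (dV i).
apply: le_trans sV; apply: lee_nneseries => [i _ _|i _]; first exact: diam_pow_ge0.
have [->|/set0P W0] := eqVneq (f @^-1` V i) set0.
  by rewrite diam_pow_set0 diam_pow_ge0.
have V0 : V i !=set0 by have [x Vx] := W0; exists (f x).
have [r /andP[r0 _] hr] := diameter_fin d0 V0 (dV i).
have [r' /andP[r'0 r'r] hr'] : exists2 r' : R, 0 <= r' <= r & diameter d' (f @^-1` V i) = r'%:E.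
  by apply: (diameter_fin d'0 W0); rewrite -hr.
by rewrite (diam_powE _ V0 hr) (diam_powE _ W0 hr') lee_fin; apply: ge0_ler_powR.
Qed.

Section complex_slices.
Context {R : realType} {n : nat}.
Local Notation C := R[i].
Local Notation Cn := 'rV[C]_n.
Local Notation Re := (@complex.Re R).
Local Notation Im := (@complex.Im R).
Local Notation null := (null_at (@euclidean_dist R n)).
Implicit Types (E : set Cn) (x y p v : Cn).

Lemma nsq_hdot_le x v : nsq (hdot x v) <= 2 * nrm2 v * nrm2 x.
Proof.
have := Re_hdot_CauchySchwarz x v.
have := Re_hdot_CauchySchwarz ((0 +i* -1) *: x) v.
rewrite hdotZl nrm2Z /nsq !cReImE; lra.
Qed.

Lemma null_at_hdot_slice p v s E (delta : R) : 0 < delta -> null s E ->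
  exists2 c : C, nsq c < delta ^+ 2 & null (s - 2) (E `&` [set z | hdot (z - p) v = c]).
Proof.
move=> d0 nE.
pose L := Num.sqrt (2 * nrm2 v + 1).
have nv := nrm2_ge0 v.
have L0 : 0 < L by rewrite sqrtr_gt0; lra.
have hL x y : nsq (hdot (x - p) v - hdot (y - p) v) <= L ^+ 2 * nrm2 (x - y).
  rewrite -hdotBl opprB addrA subrK sqr_sqrtr; last by lra.
  apply: (le_trans (nsq_hdot_le _ _)); have := nrm2_ge0 (x - y); lra.
have lip := coord_lipschitz (ltW L0) hL.
have ab : - (delta / 2) < delta / 2 by lra.
have [a /andP[a1 a2] na] := null_at_slice euclidean_dist_ge0 L0 (fun x y => (lip x y).1) ab nE.
have [b /andP[b1 b2] nb] := null_at_slice euclidean_dist_ge0 L0 (fun x y => (lip x y).2) ab na.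
exists (a +i* b); first by rewrite /nsq cRe_mk cIm_mk; nra.
have -> : s - 2 = s - 1 - 1 by lra.
congr (null _ _) : nb; apply/seteqP; split=> z /=.
  by move=> [[Ez za] zb]; split=> //; apply: complexP.
by move=> [Ez zc]; rewrite zc cRe_mk cIm_mk.
Qed.

Lemma null_at_hdot_slices (k : nat) p (v : nat -> Cn) s E (delta : R) : 0 < delta -> null s E ->
  exists2 c : nat -> C, forall j, nsq (c j) < delta ^+ 2 &
    null (s - (2 * k)%:R) (E `&` [set z | forall j, (j < k)%N -> hdot (z - p) (v j) = c j]).
Proof.
move=> d0 nE; elim: k => [|k [c hc nc]].
  exists (fun=> 0); first by move=> _; rewrite nsq0 exprn_gt0.
  by rewrite muln0 subr0 (_ : [set z | _] = setT) ?setIT//; apply/seteqP; split.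
have [a ha na] := null_at_hdot_slice p (v k) d0 nc.
exists (fun j => if j == k then a else c j); first by move=> j; case: ifP.
rewrite (_ : s - _ = s - (2 * k)%:R - 2); last by rewrite mulnS natrD; lra.
congr (null _ _) : na; apply/seteqP; split=> z /=.
  move=> [[Ez h] e]; split => // j; rewrite ltnS leq_eqVlt; case: eqP => [->//|_ /= jk]; exact: h.
move=> [Ez h]; split; last by have := h k (ltnSn k); rewrite eqxx.
split=> // j jk; have := h j (ltnW jk); by rewrite ltn_eqF.
Qed.

Lemma nbhs0_coord m (P : set 'rV[C]_m) : nbhs (0 : 'rV[C]_m) P ->
  exists2 delta : R, 0 < delta & forall c : 'rV[C]_m, (forall k, nsq (c 0 k) < delta ^+ 2) -> P c.
Proof.
move=> /nbhs_ballP [e /= e0 he]; have [dl dl0 ed] := pos_complex_real e0.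
exists dl => // c hc; apply: he; split => [//|i j]; rewrite ord1 mxE.
by rewrite -ball_normE /ball_ /= sub0r normrN ed ltr_norm_nsq.
Qed.

End complex_slices.

(** * Dimension of the Shilov boundary *)

Section shilov_slices.
Context {R : realType} {N m q : nat}.
Local Notation C := R[i].
Local Notation CN := 'rV[C]_N.
Local Notation null := (null_at (@euclidean_dist R _)).
Variables (A : 'M[C]_(m, N)) (A' : 'M[C]_(q, N)) (B : 'M[C]_(N, m)) (B' : 'M[C]_(N, q)).
Hypothesis AB : A *m B = 1%:M.
Hypothesis AB' : A *m B' = 0.
Hypothesis A'B' : A' *m B' = 1%:M.
Hypothesis BB' : B *m A + B' *m A' = 1%:M.
Hypothesis mqN : (m + q)%N = N.
Variable K : set CN.
Hypothesis compactK : compact K.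
Hypothesis closedK : closed K.
Local Notation X := (shilov_boundary K (q_holomorphic_on q K)).
Local Notation slice p := (K `&` affine_plane A p).

Lemma shilov_slice_sub p : slice p !=set0 ->
  shilov_boundary (slice p) (holomorphic_on_plane A p (slice p)) `<=` X `&` affine_plane A p.
Proof.
move=> K0 z [[Kz Pz] hz]; split=> //; split=> // S bS.
by have [] := hz _ (slice_closed_boundary AB AB' BB' mqN compactK closedK bS K0).
Qed.

(** The columns of [B'] give q complex functionals. Because [A' *m B' = 1], fixing their levels at c
    amounts to translating the plane by [c *m A']. Satisfying [P] and meeting [D] hold for all small
    c, so the levels can be chosen among these. *)
Lemma null_at_plane_slice (D : set CN) (P : set CN) p s : open D ->
  D `&` affine_plane A p !=set0 -> nbhs (0 : CN) P -> null s X ->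
  exists v, [/\ P v, D `&` affine_plane A (p + v) !=set0 &
    null (s - (2 * q)%:R) (X `&` affine_plane A (p + v))].
Proof.
move=> oD [z [Dz [w _ wz]]] nP nX.
have nDz : nbhs (0 : CN) [set v | D (z + v)].
  have c2 : z + v @[v --> (0 : CN)] --> z + 0.
    have f0 : z @[v --> (0 : CN)] --> z by exact: (@cst_continuous CN CN z 0).
    have f1 : v @[v --> (0 : CN)] --> (0 : CN) by exact: cvg_id.
    exact: (cvgD f0 f1).
  by apply: c2; rewrite addr0; exact: open_nbhs_nbhs.
have nQ : nbhs (0 : 'rV[C]_q) [set c | P (c *m A') /\ D (z + c *m A')].
  have h : nbhs (proj_mx_at 0 A' 0) [set v | P v /\ D (z + v)].
    rewrite /proj_mx_at subrr mul0mx; exact: filterI.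
  have h2 : nbhs (0 : 'rV[C]_q) (proj_mx_at 0 A' @^-1` [set v | P v /\ D (z + v)]).
    exact: proj_mx_at_continuous.
  apply: (@filterS _ (nbhs (0 : 'rV[C]_q)) _ _ _ _ h2) => c /=.
  by rewrite /proj_mx_at subr0.
have [dl dl0 hdl] := nbhs0_coord nQ.
(* Conjugated columns of [B'], so that [hdot] reproduces [*m B']; padded by 0 because
   [null_at_hdot_slices] takes a sequence. *)
pose vv (k : nat) : CN := \row_j (if insub k is Some k' then conjc (B' j k') else 0).
have vvE (k : 'I_q) x : hdot x (vv k) = (x *m B') 0 k.
  rewrite mxE /hdot; apply: eq_bigr => j _; rewrite mxE valK /=; congr (_ * _).
  by apply: complexP; rewrite !cReImE ?opprK.
have [c hc nc] := null_at_hdot_slices q p vv dl0 nX.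
pose cr : 'rV[C]_q := \row_k c k.
have [Pv Dv] : P (cr *m A') /\ D (z + cr *m A') by apply: hdl => k; rewrite mxE.
exists (cr *m A'); split=> //.
  exists (z + cr *m A'); split=> //; exists w => //.
  by rewrite -wz /plane_param addrAC.
congr (null _ _) : nc; congr (_ `&` _); apply/seteqP; split=> x.
  move=> hx; apply/(affine_planeE AB' BB').
  rewrite /proj_mx_at opprD addrA mulmxBl -mulmxA A'B' mulmx1.
  by apply/rowP => k; rewrite !mxE -(hx k (ltn_ord k)) vvE mxE subrr.
move=> /(affine_planeE AB' BB') hx j jq.
move: hx; rewrite /proj_mx_at opprD addrA mulmxBl -mulmxA A'B' mulmx1 => /subr0_eq hx.
by rewrite -[j]/(val (Ordinal jq)) vvE hx mxE.
Qed.

Lemma shilov_dim_slices (D : set CN) p (alpha : R) : open D -> D `<=` K -> 0 <= alpha ->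
  D `&` affine_plane A p !=set0 ->
  (\forall v \near (0 : CN),
    (alpha%:E <= dimH (shilov_boundary (slice (p + v)) (holomorphic_on_plane A (p + v) (slice (p + v)))))%E) ->
  ((alpha + (2 * q)%:R)%:E <= dimH X)%E.
Proof.
move=> oD DK al0 D0 hdim; rewrite leNgt; apply/negP => /ereal_inf_lt [_ [s [s0 hs] <-]].
rewrite lte_fin => s_lt.
have nX : null s X by rewrite /null_at s0.
have [v [hv [z [Dz Pz]] nv]] := null_at_plane_slice oD D0 hdim nX.
have K0 : slice (p + v) !=set0 by exists z; split => //; exact: DK.
have sub := shilov_slice_sub K0.
have clK : closed (slice (p + v)) by apply: (closedI closedK); exact: (plane_closed AB' BB').
have cK : compact (slice (p + v)) by apply: (subclosed_compact clK compactK) => y [].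
have [y Sy] := shilov_boundary_nonempty AB cK (fun y h => h.2) K0.
(* If s - 2q were negative the trace of the boundary would be empty, yet it contains the point
   [y]. *)
move: nv; rewrite /null_at; case: ifP => [t0 h|_ h]; last by have := sub _ Sy; rewrite h.
have : (alpha%:E <= (s - (2 * q)%:R)%:E)%E.
  apply: (le_trans hv); apply: ereal_inf_lbound; exists (s - (2 * q)%:R) => //.
  by split=> //; exact: hausdorff_null_sub h.
by rewrite lee_fin; lra.
Qed.

End shilov_slices.

(** * Two-dimensional coordinate slices and the second bound *)

Section planar_slices.
Context {R : realType} {q : nat}.
Local Notation C := R[i].
Local Notation CN := 'rV[C]_(2 + q).
Local Notation C2 := 'rV[C]_2.
(** The second bound leaves the direction of the slices free; the coordinate one makes [plane_param]
    an isometry, so null sets transfer to C^2 without distortion. *)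
Let A : 'M[C]_(2, 2 + q) := row_mx 1%:M 0.
Let A' : 'M[C]_(q, 2 + q) := row_mx 0 1%:M.
Let B : 'M[C]_(2 + q, 2) := col_mx 1%:M 0.
Let B' : 'M[C]_(2 + q, q) := col_mx 0 1%:M.
Let AB : A *m B = 1%:M. Proof. by rewrite mul_row_col mulmx1 mul0mx addr0. Qed.
Let AB' : A *m B' = 0. Proof. by rewrite mul_row_col mulmx0 mul0mx addr0. Qed.
Let A'B' : A' *m B' = 1%:M. Proof. by rewrite mul_row_col mulmx0 mulmx1 add0r. Qed.
Let BB' : B *m A + B' *m A' = 1%:M.
Proof.
rewrite !mul_col_row !mulmx0 !mul0mx !mulmx1 add_block_mx !addr0 !add0r.
by rewrite -scalar_mx_block.
Qed.

Lemma nrm2_row_mx (w : C2) : nrm2 (w *m A) = nrm2 w.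
Proof.
rewrite mul_mx_row mulmx1 mulmx0 /nrm2 big_split_ord /= [X in _ + X]big1 ?addr0.
  by apply: eq_bigr => j _; rewrite row_mxEl.
by move=> j _; rewrite row_mxEr mxE nsq0.
Qed.

Variable D : set CN.
Hypothesis oD : open D.
Hypothesis D0 : D !=set0.
Hypothesis convD : segment_convex D.
Hypothesis compactK : compact (closure D).
Local Notation K := (closure D).
Local Notation X := (shilov_boundary K (q_holomorphic_on q K)).

Lemma shilov_dim_planar : ((2 * q + 2)%:R%:E <= dimH X)%E.
Proof.
have closedK : closed K by exact: closed_closure.
have closedX : closed X.
  by apply: (closedI closedK); apply: closed_bigI => S [].
rewrite leNgt; apply/negP => /ereal_inf_lt [_ [s [s0 hs] <-]]; rewrite lte_fin natrD => s_lt.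
have nX : null_at (@euclidean_dist R _) s X by rewrite /null_at s0.
have [z0 Dz0] := D0.
have Dp : D `&` affine_plane A z0 !=set0.
  by exists z0; split=> //; exists 0 => //; rewrite /plane_param mul0mx addr0.
have [v [_ [z1 [Dz1 [w1 _ wz1]]] nv]] :=
  null_at_plane_slice AB' A'B' BB' oD Dp filterT nX.
set p := z0 + v in nv wz1.
pose D' : set C2 := plane_param A p @^-1` D.
pose K' : set C2 := plane_param A p @^-1` K.
(* The trace of the whole [X], which inherits nullity from the cut and contains the Shilov boundary
   of the slice. *)
pose X' : set C2 := plane_param A p @^-1` X.
have cp : continuous (plane_param A p) by exact: plane_param_continuous.
have openD' : open D' by apply: open_comp => // y _; exact: cp.
have closedK' : closed K' by apply: closed_comp => // y _; exact: cp.
have closedX' : closed X' by apply: closed_comp => // y _; exact: cp.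
have D'K' : D' `<=` K' by move=> y; exact: (@subset_closure _ D (plane_param A p y)).
have nX' : null_at (@euclidean_dist R 2) (s - (2 * q)%:R) X'.
  have -> : X' = plane_param A p @^-1` (X `&` affine_plane A p).
    by apply/seteqP; split=> y /= => [h|[]//]; split=> //; exists y.
  apply: null_at_preimage nv => [|x y]; first exact: euclidean_dist_ge0.
  rewrite !euclidean_distE -[in LHS]nrm2_row_mx mulmxBl /plane_param.
  by rewrite opprD addrACA subrr add0r.
have compactK' : compact K'.
  apply: (compact_bounded_nrm2 closedK').
  have [M _ hM] : exists2 M : R, True & forall z, K z -> nrm2 (z - p) <= M.
    have [|y] := @compact_EVT_max _ _ (fun y : CN => nrm2 (y - p)) K (ex_intro _ z0 (subset_closure Dz0)) compactK.
      apply: continuous_subspaceT => y.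
      have c1 : {for y, continuous (fun y : CN => y - p)} by exact: rV_subr_continuous.
      exact: (continuous_comp c1 (@nrm2_continuous _ _ _)).
    move=> /set_mem Ky hy; exists (nrm2 (y - p)); first exact: I.
    move=> x Kx; exact: (hy x (mem_set Kx)).
  exists M => w /hM; rewrite /plane_param addrAC subrr add0r; by rewrite nrm2_row_mx.
have compactX' : compact X'.
  by apply: (subclosed_compact closedX' compactK') => y [].
have D'w1 : D' w1 by rewrite /D' /= wz1.
have D'0 : D' !=set0 by exists w1.
have paramD (x y : C2) (t : C) : plane_param A p (x + t *: (y - x)) =
    plane_param A p x + t *: (plane_param A p y - plane_param A p x).
  rewrite /plane_param opprD addrACA subrr add0r -mulmxBl mulmxDl scalemxAl; exact: addrA.
have convK : segment_convex K by exact: closure_convex.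
have convK' : segment_convex K'.
  move=> x y t Kx Ky t01; have h := convK (plane_param A p x) (plane_param A p y) t Kx Ky t01.
  by rewrite -paramD in h; exact: h.
have D'K'_segment (z y : C2) (t : R) : D' z -> K' y -> 0 <= t < 1 -> D' (z + t%:C *: (y - z)).
  move=> Dz Ky t01; have h := closure_segment convD oD Dz Ky t01.
  by rewrite -paramD in h; exact: h.
pose Kp := K `&` affine_plane A p.
have closedKp : closed Kp by apply: (closedI closedK); exact: (plane_closed AB' BB').
have compactKp : compact Kp by apply: (subclosed_compact closedKp compactK) => y [].
have Kp0 : Kp !=set0.
  by exists z1; split; [exact: subset_closure|exists w1].
have K'E w : K' w <-> Kp (plane_param A p w).
  by split=> [h|[]//]; split=> //; exists w.
(* [leaf_boundary] speaks of all closed boundaries; applied to [Kp] itself it places the point in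
   [K]. *)
have boundaryKp : closed_boundary Kp (holomorphic_on_plane A p Kp) Kp.
  split=> [//|//|f [cf _]].
  have cnf : {within Kp, continuous (fun z => nsq (f z))}.
    by move=> x; exact: (continuous_comp (cf x) (@nsq_continuous R _)).
  have [z] := compact_EVT_max Kp0 compactKp cnf.
  move=> /set_mem Kz hz; exists z; first exact: Kz.
  move=> w Kw; rewrite ler_norm_nsq; exact: (hz w (mem_set Kw)).
have leaf (p' : C2) : K' p' -> ~ D' p' -> exists2 d : C2, d != 0 &
    (forall t : C, ~ D' (p' + t *: d)) /\
    forall u : C, u != 0 -> exists2 r : R, 0 <= r & X' (p' + (r%:C * u) *: d).
  move=> Kp' Dp'.
  have [d d0 [hD hS]] := leaf_boundary AB compactKp (fun y h => h.2) K'E compactK' closedK'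
    convK' openD' D'K' D'0 D'K'_segment Kp' Dp'.
  exists d; first exact: d0.
  split; first exact: hD.
  move=> u u0; have [r r0 hr] := hS u u0; exists r; first exact: r0.
  split; first exact: (hr _ boundaryKp).1.
  move=> S bS.
  exact: (hr _ (slice_closed_boundary AB AB' BB' erefl compactK closedK bS Kp0)).1.
have nD' : nbhs (0 : C2) [set y | D' (w1 + y)].
  have c2 : w1 + y @[y --> (0 : C2)] --> w1 + 0.
    have f0 : w1 @[y --> (0 : C2)] --> w1 by exact: (@cst_continuous C2 C2 w1 0).
    have f1 : y @[y --> (0 : C2)] --> (0 : C2) by exact: cvg_id.
    exact: (cvgD f0 f1).
  by apply: c2; rewrite addr0; exact: open_nbhs_nbhs.
have [dl dl0 hdl] := nbhs0_coord nD'.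
have dl2 : 0 < dl / 2 by rewrite divr_gt0.
have [c hc nc] := null_at_hdot_slice w1 (delta_mx 0 0 : C2) dl2 nX'.
have hdot0 (x : C2) : hdot x (delta_mx 0 0) = x 0 0.
  by rewrite /hdot sum_ord2 !mxE !eqxx; apply: complexP; rewrite !cReImE; ring.
(* The exponent s - 2q - 2 is negative, so [nc] says that [X'] does not meet the line. *)
have avoid w : X' w -> w 0 0 != w1 0 0 + c.
  move=> Xw; apply/eqP => e; move: nc; rewrite /null_at ifN -?ltNge; last by lra.
  move=> /seteqP[h _]; apply: (h w); split=> //=.
  by rewrite hdot0 !mxE e addrAC subrr add0r.
(* Radius dl/4 about the shifted centre: with |a|^2 <= dl^2/16 and |c|^2 < dl^2/4, |a + c|^2 <=
   2|a|^2 + 2|c|^2 stays below dl^2. *)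
have ballD' (w : C2) : nsq (w 0 0 - (w1 0 0 + c)) + nsq (w 0 1 - w1 0 1) <= (dl / 4) ^+ 2 -> D' w.
  move=> h; have -> : w = w1 + (w - w1) by rewrite addrC subrK.
  set y := w - w1; apply: hdl => k.
  have y0 : y 0 0 = w 0 0 - (w1 0 0 + c) + c by rewrite !mxE opprD addrA subrK.
  have y1 : y 0 1 = w 0 1 - w1 0 1 by rewrite !mxE.
  rewrite -y1 in h; set a := w 0 0 - _ in h y0.
  have dd : 0 < dl ^+ 2 by rewrite exprn_gt0.
  have ha := nsq_ge0 a; have hb := nsq_ge0 (y 0 1).
  have hac : nsq (a + c) <= 2 * nsq a + 2 * nsq c.
    by rewrite -subr_ge0 (_ : _ - _ = nsq (a - c)) ?nsq_ge0//; rewrite /nsq !cReImE; ring.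
  have [->|->] : k = 0 \/ k = 1; last by lra.
    have [->|k0] := eqVneq k 0; first by left.
    by right; case: k k0 => -[|[|//]] h' // _; exact: val_inj.
  by rewrite y0; move: hc; lra.
have s2 : s - (2 * q)%:R < 2 by lra.
have dl4 : 0 < dl / 4 by rewrite divr_gt0.
(* Raising the exponent to at least 1 preserves nullity and also covers a negative s - 2q, for which
   [X'] is empty. *)
pose s' := Num.max (s - (2 * q)%:R) 1.
have s'12 : 1 <= s' < 2 by rewrite le_max lexx orbT gt_max s2; lra.
apply: (boundary_not_null compactK' closedK' compactX' openD' D'K' avoid dl4 ballD' leaf s'12).
apply: (null_at_le euclidean_dist_ge0 _ _ nX'); first by rewrite le_max lexx.
by rewrite le_max ler01 orbT.
Qed.

End planar_slices.

Theorem theorem7p3 (R : realType) (N : nat) (hN : (2 <= N)%N)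
    (D : set 'rV[R[i]]_N) (hD : convex_bounded_domain D) :
  (forall (q : nat) (hq : (q <= N - 2)%N) (alpha : R) (halpha : 0 <= alpha)
      (A : 'M[R[i]]_(N - q, N)) (hA : row_free A) (p0 : 'rV[R[i]]_N)
      (hmeet : D `&` affine_plane A p0 !=set0)
      (hdim : \forall v \near (0 : 'rV[R[i]]_N),
         let K := closure D `&` affine_plane A (p0 + v) in
         (alpha%:E <=
            dimH (shilov_boundary K (holomorphic_on_plane A (p0 + v) K)))%E),
     ((alpha + (2 * q)%:R)%:E <=
        dimH (shilov_boundary (closure D) (q_holomorphic_on q (closure D))))%E)
  /\
  ((2 * N - 2)%:R%:E <=
     dimH (shilov_boundary (closure D)
             (q_holomorphic_on (N - 2) (closure D))))%E.
Proof.
have [oD _ D0 cvD bD] := hD.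
have convD := convex_set_segment cvD.
have compK : compact (closure D).
  exact: bounded_closure_compact.
split.
  move=> q hq alpha al0 A hA p0 hmeet hdim.
  have mqN : (N - q + q = N)%N by rewrite subnK// (leq_trans hq)// leq_subr.
  have [A' [B [B' [AB AB' _ A'B' BB']]]] := row_free_complement hA mqN.
  exact: (shilov_dim_slices AB AB' A'B' BB' mqN compK (@closed_closure _ D) oD (@subset_closure _ D) al0 hmeet hdim).
case: N hN D hD oD D0 cvD bD convD compK => [//|[//|q]] _ D _ oD D0 _ _ convD compK.
have -> : (q.+2 - 2 = q)%N by rewrite !subSS subn0.
have -> : (2 * q.+2 - 2 = 2 * q + 2)%N by lia.
exact: (shilov_dim_planar oD D0 convD compK).
Qed.
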